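(* Let $\tilde W_m := W_{T_m}$. (a) For every $d \ge 1$, $\dfrac{\tilde W_m}{\ln m} \to 1 - d^{-1}$ in probability as $m \to \infty$. (b) If $d \ge 2$, then almost surely \[ \liminf_{m\to\infty} \frac{\tilde W_m}{\ln m} = 1 - d^{-1}, \qquad \limsup_{m\to\infty} \frac{\tilde W_m}{\ln m} = 1; \] in particular $\tilde W_m = \Theta(\ln m)$ almost surely.
   Context: Fix an integer $d \ge 1$. Let $X^{(1)}, X^{(2)}, \dots$ be i.i.d. random vectors in $\mathbb{R}^d$ with independent Exponential$(1)$ coordinates. For $x,y \in \mathbb{R}^d$ write $x \prec y$ if $x_j<y_j$ for all $j$, $x \le y$ if $x_j \le y_j$ for all $j$, and $x_+ := \sum_j x_j$. The record-setting region at time $n$ is $\mathrm{RS}_n := \{x \in \mathbb{R}^d : 0 \le x,\ x \not\prec X^{(i)} \text{ for all } 1 \le i \le n\}$, with frontier $F_n$ (its topological boundary relative to $[0,\infty)^d$). Define $F_n^- := \min\{x_+ : x \in F_n\}$, $F_n^+ := \max\{x_+ : x \in F_n\}$, and $W_n := F_n^+ - F_n^-$. $X^{(k)}$ is a (Pareto) record if $X^{(k)} \not\prec X^{(i)}$ for all $1 \le i < k$, and $T_m$ is the index at which the $m$th record is set. *)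

(* Defs.v *)
From HB Require Import structures.
From mathcomp Require Import all_boot all_order all_algebra.
From mathcomp Require Import all_classical all_reals all_analysis.
Set Implicit Arguments. Unset Strict Implicit. Unset Printing Implicit Defensive.
Import Order.TTheory GRing.Theory Num.Theory.
Import numFieldNormedType.Exports.
Local Open Scope classical_set_scope.
Local Open Scope ring_scope.

Section defs.
Context {R : realType} {d0 : measure_display} {Omega : measurableType d0}.

Definition mutually_independent (P : probability Omega R) (I : eqType)
    (Y : I -> Omega -> R) : Prop :=
  forall (J : seq I) (B : I -> set R), uniq J ->
    (forall i, i \in J -> measurable (B i)) ->
    P (\bigcap_(i in [set` J]) (Y i @^-1` B i)) =
    (\prod_(i <- J) fine (P (Y i @^-1` B i)))%:E.

Variable d : nat.
Variable X : nat -> 'I_d -> Omega -> R.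

Definition orthant : set 'rV[R]_d := [set x | forall j, 0 <= x ord0 j].
Definition RS (n : nat) (w : Omega) : set 'rV[R]_d :=
  [set x | (forall j, 0 <= x ord0 j) /\
     (forall i, (i < n)%N -> ~ (forall j, x ord0 j < X i j w))].
Definition frontier n w : set 'rV[R]_d :=
  closure (RS n w) `&` closure (orthant `\` RS n w).
Definition coord_sum (x : 'rV[R]_d) : R := \sum_(j < d) x ord0 j.
Definition Fminus n w : R := inf [set coord_sum x | x in frontier n w].
Definition Fplus n w : R := sup [set coord_sum x | x in frontier n w].
Definition Wn n w : R := Fplus n w - Fminus n w.
Definition is_record (w : Omega) (k : nat) : Prop :=
  forall i, (i < k)%N -> ~ (forall j, X k j w < X i j w).
Definition nrecords (w : Omega) (n : nat) : nat :=
  \sum_(k < n) (asbool (is_record w k) : nat).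
Definition Trec (m : nat) (w : Omega) : nat :=
  match pselect (exists n, (m <= nrecords w n)%N) with
  | left h => ex_minn h
  | right _ => 0%N
  end.
Definition Wtilde (m : nat) (w : Omega) : R := Wn (Trec m w) w.
End defs.

(* Main.v *)
Require Import Defs.
From HB Require Import structures.
From mathcomp Require Import all_boot all_order all_algebra.
From mathcomp Require Import all_classical all_reals all_analysis.
From mathcomp Require Import measurable_realfun ring lra zify.
Set Implicit Arguments. Unset Strict Implicit. Unset Printing Implicit Defensive.
Import Order.TTheory GRing.Theory Num.Theory.
Import numFieldNormedType.Exports.
Local Open Scope classical_set_scope.
Local Open Scope ring_scope.

(** Write d = e + 1, l = ln n and u = ln (ln n).  For d = 1 the frontier has at
    most one point, so let d >= 2.  Then F_n^+ is the largest coordinate sum of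
    the first n vectors, a maximum of Gamma(d) variables, and union bounds and
    independence along n = 2^k give, almost surely, F_n^- = l + o(u), F_n^+
    eventually between l + (e - o(1)) u and l + (d + o(1)) u, the latter order
    being attained infinitely often, and l^(d - o(1)) <= R_n <= l^(d + o(1)) for
    the number R_n of records.  Hence ln m ~ d u at n = T_m, which yields
    part (b) except for the upper bound on the lower limit; that bound follows
    from part (a).

    For the remaining half of (a), F^+ <= l + (e + o(1)) u at the random time
    T_m, suppose it fails.  The maximum is then attained at an index k shortly
    before T_m, so R_k = m - r with r at most 1 plus the number of high vectors
    soon after k.  The vector X^(k), the past of k (which determines R_k) and its
    future are independent, and the probability that X^(k) is so large is
    O(l^-c / k).  At least l^(e - o(1)) disjoint boxes of probability
    l^(-o(1)) / k are free at time k, so that the record probability at time k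
    given the past is at least l^(e - o(1)) / k; since exactly one record has rank
    m - r + 1, the sum over k of P(R_k = m - r) / k is at most l^(-e + o(1)).
    Summing over r gives the bound l^(-c + o(1)). *)

(** * Real-valued probabilities and eventual properties *)

(** At a fixed n the bound on F_n^+ in probability is a plain union bound. At T_m it is not: ln T_m
    is only located between m^(1/(d + eta)) and m^(1/(d - eta)), and for small c the sum of l^-c / k
    over such a range is a positive power of l. The factor P(R_k = m - r) must therefore be kept. No
    local estimate of the law of R_k is proved; the record probability given the past serves as a
    weight that makes these factors summable.

    A lower bound for that weight must hold outside an event so rare that a sum over all k survives.
    A cell at level l + c u is hit with probability at most l^-c, which is too large for a union
    bound over about l^e cells. Hence cells come in blocks of r, with mesh of order u so that one
    vector hardly ever hits two of them, and each block is asked for one free cell only; c r > e + 3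
    then beats the number of blocks.

    Properties at the random index T_m are not shown to be measurable, so every asymptotic statement
    is phrased through measurable exceptional sets. *)

Section real_probability.
Context {R : realType} {d0 : measure_display} {Omega : measurableType d0}.
Variable P : probability Omega R.
Implicit Types A B V : set Omega.

(** Real-valued, so that the ordered-field lemmas and [lra] apply; [PrE] leads back to [P] on
    measurable sets. *)
Definition Pr A : R := fine (P A).

Lemma PrE A : measurable A -> P A = (Pr A)%:E.
Proof. by move=> mA; rewrite /Pr fineK// fin_num_measure. Qed.

Lemma Pr_ge0 A : 0 <= Pr A.
Proof. by rewrite /Pr fine_ge0. Qed.

Lemma Pr_le1 A : measurable A -> Pr A <= 1.
Proof. by move=> mA; rewrite -lee_fin -PrE// probability_le1. Qed.

Lemma le_Pr A B : measurable A -> measurable B -> A `<=` B -> Pr A <= Pr B.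
Proof. by move=> mA mB AB; rewrite -lee_fin -!PrE// le_measure// inE. Qed.

Lemma PrC A : measurable A -> Pr (~` A) = 1 - Pr A.
Proof.
move=> mA; apply: EFin_inj; rewrite -PrE//; last exact: measurableC.
by rewrite probability_setC// EFinB PrE.
Qed.

Lemma Pr0 : Pr set0 = 0.
Proof. by rewrite /Pr measure0. Qed.

Lemma Pr_setU A B : measurable A -> measurable B -> A `&` B = set0 ->
  Pr (A `|` B) = Pr A + Pr B.
Proof.
move=> mA mB AB; apply: EFin_inj; rewrite -PrE ?EFinD; last exact: measurableU.
by rewrite measureU//; congr (_ + _)%E; exact: PrE.
Qed.

Lemma Pr_setD A B : measurable A -> measurable B -> B `<=` A ->
  Pr (A `\` B) = Pr A - Pr B.
Proof.
move=> mA mB BA; apply/eqP; rewrite eq_sym subr_eq; apply/eqP.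
rewrite -Pr_setU//; last 2 first.
- exact: measurableD.
- by apply/seteqP; split=> // w [[]].
by congr Pr; apply/seteqP; split=> [w Aw|w [[]//|/BA//]];
  have [Bw|nBw] := pselect (B w); [right|left].
Qed.

Lemma Pr_setU_le A B : measurable A -> measurable B ->
  Pr (A `|` B) <= Pr A + Pr B.
Proof.
move=> mA mB; rewrite -lee_fin EFinD -!PrE//; first exact: measureU2.
exact: measurableU.
Qed.

Lemma Pr_union_bound (I : eqType) (r : seq I) (F : I -> set Omega) A :
  measurable A -> (forall i, i \in r -> measurable (F i)) ->
  (forall w, A w -> exists2 i, i \in r & F i w) ->
  Pr A <= \sum_(i <- r) Pr (F i).
Proof.
elim: r A => [|i r IH] A mA mF AF.
  rewrite big_nil (_ : A = set0) ?Pr0//.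
  by apply/seteqP; split=> // w /AF[].
rewrite big_cons.
have mFi : measurable (F i) by apply: mF; rewrite mem_head.
have mD : measurable (A `\` F i) by exact: measurableD.
apply: (@le_trans _ _ (Pr (F i `|` (A `\` F i)))).
  apply: le_Pr => //; first exact: measurableU.
  by move=> w Aw; have [Fw|nFw] := pselect (F i w); [left|right].
apply: le_trans (Pr_setU_le mFi mD) _; rewrite lerD2l; apply: IH => //.
  by move=> j jr; apply: mF; rewrite inE jr orbT.
move=> w [/AF[j]]; rewrite inE => /orP[/eqP->//|jr Fj _].
by exists j.
Qed.

Lemma Pr_disjoint_sum (I : eqType) (r : seq I) (F : I -> set Omega) A :
  uniq r -> measurable A -> (forall i, i \in r -> measurable (F i)) ->
  (forall i j w, F i w -> F j w -> i = j) ->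
  (forall i, i \in r -> F i `<=` A) ->
  \sum_(i <- r) Pr (F i) <= Pr A.
Proof.
elim: r A => [|i r IH] A; first by rewrite big_nil Pr_ge0.
move=> /= /andP[ir ur] mA mF dF FA; rewrite big_cons.
have mFi : measurable (F i) by apply: mF; rewrite mem_head.
have FiA : F i `<=` A by apply: FA; rewrite mem_head.
rewrite addrC -lerBrDr -Pr_setD//; apply: IH => //.
- exact: measurableD.
- by move=> j jr; apply: mF; rewrite inE jr orbT.
move=> j jr w Fj; split; first by apply: FA Fj; rewrite inE jr orbT.
by move=> /dF /(_ Fj) ij; rewrite ij jr in ir.
Qed.

Lemma Pr_bigcup_le (F : nat -> set Omega) (b : R) :
  (forall k, measurable (F k)) ->
  (forall n, \sum_(k < n) Pr (F k) <= b) -> Pr (\bigcup_k F k) <= b.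
Proof.
move=> mF Fb; rewrite -lee_fin -PrE; last exact: bigcupT_measurable.
apply: (@le_trans _ _ (\sum_(0 <= k <oo) P (F k))%E).
  by apply: measure_sigma_subadditive => //; exact: bigcupT_measurable.
apply: lime_le; first exact: is_cvg_nneseries.
near=> n; rewrite big_mkord (eq_bigr (fun k : 'I_n => (Pr (F k))%:E)).
  by rewrite sumEFin lee_fin; exact: Fb.
by move=> k _; rewrite PrE.
Unshelve. all: by end_near.
Qed.

(** Markov's inequality for a sum of indicators, integrated over [A]; the events [F i] need not be
    independent. *)
Lemma markov_count (I : Type) (r : seq I) (F : I -> set Omega) (t : nat) A :
  measurable A -> (forall i, measurable (F i)) ->
  (forall w, A w -> (t <= \sum_(i <- r) (asbool (F i w) : nat))%N) ->
  t%:R * Pr A <= \sum_(i <- r) Pr (F i).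
Proof.
move=> mA mF AF.
have mi i : measurable_fun setT (EFin \o (\1_(F i) : Omega -> R)).
  by apply/measurable_EFinP; apply: measurable_indic; exact: mF.
rewrite -lee_fin EFinM -PrE// -integral_cst// -sumEFin.
rewrite [leRHS](_ : _ = (\sum_(i <- r) \int[P]_w (\1_(F i) w)%:E)%E); last first.
  by apply: eq_bigr => i _; rewrite integral_indic// setIT; exact/esym/PrE.
rewrite -ge0_integral_sum//.
apply: (@le_trans _ _ (\int[P]_(w in A)
   (\sum_(i <- r) (\1_(F i) w)%:E))%E); last first.
  apply: ge0_subset_integral => //.
    by apply: emeasurable_sum => i; exact: mi.
  by move=> w _; apply: sume_ge0 => i _; rewrite lee_fin.
apply: ge0_le_integral => //.
- by move=> w _; rewrite lee_fin.
- by apply: emeasurable_sum => i; apply: measurable_funTS; exact: mi.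
move=> w Aw; rewrite sumEFin lee_fin.
rewrite (eq_bigr (fun i => (asbool (F i w) : nat)%:R)).
  by rewrite -natr_sum ler_nat AF.
by move=> i _; rewrite indicE; congr (_%:R); congr nat_of_bool; exact: asbool_equiv_eq.
Qed.

(** The Egorov form of an almost sure eventual property: off a set of small probability the
    threshold is deterministic. It requires no measurability of [Q], implies both the almost sure
    statement ([ev_ae]) and the one in probability ([ev_whp]), and can be transferred path by path
    to random times. *)
Definition almost_uniformly_eventually (Q : nat -> Omega -> Prop) :=
  forall eps : R, 0 < eps -> exists N V,
    [/\ measurable V, Pr V <= eps &
      forall w, ~ V w -> forall n, (N <= n)%N -> Q n w].

Local Notation ev := almost_uniformly_eventually.

Lemma ev_and (Q1 Q2 : nat -> Omega -> Prop) :
  ev Q1 -> ev Q2 -> ev (fun n w => Q1 n w /\ Q2 n w).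
Proof.
move=> h1 h2 eps eps0.
have e2 : 0 < eps / 2 by rewrite divr_gt0.
have [N1 [V1 [m1 p1 q1]]] := h1 _ e2; have [N2 [V2 [m2 p2 q2]]] := h2 _ e2.
exists (maxn N1 N2), (V1 `|` V2); split; first exact: measurableU.
  by apply: le_trans (Pr_setU_le m1 m2) _; rewrite [leRHS]splitr lerD.
move=> w /not_orP[n1 n2] n; rewrite geq_max => /andP[N1n N2n].
by split; [exact: q1|exact: q2].
Qed.

Lemma ev_imp (Q1 Q2 : nat -> Omega -> Prop) (n0 : nat) :
  (forall w n, (n0 <= n)%N -> Q1 n w -> Q2 n w) -> ev Q1 -> ev Q2.
Proof.
move=> h h1 eps /h1[N [V [mV pV qV]]]; exists (maxn N n0), V; split=> //.
move=> w nV n; rewrite geq_max => /andP[Nn n0n].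
by apply: h => //; exact: qV.
Qed.

(** The exceptional set is kept and only the threshold changes, by a pathwise argument. This carries
    properties of all large n over to the random index [Trec m]. *)
Lemma ev_shift (Q1 Q2 : nat -> Omega -> Prop) :
  (forall N, exists N', forall w, (forall n, (N <= n)%N -> Q1 n w) ->
     forall n, (N' <= n)%N -> Q2 n w) -> ev Q1 -> ev Q2.
Proof.
move=> h h1 eps /h1[N [V [mV pV qV]]]; have [N' hN'] := h N.
by exists N', V; split=> // w nV n N'n; apply: hN' (qV w nV) _ N'n.
Qed.

Lemma ev_ae_cst (Q : Omega -> Prop) : {ae P, forall w, Q w} ->
  ev (fun _ => Q).
Proof.
move=> [V [mV PV QV]] eps eps0; exists 0%N, V; split=> //.
  by rewrite /Pr PV ltW.
by move=> w nV n _; apply: contrapT => nQ; apply: nV; exact: QV.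
Qed.

Lemma ev_ae (Q : nat -> Omega -> Prop) : ev Q ->
  {ae P, forall w, exists N, forall n, (N <= n)%N -> Q n w}.
Proof.
move=> evQ.
have /choice[NV hNV] k : exists NV : nat * set Omega,
    [/\ measurable NV.2, Pr NV.2 <= k.+1%:R^-1 &
      forall w, ~ NV.2 w -> forall n, (NV.1 <= n)%N -> Q n w].
  have [|N [V hV]] := evQ k.+1%:R^-1; first by rewrite invr_gt0.
  by exists (N, V).
have mV : measurable (\bigcap_k (NV k).2).
  by apply: bigcapT_measurable => k; case: (hNV k).
exists (\bigcap_k (NV k).2); split=> //.
  rewrite PrE//; congr EFin; apply/eqP; rewrite eq_le Pr_ge0 andbT.
  apply/ler_addgt0Pl => e e0; rewrite addr0.
  have [k ke] := ltr_add_invr e0.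
  have [mk pk _] := hNV k.
  apply: le_trans (le_trans pk (ltW _)); last by rewrite add0r in ke.
  by apply: le_Pr => // w; exact.
move=> w nQ k _; apply: contrapT => nV; apply: nQ.
by have [_ _ q] := hNV k; exists (NV k).1 => n; exact: q.
Qed.

(** Convergence in outer probability: the failure of [Q m] is only required to lie in a measurable
    set of small probability. *)
Definition whp (Q : nat -> Omega -> Prop) :=
  forall eps : R, 0 < eps -> exists N, forall m, (N <= m)%N ->
    exists V, [/\ measurable V, Pr V <= eps & forall w, ~ V w -> Q m w].

Lemma ev_whp Q : ev Q -> whp Q.
Proof.
move=> h eps /h[N [V [mV pV qV]]]; exists N => m Nm; exists V; split=> // w nV.
exact: qV.
Qed.

Lemma whp_and Q1 Q2 : whp Q1 -> whp Q2 -> whp (fun n w => Q1 n w /\ Q2 n w).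
Proof.
move=> h1 h2 eps eps0.
have e2 : 0 < eps / 2 by rewrite divr_gt0.
have [N1 q1] := h1 _ e2; have [N2 q2] := h2 _ e2.
exists (maxn N1 N2) => m; rewrite geq_max => /andP[N1m N2m].
have [V1 [m1 p1 r1]] := q1 _ N1m; have [V2 [m2 p2 r2]] := q2 _ N2m.
exists (V1 `|` V2); split; first exact: measurableU.
  by apply: le_trans (Pr_setU_le m1 m2) _; rewrite [leRHS]splitr lerD.
by move=> w /not_orP[n1 n2]; split; [exact: r1|exact: r2].
Qed.

Lemma whp_imp (Q1 Q2 : nat -> Omega -> Prop) (n0 : nat) :
  (forall w n, (n0 <= n)%N -> Q1 n w -> Q2 n w) -> whp Q1 -> whp Q2.
Proof.
move=> h h1 eps /h1[N q]; exists (maxn N n0) => m.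
rewrite geq_max => /andP[Nm n0m]; have [V [mV pV qV]] := q _ Nm.
by exists V; split=> // w nV; apply: h => //; exact: qV.
Qed.

(** The sets given by [whp] depend on [eps], whereas a single sequence is wanted. For each m a
    measurable cover is chosen whose probability is within 1 / (m + 1) of the infimum over all
    covers, so it is almost as good as any of them. *)
Lemma whp_cover (Q : nat -> Omega -> Prop) : whp Q ->
  exists B : nat -> set Omega,
    (forall m, measurable (B m) /\ [set w | ~ Q m w] `<=` B m) /\
    (fun m => P (B m)) @ \oo --> 0%E.
Proof.
move=> hQ.
have hB (m : nat) : exists B, [/\ measurable B, [set w | ~ Q m w] `<=` B &
    forall B', measurable B' -> [set w | ~ Q m w] `<=` B' ->
      Pr B <= Pr B' + m.+1%:R^-1].
  pose S := [set Pr B | B in [set B | measurable B /\ [set w | ~ Q m w] `<=` B]].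
  have iS : has_inf S.
    split; last by exists 0 => _ [B _ <-]; exact: Pr_ge0.
    by exists (Pr setT), setT.
  have [|x [B [mB QB] <-] xe] := @inf_adherent _ S m.+1%:R^-1 _ iS.
    by rewrite invr_gt0.
  exists B; split=> // B' mB' QB'; apply: le_trans (ltW xe) _.
  by rewrite lerD2r; apply: ge_inf; [case: iS|exists B'].
have /choice[B BP] := hB; exists B; split; first by move=> m; have [] := BP m.
have -> : (fun m => P (B m)) = (fun m => (Pr (B m))%:E).
  by apply/funext => m; rewrite PrE//; have [] := BP m.
apply: cvg_EFin; first by near=> m.
apply/cvgrPdist_le => eps eps0; rewrite /=.
have [|N hN] := hQ (eps / 2); first by rewrite divr_gt0.
near=> m; rewrite sub0r normrN ger0_norm ?Pr_ge0//.
have [|V [mV pV qV]] := hN m; first by near: m; exact: nbhs_infty_ge.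
have [_ _ /(_ V mV)] := BP m; move=> h.
apply: (@le_trans _ _ (eps / 2 + eps / 2)); last by rewrite -splitr.
apply: le_trans (h _) _.
  by move=> w /= nQ; apply: contrapT => nV; apply: nQ; exact: qV.
rewrite lerD//; near: m.
have e20 : 0 < eps / 2 by rewrite divr_gt0.
have [k ke] := ltr_add_invr e20.
rewrite add0r in ke.
near=> m; apply: le_trans (ltW ke); rewrite lef_pV2 ?posrE// ler_nat ltnS.
by near: m; exact: nbhs_infty_ge.
Unshelve. all: by end_near.
Qed.

(** The sum telescopes: c k^-(1 + c) <= (k - 1)^-c - k^-c, by 1 + y <= e^y and ln (1 + y) <= y. *)
Lemma sum_powR_le (c : R) (K n : nat) : 0 < c -> (1 < K)%N ->
  \sum_(k < n) ((K + k)%:R : R) `^ (- (1 + c)) <= (K.-1%:R : R) `^ (- c) / c.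
Proof.
move=> c0 K1; rewrite ler_pdivlMr// mulrC mulr_sumr.
have step (k : nat) : (1 < k)%N ->
    c * (k%:R : R) `^ (- (1 + c)) <= k.-1%:R `^ (- c) - k%:R `^ (- c).
  case: k => [//|k]; rewrite ltnS => k0 /=.
  have kR : 0 < (k%:R : R) by rewrite ltr0n.
  have k1R : 0 < (k.+1%:R : R) by rewrite ltr0n.
  rewrite opprD powRD; last by apply/implyP => _; rewrite gt_eqF.
  rewrite powR_inv1 ?ler0n// mulrA lerBrDr.
  rewrite -[X in _ + X <= _]mul1r -mulrDl.
  rewrite -ler_pdivlMr ?powR_gt0// -powRN opprK.
  have -> : (k%:R : R) `^ (- c) * k.+1%:R `^ c = expR (c * ln (k.+1%:R / k%:R)).
    rewrite /powR !gt_eqF// -expRD; congr expR.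
    by rewrite ln_div ?posrE//; ring.
  apply: le_trans (expR_ge1Dx _); rewrite addrC lerD2l ler_pM2l//.
  have -> : k.+1%:R / k%:R = (1 - k.+1%:R^-1 : R)^-1.
    have -> : 1 - k.+1%:R^-1 = k%:R / k.+1%:R :> R; last by rewrite invf_div.
    rewrite -[X in X - _](divff (lt0r_neq0 k1R)) -[X in _ / _ - X]mul1r.
    by rewrite -mulrBl -natr1 addrK.
  rewrite lnV ?posrE; last by rewrite subr_gt0 invf_lt1// ltr1n.
  by rewrite lerNr; apply: le_ln1Dx; rewrite ltrN2 invf_lt1// ltr1n.
apply: (@le_trans _ _ (K.-1%:R `^ (- c) - (K + n).-1%:R `^ (- c))); last first.
  by rewrite lerBlDr lerDl powR_ge0.
elim: n => [|n IH]; first by rewrite big_ord0 addn0 subrr.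
rewrite big_ord_recr /=; apply: le_trans (lerD IH (step _ _)) _.
  by rewrite (leq_trans K1)// leq_addr.
by rewrite addrA subrK addnS.
Qed.

(** The explicit tail of the series yields a threshold for each [eps], hence the almost uniform
    conclusion. *)
Lemma borel_cantelli_powR (U : nat -> set Omega) (C c : R) (k0 : nat) :
  0 < c -> (forall k, measurable (U k)) ->
  (forall k, (k0 <= k)%N -> Pr (U k) <= C * k%:R `^ (- (1 + c))) ->
  ev (fun k w => ~ U k w).
Proof.
move=> c0 mU PU eps eps0.
have C0 : 0 <= C.
  have := le_trans (Pr_ge0 _) (PU k0.+1 (leqnSn _)).
  by rewrite pmulr_lge0// powR_gt0// ltr0n.
have [K [K1 Kk0 Ke]] : exists K, [/\ (1 < K)%N, (k0 <= K)%N &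
    C * ((K.-1%:R : R) `^ (- c) / c) <= eps].
  (* Adding 1 keeps the divisor positive when [C] is 0. The number [x] below solves x^-c = eps c /
     (C + 1). *)
  have e0 : 0 < eps * c / (C + 1) by rewrite divr_gt0 ?mulr_gt0// ltr_wpDl.
  pose x := (eps * c / (C + 1)) `^ (- c^-1).
  pose K := (maxn k0 (Num.trunc x).+2).+1.
  exists K; split.
  - by rewrite ltnS leq_max orbT.
  - by rewrite ltnW// ltnS leq_maxl.
  have xK : x <= K.-1%:R.
    apply: le_trans (ltW (truncnS_gt x)) _; rewrite ler_nat.
    by rewrite (leq_trans (leqnSn _))// leq_maxr.
  have x0 : 0 < x by rewrite powR_gt0.
  have : (K.-1%:R : R) `^ (- c) <= eps * c / (C + 1).
    have -> : eps * c / (C + 1) = (x `^ c)^-1.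
      by rewrite /x -powRrM mulNr mulVf ?gt_eqF// powRN powRr1 ?invrK// ltW.
    have K0 := lt_le_trans x0 xK.
    rewrite powRN lef_pV2 ?posrE ?powR_gt0//.
    by apply: ge0_ler_powR; rewrite ?nnegrE ?(ltW c0) ?(ltW x0) ?ler0n.
  move=> h; rewrite mulrA ler_pdivrMr//.
  apply: le_trans (ler_wpM2l C0 h) _.
  by rewrite mulrA ler_pdivrMr ?ltr_wpDl// mulrC; apply: ler_wpM2l; [nra|lra].
exists K, (\bigcup_k U (K + k)%N); split.
- by apply: bigcupT_measurable => k.
- apply: Pr_bigcup_le => // n; apply: le_trans Ke.
  apply: le_trans (ler_wpM2l C0 (sum_powR_le n c0 K1)).
  rewrite mulr_sumr; apply: ler_sum => k _; apply: PU.
  by rewrite (leq_trans Kk0)// leq_addr.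
- move=> w nU n Kn Uw; apply: nU; exists (n - K)%N => //.
  by rewrite subnKC.
Qed.

End real_probability.

(** * Independence of past and future *)

Section independence.
Context {R : realType} {d0 : measure_display} {Omega : measurableType d0}.
Context {P : probability Omega R} {d : nat} {X : nat -> 'I_d -> {RV P >-> R}}.
Implicit Types S : set nat.

(** The pi-system that generates [history S]. All sets [B kj] are measurable, also off [J], so that
    two index lists can be merged without side conditions. *)
Definition cylinder S : set (set Omega) := [set A | exists J B,
  [/\ uniq J, forall kj : nat * 'I_d, kj \in J -> S kj.1,
      forall kj : nat * 'I_d, measurable (B kj : set R) &
      A = \bigcap_(kj in [set` J]) (X kj.1 kj.2 @^-1` B kj)]].

(** A type carrying the sigma-algebra generated by the vectors with index in [S]. Being decided by
    these vectors then becomes ordinary measurability in this type, and the general lemmas on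
    measurable sets and functions apply. *)
Definition history S : Type := g_sigma_algebraType (cylinder S).

HB.instance Definition _ S := Measurable.on (history S).

Lemma setI_closed_cylinder S : setI_closed (cylinder S).
Proof.
move=> _ _ [J1 [B1 [u1 s1 m1 ->]]] [J2 [B2 [u2 s2 m2 ->]]].
exists (undup (J1 ++ J2)), (fun kj => (if kj \in J1 then B1 kj else setT) `&`
                                      (if kj \in J2 then B2 kj else setT)).
split; first exact: undup_uniq.
- by move=> kj; rewrite mem_undup mem_cat => /orP[/s1|/s2].
- by move=> kj; apply: measurableI; case: ifP.
apply/seteqP; split=> [w [h1 h2] kj /=|w h].
  rewrite mem_undup mem_cat => _; split; case: ifP => //= kjJ.
    exact: h1.
  exact: h2.
split=> kj /= kjJ; have := h kj; rewrite /= mem_undup mem_cat kjJ ?orbT;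
  by move=> /(_ isT) [].
Qed.

Lemma measurable_cylinder S A : cylinder S A -> measurable A.
Proof.
move=> [J [B [uJ _ mB ->]]]; apply: fin_bigcap_measurable; first exact: finite_seq.
move=> kj _; rewrite -[X in measurable X]setTI.
exact: measurable_funPT.
Qed.

Lemma history_measurable S (A : set Omega) : measurable (A : set (history S)) ->
  measurable A.
Proof.
move=> h; apply: h; split; first exact: sigma_algebra_measurable.
by move=> B; exact: measurable_cylinder.
Qed.

Lemma history_sub S S' (A : set Omega) : S `<=` S' ->
  measurable (A : set (history S)) -> measurable (A : set (history S')).
Proof.
move=> SS' h; apply: h; split; first exact: smallest_sigma_algebra.
move=> _ [J [B [uJ sJ mB ->]]]; apply: sub_sigma_algebra.
by exists J, B; split=> // kj /sJ /SS'.
Qed.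

Lemma history_preimage S i j (B : set R) : S i -> measurable B ->
  measurable (X i j @^-1` B : set (history S)).
Proof.
move=> Si mB; apply: sub_sigma_algebra; exists [:: (i, j)], (fun=> B); split=> //.
- by move=> kj; rewrite inE => /eqP->.
apply/seteqP; split=> [w h kj /=|w h]; first by rewrite inE => /eqP->.
by have := h (i, j); rewrite /= inE eqxx; apply.
Qed.

Lemma history_fun S i j : S i -> measurable_fun (setT : set (history S)) (X i j).
Proof. by move=> Si _ Y mY; rewrite setTI; exact: history_preimage. Qed.

Lemma dynkin_independent (B : set Omega) : measurable B ->
  dynkin [set A | measurable A /\ P (A `&` B) = (P B * P A)%E].
Proof.
move=> mB; split.
- by split => //; rewrite setTI probability_setT mule1.
- move=> A [mA AB]; split; first exact: measurableC.
  have -> : ~` A `&` B = B `\` (A `&` B).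
    by apply/seteqP; split=> [w [nA Bw]|w [Bw nAB]]; split=> //;
       [move=> []|move=> Aw; apply: nAB].
  have mAB : measurable (A `&` B) by exact: measurableI.
  have {}AB : Pr P (A `&` B) = Pr P B * Pr P A.
    by apply: EFin_inj; rewrite EFinM -!PrE.
  have mC := measurableC mA; have mD := measurableD mB mAB.
  by rewrite !PrE// Pr_setD// AB PrC// -EFinM; congr EFin; ring.
- move=> F tF hF; split; first by apply: bigcupT_measurable => n; case: (hF n).
  rewrite setI_bigcupl measure_semi_bigcup.
  + rewrite measure_semi_bigcup//; last 2 first.
    * by move=> n; case: (hF n).
    * by apply: bigcupT_measurable => n; case: (hF n).
    rewrite (PrE P mB) -nneseriesZl//.
    by apply: eq_eseriesr => n _; rewrite -(PrE P mB); case: (hF n).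
  + by move=> n; apply: measurableI => //; case: (hF n).
  + move=> i j _ _ [w [[Fi _] [Fj _]]]; apply: tF => //.
    by exists w.
  + by apply: bigcupT_measurable => n; apply: measurableI => //; case: (hF n).
Qed.

Hypothesis indep :
  mutually_independent P (fun kj : nat * 'I_d => (X kj.1 kj.2 : Omega -> R)).

Lemma cylinder_independent S S' A A' : S `&` S' = set0 ->
  cylinder S A -> cylinder S' A' -> P (A `&` A') = (P A' * P A)%E.
Proof.
move=> SS' [J1 [B1 [u1 s1 m1 ->]]] [J2 [B2 [u2 s2 m2 ->]]].
have dJ kj : kj \in J2 -> (kj \in J1) = false.
  move=> /s2 S2; apply/negP => /s1 S1.
  by have : (S `&` S') kj.1 by []; rewrite SS'.
pose B kj := if kj \in J1 then B1 kj else B2 kj.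
have -> : \bigcap_(kj in [set` J1]) X kj.1 kj.2 @^-1` B1 kj `&`
          \bigcap_(kj in [set` J2]) X kj.1 kj.2 @^-1` B2 kj =
          \bigcap_(kj in [set` J1 ++ J2]) X kj.1 kj.2 @^-1` B kj.
  apply/seteqP; split=> [w [h1 h2] kj /=|w h].
    rewrite mem_cat /B; case: ifPn => kj1 /=; first by move=> _; exact: h1.
    exact: h2.
  split=> kj /= kjJ; have := h kj; rewrite /= mem_cat /B kjJ ?orbT.
    by apply.
  by rewrite dJ//; apply.
rewrite (indep (J := J1 ++ J2) (B := B)); last 2 first.
- rewrite cat_uniq u1 u2 andbT /=; apply/hasPn => kj /dJ /negbT; exact.
- by move=> kj _; rewrite /B; case: ifP.
rewrite (indep (J := J1) (B := B1))// (indep (J := J2) (B := B2))//.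
rewrite -EFinM; congr EFin; rewrite big_cat /= mulrC; congr (_ * _).
  by rewrite !big_seq; apply: eq_bigr => kj kjJ; rewrite /B dJ.
by rewrite !big_seq; apply: eq_bigr => kj kjJ; rewrite /B kjJ.
Qed.

(** The pi-lambda argument is applied twice: it extends from cylinders to histories in one argument
    while the other event is fixed, then in the other argument. *)
Lemma history_independent S S' (A A' : set Omega) : S `&` S' = set0 ->
  measurable (A : set (history S)) -> measurable (A' : set (history S')) ->
  Pr P (A `&` A') = Pr P A * Pr P A'.
Proof.
move=> SS' hA hA'.
have pl S1 (B : set Omega) : measurable B ->
    (forall C, cylinder S1 C -> P (C `&` B) = (P B * P C)%E) ->
    forall C : set Omega, measurable (C : set (history S1)) ->
      P (C `&` B) = (P B * P C)%E.
  move=> mB h C hC.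
  pose D := [set C | measurable C /\ P (C `&` B) = (P B * P C)%E].
  suff : D C by case.
  move: hC; rewrite /measurable /= -setI_closed_g_dynkin_g_sigma_algebra; last first.
    exact: setI_closed_cylinder.
  move=> /(_ D); apply; split; first exact: dynkin_independent.
  by move=> E cE; split; [exact: measurable_cylinder cE|exact: h].
have mA := history_measurable hA; have mA' := history_measurable hA'.
have : P (A `&` A') = (P A' * P A)%E.
  apply: (pl S) hA => // C cC; rewrite setIC muleC.
  apply: (pl S') hA' => [|C' cC'].
    exact: measurable_cylinder cC.
  by rewrite setIC muleC; exact: cylinder_independent cC cC'.
have mI := measurableI _ _ mA mA'.
by move=> h; apply: EFin_inj; rewrite EFinM -!PrE// h muleC.
Qed.

(** Events are labelled by an arbitrary type and [f] gives their times, because the lemma is also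
    applied to injective assignments of vectors to cells. *)
Lemma Pr_times_inj (T : eqType) (q : seq T) (f : T -> nat) (A : T -> set Omega) :
  uniq (map f q) ->
  (forall t, measurable (A t : set (history [set f t]))) ->
  Pr P [set w | forall t, t \in q -> A t w] = \prod_(t <- q) Pr P (A t).
Proof.
move=> + hA.
have hB q' : measurable ([set w | forall t, t \in q' -> A t w] :
    set (history [set i | i \in map f q'])).
  rewrite (_ : [set w | _] = \bigcap_(t in [set` q']) A t)//.
  apply: fin_bigcap_measurable; first exact: finite_seq.
  move=> t tq; apply: history_sub (hA t) => _ ->.
  exact: map_f.
elim: q => [_|t q IH /= /andP[tq uq]].
  rewrite big_nil (_ : [set w | _] = setT); last by apply/seteqP; split.
  by rewrite /Pr probability_setT.
rewrite big_cons -IH//.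
rewrite -(@history_independent [set f t] [set i | i \in map f q])//.
- congr Pr; apply/seteqP; split=> [w h|w [h1 h2] u].
    split; first by apply: h; rewrite mem_head.
    by move=> u uq'; apply: h; rewrite inE uq' orbT.
  by rewrite inE => /orP[/eqP->//|]; exact: h2.
- by apply/seteqP; split=> // i [/= -> fi]; rewrite fi in tq.
Qed.

Lemma Pr_times (A : nat -> set Omega) (a n : nat) :
  (forall i, measurable (A i : set (history [set i]))) ->
  Pr P [set w | forall i, (a <= i < a + n)%N -> A i w] =
    \prod_(a <= i < a + n) Pr P (A i).
Proof.
move=> hA; rewrite -(@Pr_times_inj _ _ id)//; last first.
  by rewrite map_id iota_uniq.
by congr Pr; apply/seteqP; split=> w h i; have := h i; rewrite mem_index_iota.
Qed.

Lemma Pr_avoid (A : nat -> set Omega) (a n : nat) :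
  (forall i, measurable (A i : set (history [set i]))) ->
  Pr P [set w | forall i, (a <= i < a + n)%N -> ~ A i w] <=
    expR (- \sum_(a <= i < a + n) Pr P (A i)).
Proof.
move=> hA.
rewrite (@Pr_times (fun i => ~` A i)); last by move=> i; exact: measurableC.
rewrite -sumrN expR_sum; apply: ler_prod => i _; rewrite Pr_ge0 /=.
rewrite PrC; last exact: history_measurable (hA i).
exact: expR_ge1Dx.
Qed.

Lemma Pr_coords (k : nat) (B : 'I_d -> set R) :
  (forall j, measurable (B j)) ->
  Pr P [set w | forall j, B j (X k j w)] = \prod_j Pr P (X k j @^-1` B j).
Proof.
move=> mB; rewrite /Pr.
have := @indep [seq (k, j) | j <- enum 'I_d] (fun kj => B kj.2).
rewrite map_inj_uniq ?enum_uniq; last by move=> i j [].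
move=> /(_ isT) h.
rewrite (_ : [set w | _] =
  \bigcap_(i in [set` [seq (k, j) | j <- enum 'I_d]]) X i.1 i.2 @^-1` B i.2).
  by rewrite h//= big_map big_enum.
apply/seteqP; split=> [w h' _ /= /mapP[j _ ->]|w h' j]; first exact: h'.
by apply: (h' (k, j)) => /=; apply: map_f; rewrite mem_enum.
Qed.

End independence.
Arguments history {R d0 Omega P d} X S.

(** Stated over any measurable type, so that with [history X S] it shows a count to be decided by
    the vectors in [S]. *)
Lemma measurable_count {dT : measure_display} {T : measurableType dT}
    (F : nat -> set T) (r : seq nat) (t : nat) :
  (forall i, i \in r -> measurable (F i)) ->
  measurable [set w | (t <= \sum_(i <- r) (asbool (F i w) : nat))%N].
Proof.
elim: r t => [|i r IH] t mF.
  have [->|t0] := eqVneq t 0%N.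
    by rewrite (_ : [set w | _] = setT)//; apply/seteqP.
  rewrite (_ : [set w | _] = set0)//; apply/seteqP; split=> // w /=.
  by rewrite big_nil leqn0 (negPf t0).
have mF' j : j \in r -> measurable (F j).
  by move=> jr; apply: mF; rewrite inE jr orbT.
rewrite (_ : [set w | _] =
  (F i `&` [set w | (t.-1 <= \sum_(i <- r) (asbool (F i w) : nat))%N]) `|`
  [set w | (t <= \sum_(i <- r) (asbool (F i w) : nat))%N]).
  apply: measurableU; last exact: IH.
  by apply: measurableI; [apply: mF; rewrite mem_head|exact: IH].
apply/seteqP; split=> w /=; rewrite big_cons; case: asboolP => Fw /=.
- by move=> h; left; split=> //; lia.
- by rewrite add0n; right.
- by case=> [[_]|]; lia.
- by case=> [[]|].
Qed.

(** * Record events as events of the past *)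

Section record_events.
Context {R : realType} {d0 : measure_display} {Omega : measurableType d0}.
Context {P : probability Omega R} {d : nat} (X : nat -> 'I_d -> {RV P >-> R}).
Local Notation x := (fun k j => X k j : Omega -> R).

Lemma history_forall_coord S (F : 'I_d -> set Omega) :
  (forall j, measurable (F j : set (history X S))) ->
  measurable ([set w | forall j, F j w] : set (history X S)).
Proof.
move=> mF; rewrite (_ : [set w | _] = \bigcap_(j in [set: 'I_d]) F j).
  by apply: fin_bigcap_measurable => //; exact: finite_finset.
by apply/seteqP; split=> [w h j _|w h j]; [exact: h|exact: (h j)].
Qed.

Lemma history_lt S i k j : S i -> S k ->
  measurable ([set w | X k j w < X i j w] : set (history X S)).
Proof.
move=> Si Sk; rewrite -[X in measurable X]setTI.
have := @measurable_fun_ltr _ (history X S) R setT (X k j) (X i j)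
  (history_fun j Sk) (history_fun j Si).
by move=> /(_ measurableT [set true]); apply.
Qed.

Lemma history_record S k : (forall i, (i <= k)%N -> S i) ->
  measurable ([set w | is_record x w k] : set (history X S)).
Proof.
move=> Sk.
rewrite (_ : [set w | _] =
   \bigcap_(i in `I_k) ~` [set w | forall j, X k j w < X i j w])//.
apply: fin_bigcap_measurable; first exact: finite_II.
move=> i /= ik; apply: measurableC; apply: history_forall_coord => j.
by apply: history_lt; apply: Sk => //; exact: ltnW.
Qed.

Lemma nrecordsE w n :
  nrecords x w n = (\sum_(i <- iota 0 n) (asbool (is_record x w i) : nat))%N.
Proof.
rewrite /nrecords -(big_mkord predT (fun i => asbool (is_record x w i) : nat)).
by rewrite /index_iota subn0.
Qed.

Lemma history_nrecords_ge k t :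
  measurable ([set w | (t <= nrecords x w k)%N] : set (history X `I_k)).
Proof.
rewrite (_ : [set w | _] = [set w |
    (t <= \sum_(i <- iota 0 k) (asbool (is_record x w i) : nat))%N]).
2: by apply/seteqP; split=> w /=; rewrite nrecordsE.
apply: (@measurable_count _ (history X `I_k) (fun i => [set w | is_record x w i])).
move=> i; rewrite mem_iota => /= ik; apply: history_record => j /= ji.
by rewrite (leq_ltn_trans ji).
Qed.

Lemma history_nrecords_eq k t :
  measurable ([set w | nrecords x w k = t] : set (history X `I_k)).
Proof.
rewrite (_ : [set w | _] = [set w | (t <= nrecords x w k)%N] `\`
                           [set w | (t.+1 <= nrecords x w k)%N]).
  by apply: measurableD; exact: history_nrecords_ge.
apply/seteqP; split=> w /=; first by move=> <-; split=> //; rewrite ltnn.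
by move=> [tk /negP]; rewrite -leqNgt => kt; apply/eqP; rewrite eqn_leq kt.
Qed.

End record_events.

(** * Exponential vectors and Gamma tails *)

Lemma sum_unlift {R : pzRingType} (e : nat) (u : R) (f : 'I_e -> R) :
  \sum_(j < e.+1) (if unlift ord0 j is Some i then f i else u) =
  u + \sum_i f i.
Proof.
rewrite big_ord_recl unlift_none; congr (_ + _).
by apply: eq_bigr => i _; rewrite liftK.
Qed.

Lemma expRN1_le_half {R : realType} (h : R) : 1 <= h -> expR (- h) <= 2^-1.
Proof.
move=> h1; rewrite expRN lef_pV2 ?posrE ?expR_gt0//.
by apply: le_trans (expR_ge1Dx h); lra.
Qed.

Section exponential_vectors.
Context {R : realType} {d0 : measure_display} {Omega : measurableType d0}.
Context {P : probability Omega R}.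

Definition hits {d} (X : nat -> 'I_d -> {RV P >-> R}) (y : 'I_d -> R) (i : nat) :
  set Omega := [set w | forall j, y j < X i j w].
Definition dominates {d} (X : nat -> 'I_d -> {RV P >-> R}) (y : 'I_d -> R)
  (i : nat) : set Omega := [set w | forall j, y j <= X i j w].
Definition tot {d} (X : nat -> 'I_d -> {RV P >-> R}) (i : nat) (w : Omega) : R :=
  \sum_j X i j w.
Definition tot_ge {d} (X : nat -> 'I_d -> {RV P >-> R}) (s : R) (i : nat) :
  set Omega := [set w | s <= tot X i w].

Lemma history_coords {d} (X : nat -> 'I_d -> {RV P >-> R}) i S
    (B : 'I_d -> set R) : S i ->
  (forall j, measurable (B j)) ->
  measurable ([set w | forall j, B j (X i j w)] : set (history X S)).
Proof.
move=> Si mB; apply: (@history_forall_coord _ _ _ _ _ X S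
  (fun j => X i j @^-1` B j)) => j.
exact: history_preimage.
Qed.

Lemma measurable_gt (t : R) : measurable [set s : R | t < s].
Proof. by rewrite -set_itvoy. Qed.

Lemma measurable_ge (t : R) : measurable [set s : R | t <= s].
Proof. by rewrite -set_itvcy. Qed.

Lemma measurable_co (t u : R) : measurable [set s : R | t <= s < u].
Proof. by rewrite -set_itvco. Qed.

Lemma history_hits {d} (X : nat -> 'I_d -> {RV P >-> R}) y i S : S i ->
  measurable (hits X y i : set (history X S)).
Proof.
move=> Si; apply: (history_coords (B := fun j => [set s | y j < s])) => // j.
exact: measurable_gt.
Qed.

Lemma history_dominates {d} (X : nat -> 'I_d -> {RV P >-> R}) y i S : S i ->
  measurable (dominates X y i : set (history X S)).
Proof.
move=> Si; apply: (history_coords (B := fun j => [set s | y j <= s])) => // j.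
exact: measurable_ge.
Qed.

Lemma history_tot_ge {d} (X : nat -> 'I_d -> {RV P >-> R}) s i S : S i ->
  measurable (tot_ge X s i : set (history X S)).
Proof.
move=> Si; rewrite -[X in measurable X]setTI.
have : measurable_fun (setT : set (history X S)) (tot X i : history X S -> R).
  by apply: measurable_sum => j; exact: history_fun.
by move=> /(_ measurableT _ (measurable_ge s)).
Qed.

Context {d : nat} {X : nat -> 'I_d -> {RV P >-> R}}.
Hypothesis expX : forall k j A, measurable A ->
  P (X k j @^-1` A) = exponential_prob 1 A.
Hypothesis indep :
  mutually_independent P (fun kj : nat * 'I_d => (X kj.1 kj.2 : Omega -> R)).

Lemma measurable_X k j (A : set R) : measurable A -> measurable (X k j @^-1` A).
Proof. exact: measurable_funPTI. Qed.

Lemma Pr_atom k j (t : R) : Pr P (X k j @^-1` [set t]) = 0.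
Proof. by rewrite /Pr expX// /exponential_prob integral_set1. Qed.

Lemma Pr_gt k j (t : R) : 0 <= t ->
  Pr P (X k j @^-1` [set s | t < s]) = expR (- t).
Proof.
move=> t0.
have neg0 : Pr P (X k j @^-1` [set s | s < 0]) = 0.
  rewrite /Pr expX; last by rewrite -set_itvNyo.
  rewrite /exponential_prob integral0_eq// => s /= s0.
  by rewrite lt0_exponential_pdf.
have mle (u : R) : measurable (X k j @^-1` [set s | s <= u]).
  by apply: measurable_X; rewrite -set_itvNyc.
have -> : X k j @^-1` [set s | t < s] = ~` (X k j @^-1` [set s | s <= t]).
  by apply/seteqP; split=> w /=; rewrite ltNge => /negP.
rewrite PrC//.
have mN : measurable (X k j @^-1` [set s | s < 0]).
  by apply: measurable_X; rewrite -set_itvNyo.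
have mI : measurable (X k j @^-1` `[0, t]) by apply: measurable_X.
have -> : X k j @^-1` [set s | s <= t] =
    X k j @^-1` [set s | s < 0] `|` X k j @^-1` `[0, t].
  apply/seteqP; split=> w /=; rewrite ?in_itv /=.
    by move=> wt; case: (ltP (X k j w) 0) => w0; [left|right].
  by move=> [w0|/andP[]//]; rewrite (le_trans (ltW w0)).
rewrite Pr_setU//; last first.
  apply/seteqP; split=> // w [/= w0]; rewrite in_itv /= => /andP[w0' _].
  by have := lt_le_trans w0 w0'; rewrite ltxx.
rewrite neg0 add0r.
have [<-|tn0] := eqVneq 0 t.
  by rewrite set_itv1 Pr_atom oppr0 expR0 addr0.
rewrite /Pr expX// exponential_prob_itv0c; last by rewrite lt_def eq_sym tn0.
by rewrite /= mulN1r opprB addrCA subrr addr0.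
Qed.

Lemma Pr_ge k j (t : R) : 0 <= t ->
  Pr P (X k j @^-1` [set s | t <= s]) = expR (- t).
Proof.
move=> t0; rewrite -(Pr_gt k j t0) -[RHS]addr0 -(Pr_atom k j t) -Pr_setU.
- congr Pr; apply/seteqP; split=> w /=.
    by rewrite le_eqVlt => /orP[/eqP<-|]; [right|left].
  by move=> [/ltW//|->].
- by apply: measurable_X; exact: measurable_gt.
- by apply: measurable_X.
- by apply/seteqP; split=> // w [/= + wt]; rewrite wt ltxx.
Qed.

Lemma Pr_co k j (t h : R) : 0 <= t -> 0 <= h ->
  Pr P (X k j @^-1` [set s | t <= s < t + h]) = expR (- t) * (1 - expR (- h)).
Proof.
move=> t0 h0.
rewrite (_ : X k j @^-1` _ =
  X k j @^-1` [set s | t <= s] `\` X k j @^-1` [set s | t + h <= s]).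
  rewrite Pr_setD; last 3 first.
  - by apply: measurable_X; exact: measurable_ge.
  - by apply: measurable_X; exact: measurable_ge.
  - by move=> w /=; apply: le_trans; rewrite lerDl.
  rewrite !Pr_ge ?addr_ge0// opprD expRD; ring.
apply/seteqP; split=> w /=.
  by move=> /andP[-> wt]; split=> //; apply/negP; rewrite -ltNge.
by move=> [-> /negP]; rewrite -ltNge.
Qed.

Lemma ae_pos : {ae P, forall w, forall k j, 0 < X k j w}.
Proof.
apply: ae_foralln => k.
have mP : measurable (\bigcup_(j in [set: 'I_d]) ~` (X k j @^-1` [set s | 0 < s])).
  apply: fin_bigcup_measurable => [|j _]; first exact: finite_finset.
  by apply: measurableC; apply: measurable_X; exact: measurable_gt.
exists (\bigcup_(j in [set: 'I_d]) ~` (X k j @^-1` [set s | 0 < s])); split=> //.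
  apply: (etrans (PrE P mP)); congr EFin; apply/eqP; rewrite eq_le Pr_ge0 andbT.
  apply: le_trans (@Pr_union_bound _ _ _ P _ (index_enum 'I_d)
    (fun j => ~` (X k j @^-1` [set s | 0 < s])) _ mP _ _) _.
  - move=> j _; apply: measurableC; apply: measurable_X; exact: measurable_gt.
  - by move=> w [j _ h]; exists j => //; exact: mem_index_enum.
  rewrite big1// => j _; rewrite PrC; last first.
    by apply: measurable_X; exact: measurable_gt.
  by rewrite Pr_gt// oppr0 expR0 subrr.
move=> w /= /existsNP[j hj]; exists j => //.
Qed.

Lemma measurable_hits y i : measurable (hits X y i).
Proof. by apply: (@history_measurable _ _ _ _ _ _ [set i]); exact: history_hits. Qed.

Lemma measurable_dominates y i : measurable (dominates X y i).
Proof.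
by apply: (@history_measurable _ _ _ _ _ _ [set i]); exact: history_dominates.
Qed.

Lemma measurable_tot_ge s i : measurable (tot_ge X s i).
Proof.
by apply: (@history_measurable _ _ _ _ _ _ [set i]); exact: history_tot_ge.
Qed.

Lemma Pr_hits y i : (forall j, 0 <= y j) ->
  Pr P (hits X y i) = expR (- \sum_j y j).
Proof.
move=> y0; rewrite /hits (Pr_coords indep i (B := fun j => [set s | y j < s])).
  by rewrite -sumrN expR_sum; apply: eq_bigr => j _; rewrite Pr_gt.
by move=> j; exact: measurable_gt.
Qed.

Lemma Pr_dominates y i : (forall j, 0 <= y j) ->
  Pr P (dominates X y i) = expR (- \sum_j y j).
Proof.
move=> y0; rewrite /dominates (Pr_coords indep i (B := fun j => [set s | y j <= s])).
  by rewrite -sumrN expR_sum; apply: eq_bigr => j _; rewrite Pr_ge.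
by move=> j; exact: measurable_ge.
Qed.

Lemma Pr_no_hit y n : (forall j, 0 <= y j) ->
  Pr P [set w | forall i, (i < n)%N -> ~ hits X y i w] <=
    expR (- (n%:R * expR (- \sum_j y j))).
Proof.
move=> y0.
have := Pr_avoid indep 0 n (A := hits X y) (fun i => @history_hits _ X y i [set i] erefl).
rewrite add0n (eq_bigr (fun=> expR (- \sum_j y j))) => [|i _]; last exact: Pr_hits.
by rewrite sumr_const_nat subn0 mulr_natl.
Qed.

Lemma measurable_no_hit y n :
  measurable [set w | forall i, (i < n)%N -> ~ hits X y i w].
Proof.
rewrite (_ : [set w | _] = \bigcap_(i in `I_n) ~` hits X y i)//.
apply: fin_bigcap_measurable => [|i _]; first exact: finite_II.
by apply: measurableC; exact: measurable_hits.
Qed.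

End exponential_vectors.

(** * Two-sided tail bounds for the Gamma distribution *)

Section gamma_tail.
Context {R : realType} {d0 : measure_display} {Omega : measurableType d0}.
Context {P : probability Omega R} {e : nat} {X : nat -> 'I_e.+1 -> {RV P >-> R}}.
Hypothesis expX : forall k j A, measurable A ->
  P (X k j @^-1` A) = exponential_prob 1 A.
Hypothesis indep :
  mutually_independent P (fun kj : nat * 'I_e.+1 => (X kj.1 kj.2 : Omega -> R)).

(** Rounding the coordinates other than the first down to integers loses at most [e] in the sum. So
    a vector of total at least [s] lies above one of at most (s + 1)^e corners [y b], whose
    coordinate sums are at least s - e. *)
Lemma Pr_tot_ge_le i (s : R) : 0 <= s ->
  Pr P (tot_ge X s i) <= (s + 1) ^+ e * expR (e%:R - s).
Proof.
move=> s0; pose K := (Num.trunc s).+1.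
pose y (b : {ffun 'I_e -> 'I_K}) (j : 'I_e.+1) : R :=
  if unlift ord0 j is Some i then (b i)%:R
  else Num.max 0 (s - e%:R - \sum_i (b i)%:R).
have y0 b j : 0 <= y b j.
  by rewrite /y; case: unlift => [k|]; rewrite ?ler0n// le_max lexx.
have posv1 : Pr P (~` dominates X (fun=> 0) i) = 0.
  rewrite PrC; last exact: measurable_dominates.
  by rewrite (Pr_dominates expX indep)// big1// oppr0 expR0 subrr.
have mpos : measurable (dominates X (fun=> 0) i) by exact: measurable_dominates.
have mt : measurable (tot_ge X s i) by exact: measurable_tot_ge.
(* The rounding needs nonnegative coordinates, which hold only almost surely. *)
apply: (@le_trans _ _ (Pr P (tot_ge X s i `&` dominates X (fun=> 0) i))).
  have := Pr_setU_le P (measurableI _ _ mt mpos) (measurableC mpos).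
  rewrite posv1 addr0; apply: le_trans.
  apply: le_Pr => //; first by apply: measurableU; [exact: measurableI|exact: measurableC].
  by move=> w tw; case: (pselect (dominates X (fun=> 0) i w)) => h; [left|right].
apply: le_trans (@Pr_union_bound _ _ _ P _ (index_enum {ffun 'I_e -> 'I_K})
   (fun b => dominates X (y b) i) _ _ _ _) _.
- exact: measurableI.
- by move=> b _; exact: measurable_dominates.
- move=> w [tw pw]; pose a (k : 'I_e) := Num.trunc (X i (lift ord0 k) w).
  have aE k : (a k)%:R <= X i (lift ord0 k) w < (a k).+1%:R.
    by rewrite /a truncn_itv.
  (* Integer parts capped at [K.-1], the integer part of s. If the cap is active, the rounded
     coordinates already sum to more than s - 1 >= s - e, and the demand on the first coordinate
     reduces to nonnegativity. *)
  exists [ffun k => inord (minn (a k) K.-1)]; first exact: mem_index_enum.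
  have bE (k : 'I_e) : ([ffun k => inord (minn (a k) K.-1)] k : 'I_K) = minn (a k) K.-1 :> nat.
    by rewrite ffunE inordK// ltnS geq_minr.
  move=> j; rewrite /y; case: unliftP => [k ->|->].
    rewrite bE; apply: le_trans (andP (aE k)).1.
    by rewrite ler_nat geq_minl.
  rewrite ge_max; apply/andP; split; first exact: pw.
  have [/forallP al|/forallPn[k]] := boolP [forall k, a k <= K.-1]%N.
    have S : \sum_k X i (lift ord0 k) w <=
        \sum_k (([ffun k => inord (minn (a k) K.-1)] k : 'I_K)%:R + 1).
      apply: ler_sum => k _; rewrite natr1 bE (minn_idPl (al k)).
      by case/andP: (aE k) => _ /ltW.
    rewrite big_split /= sumr_const card_ord in S.
    move: tw; rewrite /tot_ge /= /tot big_ord_recl; lra.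
  rewrite -ltnNge => ak.
  apply: le_trans (pw ord0); rewrite (bigD1 k)//= bE (minn_idPr (ltnW ak)) /=.
  have e1 : (1 : R) <= e%:R by rewrite ler1n; case: (e) k {ak} => // - [].
  have sK : s < (Num.trunc s).+1%:R by exact: truncnS_gt.
  have : 0 <= \sum_(i < e | i != k) (([ffun k => inord (minn (a k) K.-1)] i : 'I_K)%:R : R).
    exact: sumr_ge0.
  move: sK; rewrite -natr1; lra.
apply: (@le_trans _ _ (\sum_(b : {ffun 'I_e -> 'I_K}) expR (e%:R - s))).
  apply: ler_sum => b _; rewrite (Pr_dominates expX indep)//.
  rewrite ler_expR sum_unlift.
  have : s - e%:R - \sum_i (b i)%:R <= Num.max 0 (s - e%:R - \sum_i (b i)%:R) :> R.
    by rewrite le_max lexx orbT.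
  lra.
rewrite sumr_const card_ffun !card_ord -[_ *+ (_ ^ _)]mulr_natl natrX.
rewrite ler_wpM2r ?expR_ge0// lerXn2r ?nnegrE ?addr_ge0//.
by rewrite -natr1 lerD2r; have /andP[] := truncn_itv s0.
Qed.

(** The lower corner of a cell: the point of the hyperplane of coordinate sum [s] whose coordinates
    other than the first are the lattice values [h * a i]. *)
Definition cell (s h : R) (a : 'I_e -> nat) (j : 'I_e.+1) : R :=
  if unlift ord0 j is Some i then h * (a i)%:R else s - h * \sum_i (a i)%:R.

Lemma sum_cell s h a : \sum_j cell s h a j = s.
Proof. by rewrite sum_unlift -mulr_sumr subrK. Qed.

Lemma cell_ge0 s h a : 0 <= h -> h * \sum_i (a i)%:R <= s ->
  forall j, 0 <= cell s h a j.
Proof.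
by move=> h0 hs j; rewrite /cell; case: unlift => [i|]; rewrite ?mulr_ge0 ?subr_ge0.
Qed.

(** All coordinates but the first are confined to one mesh interval above the corner. This makes
    slabs of distinct corners disjoint while costing only a constant factor in probability compared
    with the full region above the corner. *)
Definition slab (s h : R) (a : 'I_e -> nat) (i : nat) : set Omega :=
  [set w | forall j, (if unlift ord0 j is Some k
     then [set t | h * (a k)%:R <= t < h * (a k)%:R + h]
     else [set t | s - h * \sum_i (a i)%:R <= t]) (X i j w)].

Lemma history_slab s h a i S : S i -> measurable (slab s h a i : set (history X S)).
Proof.
move=> Si; apply: (history_coords (B := fun j => if unlift ord0 j is Some k
     then [set t | h * (a k)%:R <= t < h * (a k)%:R + h]
     else [set t | s - h * \sum_i (a i)%:R <= t])) => // j.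
by case: unlift => [k|]; [exact: measurable_co|exact: measurable_ge].
Qed.

Lemma measurable_slab s h a i : measurable (slab s h a i).
Proof. by apply: (@history_measurable _ _ _ _ _ _ [set i]); exact: history_slab. Qed.

Lemma slab_dominates s h a i : slab s h a i `<=` dominates X (cell s h a) i.
Proof.
move=> w sw j; have := sw j; rewrite /cell; case: unlift => [k|] //=.
by case/andP.
Qed.

Lemma slab_tot_ge s h a i : slab s h a i `<=` tot_ge X s i.
Proof.
move=> w /slab_dominates dw; rewrite /tot_ge /= -[leLHS](sum_cell s h a).
by apply: ler_sum => j _; exact: dw.
Qed.

Lemma slab_inj s h a b i w : 0 < h -> slab s h a i w -> slab s h b i w -> a =1 b.
Proof.
move=> h0 aw bw k; have := aw (lift ord0 k); have := bw (lift ord0 k).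
rewrite !liftK /= => /andP[b1 b2] /andP[a1 a2].
have lt1 : h * (a k)%:R < h * (b k).+1%:R.
  by apply: le_lt_trans a1 _; rewrite -natr1 mulrDr mulr1.
have lt2 : h * (b k)%:R < h * (a k).+1%:R.
  by apply: le_lt_trans b1 _; rewrite -natr1 mulrDr mulr1.
move: lt1 lt2; rewrite !ltr_pM2l// !ltr_nat; lia.
Qed.

(** For [1 <= h] each of the [e] interval factors 1 - e^-h is at least 1/2. *)
Lemma Pr_slab s h a i : 1 <= h -> h * \sum_i (a i)%:R <= s ->
  2^-1 ^+ e * expR (- s) <= Pr P (slab s h a i).
Proof.
move=> h1 hs; have h0 : 0 <= h by lra.
rewrite /slab (Pr_coords indep i (B := fun j => if unlift ord0 j is Some k
     then [set t | h * (a k)%:R <= t < h * (a k)%:R + h]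
     else [set t | s - h * \sum_i (a i)%:R <= t])); last first.
  by move=> j; case: unlift => [k|]; [exact: measurable_co|exact: measurable_ge].
rewrite big_ord_recl unlift_none (Pr_ge expX) ?subr_ge0//.
rewrite [X in _ <= _ * X](eq_bigr (fun k => expR (- (h * (a k)%:R)) * (1 - expR (- h)))).
  rewrite big_split /= -expR_sum sumrN -mulr_sumr mulrA -expRD.
  rewrite opprB addrAC subrr add0r mulrC ler_wpM2l ?expR_ge0//.
  rewrite prodr_const card_ord; apply: lerXn2r; rewrite ?nnegrE ?invr_ge0//.
    by rewrite subr_ge0 -expR0 ler_expR oppr_le0.
  by have := expRN1_le_half h1; lra.
by move=> k _; rewrite liftK (Pr_co expX)// mulr_ge0.
Qed.

(** The M^e slabs of mesh 1 are disjoint parts of the event; M e <= s keeps the first coordinate of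
    every corner nonnegative. *)
Lemma Pr_tot_ge_ge i (s : R) (M : nat) : M%:R * e%:R <= s ->
  (M%:R / 2) ^+ e * expR (- s) <= Pr P (tot_ge X s i).
Proof.
move=> Ms.
have aE (a : {ffun 'I_e -> 'I_M}) : 1 * \sum_i (a i)%:R <= s.
  rewrite mul1r; apply: le_trans Ms; rewrite mulr_natr.
  rewrite -[in leRHS](card_ord e) -sumr_const; apply: ler_sum => k _.
  by rewrite ler_nat ltnW.
apply: le_trans (@Pr_disjoint_sum _ _ _ P _ (index_enum {ffun 'I_e -> 'I_M})
   (fun a => slab s 1 (fun k => a k) i) _ _ _ _ _ _).
- apply: (@le_trans _ _ (\sum_(a : {ffun 'I_e -> 'I_M}) (2^-1 ^+ e * expR (- s)))).
    by rewrite sumr_const card_ffun !card_ord exprMn -mulrA -[_ *+ (_ ^ _)]mulr_natl natrX.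
  by apply: ler_sum => a _; exact: Pr_slab.
- exact: index_enum_uniq.
- exact: measurable_tot_ge.
- by move=> a _; exact: measurable_slab.
- move=> a b w sa sb; apply/ffunP => k; apply: val_inj.
  by apply: (slab_inj _ sa sb).
- by move=> a _; exact: slab_tot_ge.
Qed.

End gamma_tail.

(** * The frontier and the record count *)

Section frontier.
Context {R : realType} {d0 : measure_display} {Omega : measurableType d0}.
Context {d : nat} (X : nat -> 'I_d -> Omega -> R) (w : Omega).

Lemma closed_coord_le j (t : R) : closed [set z : 'rV[R]_d | z ord0 j <= t].
Proof.
apply: (@closed_comp _ _ (fun z : 'rV[R]_d => z ord0 j) [set x | x <= t]).
  by move=> z _; exact: coord_continuous.
exact: closed_le.
Qed.

Lemma closed_coord_ge j (t : R) : closed [set z : 'rV[R]_d | t <= z ord0 j].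
Proof.
apply: (@closed_comp _ _ (fun z : 'rV[R]_d => z ord0 j) [set x | t <= x]).
  by move=> z _; exact: coord_continuous.
exact: closed_ge.
Qed.

Lemma closed_RS n : closed (RS X n w).
Proof.
rewrite (_ : RS X n w =
  (\bigcap_(j in [set: 'I_d]) [set z : 'rV[R]_d | 0 <= z ord0 j]) `&`
  \bigcap_(i in `I_n) \bigcup_(j in [set: 'I_d])
    [set z : 'rV[R]_d | X i j w <= z ord0 j]).
  apply: closedI; first by apply: closed_bigI => j _; exact: closed_coord_ge.
  apply: closed_bigI => i _; apply: closed_bigcup; first exact: finite_finset.
  by move=> j _; exact: closed_coord_ge.
apply/seteqP; split=> z [z0 h]; split=> //.
- by move=> j _; exact: z0.
- by move=> i /= /h /existsNP[j /negP]; rewrite -leNgt; exists j.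
- by move=> j; exact: z0.
- by move=> i /h[j _ /= + hj]; rewrite leNgt hj.
Qed.

Lemma frontier_ge n z : frontier X n w z -> RS X n w z.
Proof. by move=> [+ _]; rewrite -(closure_id _).1//; exact: closed_RS. Qed.

(** The part of the orthant outside [RS] is contained in a finite union of closed lower sets, one
    for each vector, and so is its closure. *)
Lemma frontier_le n z : frontier X n w z ->
  exists2 i, (i < n)%N & forall j, z ord0 j <= X i j w.
Proof.
move=> [_ zD].
pose D := \bigcup_(i in `I_n) \bigcap_(j in [set: 'I_d])
  [set z : 'rV[R]_d | z ord0 j <= X i j w].
have cD : closed D.
  apply: closed_bigcup; first exact: finite_II.
  by move=> i _; apply: closed_bigI => j _; exact: closed_coord_le.
have : D z.
  have -> : D = closure D by exact/closure_id.
  apply: closure_subset zD => u [u0 nu].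
  apply: contrapT => nD; apply: nu; split=> // i ni h; apply: nD.
  by exists i => // j _; exact/ltW/h.
by move=> [i ni h]; exists i => // j; exact: h.
Qed.

Lemma frontier_coord_sum_ge0 n z : frontier X n w z -> 0 <= coord_sum z.
Proof. by move=> /frontier_ge[z0 _]; exact: sumr_ge0. Qed.

(** The hypothesis [0 <= s] handles an empty frontier, whose supremum is 0 by convention. *)
Lemma Fplus_le n s : 0 <= s -> (forall i, (i < n)%N -> \sum_j X i j w <= s) ->
  Fplus X n w <= s.
Proof.
move=> s0 hs; rewrite /Fplus.
have [->|/set0P ne] := eqVneq [set coord_sum x | x in frontier X n w] set0.
  by rewrite sup0.
apply: ge_sup => // _ [z /frontier_le[i ni h] <-].
by apply: le_trans (hs i ni); exact: ler_sum.
Qed.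

Lemma has_sup_frontier n z : frontier X n w z ->
  has_sup [set coord_sum x | x in frontier X n w].
Proof.
move=> fz; split; first by exists (coord_sum z), z.
exists (\sum_(i < n) `|\sum_j X i j w|) => _ [u /frontier_le[i ni h] <-].
apply: (@le_trans _ _ (\sum_j X i j w)); first exact: ler_sum.
apply: le_trans (ler_norm _) _.
rewrite (bigD1 (Ordinal ni))//= lerDl.
by apply: sumr_ge0.
Qed.

Lemma has_inf_frontier n z : frontier X n w z ->
  has_inf [set coord_sum x | x in frontier X n w].
Proof.
move=> fz; split; first by exists (coord_sum z), z.
by exists 0 => _ [u fu <-]; exact: frontier_coord_sum_ge0 fu.
Qed.

(** On the line a frontier point lies below some vector that another frontier point is not strictly
    below; hence the two coincide. *)
Lemma Wn_dim1 n : d = 1%N -> Wn X n w = 0.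
Proof.
move=> d1; rewrite /Wn /Fplus /Fminus.
set A := [set coord_sum x | x in _].
have uA a b : A a -> A b -> a <= b.
  move=> [x /frontier_le[i ni hx] <-] [y /frontier_ge[_ hy] <-].
  apply: ler_sum => j _; apply: le_trans (hx j) _; rewrite leNgt; apply/negP => yj.
  apply: (hy i ni) => k; rewrite (_ : k = j)//.
  by apply/val_inj; case: k j {yj} => [k hk] [j hj] /=; rewrite d1 in hk hj; lia.
have [->|/set0P[a Aa]] := eqVneq A set0; first by rewrite sup0 inf0 subrr.
rewrite (_ : A = [set a]) ?sup1 ?inf1 ?subrr//.
apply/seteqP; split=> [b Ab|_ ->//] /=.
by apply/eqP; rewrite eq_le !uA.
Qed.

Hypothesis Xpos : forall i j, 0 < X i j w.

(** The point where a ray from the origin enters [RS] is the limit from below of points of the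
    orthant outside [RS]. *)
Lemma frontier_ray n (z : 'rV[R]_d) (a : R) : (forall j, 0 <= z ord0 j) ->
  0 <= a -> RS X n w (a *: z) ->
  (forall t, 0 <= t < a -> ~ RS X n w (t *: z)) -> 0 < a ->
  frontier X n w (a *: z).
Proof.
move=> z0 a0 Ra nR ap; split; first exact: subset_closure.
move=> B nB.
have : \forall t \near a^'-, B (t *: z).
  have : t *: z @[t --> a^'-] --> a *: z.
    by apply: cvg_at_left_filter; exact: scalel_continuous.
  exact.
move=> hB; near (a^'-) => t.
have t0 : 0 < t by near: t; exact: nbhs_left_gt.
have ta : t < a by near: t; exact: nbhs_left_lt.
exists (t *: z); split; last by near: t.
split; first by move=> j; rewrite mxE mulr_ge0// ltW.
by apply: nR; rewrite ltW.
Unshelve. all: by end_near.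
Qed.

(** Shrinking [y] towards the origin down to the entry point of its ray does not increase the
    coordinate sum. *)
Lemma frontier_below n (y : 'rV[R]_d) : (0 < n)%N -> RS X n w y ->
  exists2 z, frontier X n w z & coord_sum z <= coord_sum y.
Proof.
move=> n0 Ry; have [y0 _] := Ry.
pose A := [set t : R | 0 <= t <= 1 /\ RS X n w (t *: y)].
have A1 : A 1 by rewrite /A /= ler01 lexx scale1r.
have hA : has_inf A by split; [exists 1|exists 0 => t [/andP[]]].
pose a := inf A.
have a0 : 0 <= a by apply: lb_le_inf => [|t [/andP[]]]; [exists 1|].
have a1 : a <= 1 by apply: ge_inf => //; case: hA.
have Ra : RS X n w (a *: y).
  have -> : RS X n w = closure (RS X n w) by apply/closure_id; exact: closed_RS.
  move=> B nB.
  have hB : \forall t \near a, B (t *: y).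
    by have := @scalel_continuous _ _ y a; exact.
  have /nbhs_ballP[e /= e0 he] := hB.
  have [t [t01 Rt] te] := inf_adherent e0 hA.
  exists (t *: y); split=> //; apply: he.
  rewrite /ball /= ler0_norm ?opprB; last first.
    by rewrite subr_le0; apply: ge_inf => //; case: hA.
  by rewrite ltrBlDr addrC.
(* The origin lies outside [RS], since vector 0 has positive coordinates and [0 < n]. *)
have ap : 0 < a.
  rewrite lt_def a0 andbT; apply/eqP => az; case: Ra => _ /(_ 0%N n0); apply => j.
  by rewrite az scale0r mxE.
exists (a *: y).
  apply: frontier_ray => // t /andP[t0 ta] Rt.
  have : A t by split=> //; rewrite t0 (le_trans (ltW ta)).
  by move=> At; have := ge_inf hA.2 At; rewrite -/a leNgt ta.
rewrite /coord_sum; apply: ler_sum => j _; rewrite mxE.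
by rewrite ler_piMl.
Qed.

Lemma Fminus_le n (y : 'I_d -> R) : (0 < n)%N -> (forall j, 0 <= y j) ->
  (forall i, (i < n)%N -> ~ (forall j, y j < X i j w)) ->
  Fminus X n w <= \sum_j y j.
Proof.
move=> n0 y0 hy.
have Ry : RS X n w (\row_j y j).
  split=> [j|i ni h]; rewrite ?mxE//; apply: (hy i ni) => j.
  by have := h j; rewrite mxE.
have [z fz zy] := frontier_below n0 Ry.
apply: (@le_trans _ _ (coord_sum z)).
  by apply: ge_inf; [case: (has_inf_frontier fz)|exists z].
by apply: le_trans zy _; apply: ler_sum => j _; rewrite mxE.
Qed.

(** A vector of maximal total is itself on the frontier: a strict dominator would have a larger
    total, and the shorter multiples of the vector are strictly below it. *)
Lemma frontier_above n i : (0 < d)%N -> (i < n)%N ->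
  exists2 z, frontier X n w z & \sum_j X i j w <= coord_sum z.
Proof.
move=> dp ni.
have [k hk] : exists k : 'I_n, forall i : 'I_n, \sum_j X i j w <= \sum_j X k j w.
  exists [arg max_(k > Ordinal ni) \sum_j X k j w]%O => u.
  by case: arg_maxP => // k _ /(_ u isT).
exists (\row_j X k j w); last first.
  apply: le_trans (hk (Ordinal ni)) _.
  by apply: ler_sum => j _; rewrite mxE.
rewrite -[\row_j _]scale1r; apply: frontier_ray; rewrite ?ltr01 ?ler01 ?scale1r//.
- by move=> j; rewrite mxE ltW.
- split=> [j|u nu h]; first by rewrite mxE ltW.
  have := hk (Ordinal nu); rewrite leNgt => /negP; apply.
  apply: ltr_sum => [|j _]; last by have := h j; rewrite mxE.
  by apply/hasP; exists (Ordinal dp) => //; exact: mem_index_enum.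
- move=> t /andP[t0 t1] [_ /(_ k (ltn_ord k))]; apply => j.
  by rewrite !mxE gtr_pMl.
Qed.

Lemma Fplus_ge n i : (0 < d)%N -> (i < n)%N -> \sum_j X i j w <= Fplus X n w.
Proof.
move=> dp ni; have [z fz hz] := frontier_above dp ni.
apply: le_trans hz _; apply: ub_le_sup; last by exists z.
by case: (has_sup_frontier fz).
Qed.

Lemma Fminus_ge n s : (0 < d)%N -> (0 < n)%N ->
  (forall y : 'I_d -> R, (forall j, 0 <= y j) -> \sum_j y j < s ->
     exists2 i, (i < n)%N & forall j, y j < X i j w) ->
  s <= Fminus X n w.
Proof.
move=> dp n0 hs; have [z fz _] := frontier_above dp n0.
apply: lb_le_inf; first by exists (coord_sum z), z.
move=> _ [u /frontier_ge[u0 hu] <-]; rewrite leNgt; apply/negP => us.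
by have [i ni h] := hs (fun j => u ord0 j) u0 us; exact: (hu i ni).
Qed.

End frontier.

(** * Record counts and record times *)

Section record_counts.
Context {R : realType} {d0 : measure_display} {Omega : measurableType d0}.
Context {d : nat} (X : nat -> 'I_d -> Omega -> R) (w : Omega).

Lemma nrecordsS n :
  nrecords X w n.+1 = (nrecords X w n + asbool (is_record X w n))%N.
Proof. by rewrite /nrecords big_ord_recr. Qed.

Lemma nrecords_mono a b : (a <= b)%N -> (nrecords X w a <= nrecords X w b)%N.
Proof.
by move=> /subnK <-; elim: (b - a)%N => // n IH; rewrite addSn nrecordsS; lia.
Qed.

Lemma nrecords_le n : (nrecords X w n <= n)%N.
Proof. by elim: n => [|n IH]; [rewrite /nrecords big_ord0|rewrite nrecordsS; case: asbool; lia]. Qed.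

(** A vector that is not a record is strictly below an earlier one, so the constraint it adds is
    already implied. *)
Lemma RS_nonrecord n : ~ is_record X w n -> RS X n.+1 w = RS X n w.
Proof.
move=> /existsNP[i /not_implyP[ni /contrapT h]].
apply/seteqP; split=> z [z0 hz]; split=> // k kn.
  by apply: hz; rewrite ltnW.
move: kn; rewrite ltnS leq_eqVlt => /orP[/eqP-> hk|]; last exact: hz.
by apply: (hz i ni) => j; exact: lt_trans (hk j) (h j).
Qed.

Lemma RS_eq_nrecords a b : (a <= b)%N -> nrecords X w a = nrecords X w b ->
  RS X a w = RS X b w.
Proof.
move=> /subnK <-; elim: (b - a)%N => // n IH; rewrite addSn nrecordsS => e.
have m := nrecords_mono (leq_addl n a).
have [/asboolP r|r] := boolP (asbool (is_record X w (n + a))).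
  by move: e; rewrite asboolT//; lia.
rewrite RS_nonrecord; last by move: r => /asboolPn.
by apply: IH; move: e; rewrite (negPf r); lia.
Qed.

(** Indices start at 0, so for positive m [Trec] counts the vectors seen up to and including the
    m-th record. The record count grows by at most 1 at a time, hence takes the value m exactly. *)
Lemma Trec_spec m n : (m <= nrecords X w n)%N ->
  [/\ nrecords X w (Trec X m w) = m, (Trec X m w <= n)%N & (m <= Trec X m w)%N].
Proof.
move=> mn; rewrite /Trec; case: pselect => [h|]; last by case; exists n.
case: ex_minnP => T hT minT.
have Tm : nrecords X w T = m.
  apply/eqP; rewrite eqn_leq hT andbT; case: T hT minT => [|T] hT minT.
    by rewrite /nrecords big_ord0.
  rewrite nrecordsS; have : ~~ (m <= nrecords X w T)%N.
    by apply/negP => /minT; rewrite ltnn.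
  by rewrite -ltnNge; case: asbool; lia.
by split=> //; [exact: minT|rewrite -Tm; exact: nrecords_le].
Qed.

(** The region changes only at records, so the width at any n is already a term of the sequence at
    record times. This allows the upper limit to be studied at arbitrary n. *)
Lemma Wtilde_nrecords n : Wtilde X (nrecords X w n) w = Wn X n w.
Proof.
have [e1 Tn _] := Trec_spec (leqnn (nrecords X w n)).
rewrite /Wtilde /Wn /Fplus /Fminus /frontier.
by rewrite (RS_eq_nrecords Tn).
Qed.

End record_counts.

(** * Logarithmic levels and dyadic interpolation *)

Section asymptotics.
Context {R : realType}.
Implicit Types (x a c K : R).

Lemma near_pinfty_ge K : \forall x \near +oo, K <= x.
Proof. by apply: nbhs_pinfty_ge; exact: num_real. Qed.

Lemma near_powR_ge a K : 0 < a -> \forall x \near +oo, K <= x `^ a.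
Proof.
move=> a0; near=> x.
have x0 : 0 <= x by near: x; exact: near_pinfty_ge.
have : (`|K| + 1) `^ a^-1 <= x by near: x; exact: near_pinfty_ge.
move=> /(ge0_ler_powR (ltW a0)); rewrite !nnegrE powR_ge0 => /(_ isT x0).
rewrite -powRrM mulVf ?gt_eqF// powRr1; last by rewrite addr_ge0.
by apply: le_trans; apply: le_trans (ler_norm K) _; rewrite lerDl.
Unshelve. all: by end_near.
Qed.

(** Half of the exponent dominates the logarithm, the other half absorbs the constant. *)
Lemma near_ln_le_powR a K : 0 < a -> \forall x \near +oo, K * ln x <= x `^ a.
Proof.
move=> a0; have a20 : 0 < a / 2 by rewrite divr_gt0.
near=> x.
have x1 : 1 <= x by near: x; exact: near_pinfty_ge.
have x0 : 0 < x by apply: lt_le_trans x1.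
have lx : 0 <= ln x by rewrite ln_ge0.
have h1 : ln x <= (a / 2)^-1 * x `^ (a / 2).
  rewrite mulrC ler_pdivlMr// mulrC -ln_powR.
  have y0 : 0 < x `^ (a / 2) by rewrite powR_gt0.
  rewrite -[in leLHS](subrK 1 (x `^ _)) addrC.
  by apply: le_trans (le_ln1Dx _) _; lra.
have h2 : `|K| * (a / 2)^-1 <= x `^ (a / 2) by near: x; exact: near_powR_ge.
apply: (@le_trans _ _ (`|K| * ln x)); first by rewrite ler_wpM2r// ler_norm.
apply: le_trans (ler_wpM2l (normr_ge0 K) h1) _.
rewrite mulrA; apply: le_trans (ler_wpM2r (powR_ge0 _ _) h2) _.
by rewrite -powRD -?splitr//; apply/implyP => _; rewrite gt_eqF.
Unshelve. all: by end_near.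
Qed.

Lemma near_expR_powR a c K : 0 < a -> 0 < c ->
  \forall x \near +oo, expR (- (a * x `^ c)) <= x `^ (- K).
Proof.
move=> a0 c0; near=> x.
have x1 : 1 <= x by near: x; exact: near_pinfty_ge.
have x0 : 0 < x by apply: lt_le_trans x1.
rewrite [leRHS]/powR gt_eqF// ler_expR mulNr lerN2.
rewrite -ler_pdivrMl// mulrA.
by near: x; exact: near_ln_le_powR.
Unshelve. all: by end_near.
Qed.

Lemma near_ln_ge K : \forall x \near +oo, K <= ln x.
Proof.
near=> x.
have x0 : 0 < x by near: x; exact: nbhs_pinfty_gt.
rewrite -ler_expR lnK//; near: x; exact: near_pinfty_ge.
Unshelve. all: by end_near.
Qed.

(** Asymptotic conditions are stated in the variable l = ln n; this converts them into a threshold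
    for n. *)
Lemma near_lnn (Q : R -> Prop) : (\forall x \near +oo, Q x) ->
  exists n0, forall n : nat, (n0 <= n)%N -> Q (ln n%:R).
Proof.
move=> [M [Mr hM]]; exists (Num.trunc (expR M)).+2 => n hn; apply: hM.
rewrite -ltr_expR lnK; last by rewrite posrE ltr0n; lia.
by apply: lt_le_trans (truncnS_gt _) _; rewrite ler_nat; exact: ltnW.
Qed.

Lemma ln2_ge_half : 2^-1 <= ln 2 :> R.
Proof.
have h : ln 2^-1 <= - 2^-1 :> R.
  rewrite [X in ln X](_ : _ = 1 + - 2^-1); last by lra.
  by apply: le_ln1Dx; lra.
by move: h; rewrite lnV ?posrE//; lra.
Qed.

Lemma ln2_le1 : ln 2 <= 1 :> R.
Proof. by rewrite [X in ln X](_ : _ = 1 + 1)//; apply: le_ln1Dx; lra. Qed.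

Lemma ln_2X k : ln (2 ^ k)%:R = k%:R * ln 2 :> R.
Proof. by rewrite natrX lnXn// mulr_natl. Qed.

Lemma natr_expR_ln n : (0 < n)%N -> n%:R = expR (ln n%:R) :> R.
Proof. by move=> n0; rewrite lnK// posrE ltr0n. Qed.

(** The scale of all bounds: by [mul_expR_level], changing [a] changes n e^-level by a power of ln
    n. *)
Definition level (a : R) (n : nat) : R := ln n%:R + a * ln (ln n%:R).

Lemma mul_expR_level a n : (0 < n)%N -> 0 < ln n%:R :> R ->
  n%:R * expR (- level a n) = ln n%:R `^ (- a).
Proof.
move=> n0 l0; rewrite {1}(natr_expR_ln n0) -expRD /powR gt_eqF//.
by congr expR; rewrite /level; ring.
Qed.

Lemma ln_dyadic k n : (1 < k)%N -> (2 ^ k <= n < 2 ^ k.+1)%N ->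
  [/\ 1 <= ln (2 ^ k)%:R :> R,
      ln (2 ^ k)%:R <= ln n%:R :> R, ln n%:R <= ln (2 ^ k)%:R + 1 :> R,
      ln n%:R <= ln (2 ^ k.+1)%:R :> R & ln (2 ^ k.+1)%:R <= ln n%:R + 1 :> R].
Proof.
move=> k1 /andP[kn nk].
have p2 m : 0 < (2 ^ m)%:R :> R by rewrite ltr0n expn_gt0.
have n0 : 0 < n%:R :> R by rewrite ltr0n; apply: leq_trans kn; rewrite expn_gt0.
have h1 : ln (2 ^ k)%:R <= ln n%:R :> R by rewrite ler_ln ?posrE// ler_nat.
have h2 : ln n%:R <= ln (2 ^ k.+1)%:R :> R by rewrite ler_ln ?posrE// ler_nat ltnW.
have h3 : ln (2 ^ k.+1)%:R = ln (2 ^ k)%:R + ln 2 :> R.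
  by rewrite !ln_2X -natr1 mulrDl mul1r.
have l2 := ln2_le1; have l2' := ln2_ge_half.
split=> //; try by rewrite h3 in h2 *; lra.
have k2 : 2 <= k%:R :> R by rewrite ler_nat.
rewrite ln_2X; nra.
Qed.

Lemma lnD1 x y : 1 <= x -> y <= x + 1 -> 0 < y -> ln y <= ln x + 1.
Proof.
move=> x1 yx y0; apply: (@le_trans _ _ (ln x + ln 2)); last by rewrite lerD2l ln2_le1.
by rewrite -lnM ?posrE//; [rewrite ler_ln ?posrE//|]; lra.
Qed.

(** Inside a dyadic block ln n and ln (ln n) vary by at most 1. This bounded loss is paid for by an
    arbitrarily small change of the coefficient of ln (ln n). *)
Lemma level_dyadic_down a b k n : (1 < k)%N -> (2 ^ k <= n < 2 ^ k.+1)%N ->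
  1 + `|b| <= (b - a) * ln (ln n%:R) -> level a n <= level b (2 ^ k).
Proof.
move=> k1 kn; have [] := ln_dyadic k1 kn; rewrite /level.
move: (ln (2 ^ k)%:R) (ln (2 ^ k.+1)%:R) (ln n%:R) => u v l u1 ul lu _ _.
have lul : `|ln l - ln u| <= 1.
  rewrite ger0_norm ?subr_ge0 ?ler_ln ?posrE//; try lra.
  by have : ln l <= ln u + 1 by [apply: lnD1 => //; lra]; lra.
move: (ln u) (ln l) lul => lu' ll lul hb.
have : b * (ll - lu') <= `|b|.
  by apply: le_trans (ler_norm _) _; rewrite normrM ler_piMr.
lra.
Qed.

Lemma level_dyadic_up a b k n : (1 < k)%N -> (2 ^ k <= n < 2 ^ k.+1)%N ->
  1 + `|a| <= (b - a) * ln (ln n%:R) -> level a (2 ^ k.+1) <= level b n.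
Proof.
move=> k1 kn; have [] := ln_dyadic k1 kn; rewrite /level.
move: (ln (2 ^ k)%:R) (ln (2 ^ k.+1)%:R) (ln n%:R) => u v l u1 ul _ lv vl.
have lvl : `|ln v - ln l| <= 1.
  rewrite ger0_norm ?subr_ge0 ?ler_ln ?posrE//; try lra.
  by have : ln v <= ln l + 1 by [apply: lnD1 => //; lra]; lra.
move: (ln v) (ln l) lvl => lv' ll lvl hb.
have : a * (lv' - ll) <= `|a|.
  by apply: le_trans (ler_norm _) _; rewrite normrM ler_piMr.
lra.
Qed.

Lemma powR_ln2X_le k c : (0 < k)%N -> 0 <= c ->
  ln (2 ^ k)%:R `^ (- c) <= 2 `^ c * k%:R `^ (- c) :> R.
Proof.
move=> k0 c0; have kR : 0 < k%:R :> R by rewrite ltr0n.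
have l2 := ln2_ge_half.
have lk : 0 < ln (2 ^ k)%:R :> R by rewrite ln_2X mulr_gt0//; lra.
rewrite !powRN -[leLHS]mul1r -ler_pdivlMr ?invr_gt0 ?powR_gt0// invrK.
rewrite -mulrA (mulrC _ (_ `^ _)) mulrA -powRM ?ler0n//; last exact: ltW.
rewrite ler_pdivlMr ?powR_gt0// mul1r.
apply: ge0_ler_powR; rewrite ?nnegrE ?ler0n ?mulr_ge0// ?(ltW lk)//.
rewrite ln_2X; nra.
Qed.

End asymptotics.

Section interpolation.
Context {R : realType} {d0 : measure_display} {Omega : measurableType d0}.
Context {P : probability Omega R}.
Local Notation ev := (almost_uniformly_eventually P).

(** Borel-Cantelli along the times [g k], after which n is compared with the two ends of its block.
    The sequence [g] is left free because powers of 2 are not sparse enough for the count of high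
    vectors. *)
Lemma ev_interpolate (g : nat -> nat) (U : nat -> set Omega) (C c : R) (k0 : nat)
    (Q : nat -> Omega -> Prop) :
  (forall k, (k <= g k)%N) -> 0 < c -> (forall k, measurable (U k)) ->
  (forall k, (k0 <= k)%N -> Pr P (U k) <= C * k%:R `^ (- (1 + c))) ->
  (forall w k n, (k0 <= k)%N -> (g k <= n < g k.+1)%N ->
     ~ U k w -> ~ U k.+1 w -> Q n w) ->
  ev Q.
Proof.
move=> gk c0 mU PU UQ; have bc := borel_cantelli_powR c0 mU PU.
apply: ev_shift bc => N; exists (g (maxn N k0)) => w hw n hn.
have ex : exists k, (g k <= n)%N by exists (maxn N k0).
have bd k : (g k <= n)%N -> (k <= n)%N by move=> /(leq_trans (gk k)).
case: (ex_maxnP ex bd) => k kn kmax.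
have Kk : (maxn N k0 <= k)%N by exact: kmax.
apply: (UQ w k); rewrite ?(leq_trans (leq_maxr _ _) Kk)//.
- by rewrite kn /= ltnNge; apply/negP => /kmax; rewrite ltnn.
- by apply: hw; rewrite (leq_trans (leq_maxl _ _) Kk).
- by apply: hw; apply: leq_trans (leqnSn k); apply: leq_trans Kk; exact: leq_maxl.
Qed.

Lemma ev_dyadic (U : nat -> set Omega) (C c : R) (n0 : nat)
    (Q : nat -> Omega -> Prop) :
  0 < c -> (forall n, measurable (U n)) ->
  (forall n, (n0 <= n)%N -> Pr P (U n) <= C * ln n%:R `^ (- (1 + c))) ->
  (forall w k n, (n0 <= n)%N -> (n0 <= 2 ^ k)%N -> (n0 <= 2 ^ k.+1)%N ->
     (1 < k)%N -> (2 ^ k <= n < 2 ^ k.+1)%N ->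
     ~ U (2 ^ k)%N w -> ~ U (2 ^ k.+1)%N w -> Q n w) ->
  ev Q.
Proof.
move=> c0 mU PU UQ.
have k2 k : (k <= 2 ^ k)%N by rewrite ltnW// ltn_expl.
apply: (@ev_interpolate (fun k => 2 ^ k)%N (fun k => U (2 ^ k)%N)
  (`|C| * 2 `^ (1 + c)) c (maxn n0 2)) => //; last first.
  move=> w k n; rewrite geq_max => /andP[n0k k1] kn.
  have n02 : (n0 <= 2 ^ k)%N by exact: leq_trans (k2 k).
  apply: (UQ w k) => //; case/andP: (kn) => kn' nk; first exact: leq_trans kn'.
  exact: leq_trans n02 (ltnW (leq_ltn_trans kn' nk)).
move=> k; rewrite geq_max => /andP[n0k k1].
apply: le_trans (PU _ (leq_trans n0k (k2 _))) _.
apply: le_trans (ler_wpM2r (powR_ge0 _ _) (ler_norm C)) _.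
rewrite -mulrA ler_wpM2l//; apply: powR_ln2X_le => //; first exact: ltnW.
lra.
Qed.

End interpolation.

(** * Almost sure bounds for the minimum and the maximum of the coordinate sum *)

Section frontier_bounds.
Context {R : realType} {d0 : measure_display} {Omega : measurableType d0}.
Context {P : probability Omega R} {e : nat} {X : nat -> 'I_e.+1 -> {RV P >-> R}}.
Hypothesis expX : forall k j A, measurable A ->
  P (X k j @^-1` A) = exponential_prob 1 A.
Hypothesis indep :
  mutually_independent P (fun kj : nat * 'I_e.+1 => (X kj.1 kj.2 : Omega -> R)).
Local Notation ev := (almost_uniformly_eventually P).
Local Notation d := e.+1.

(** Gives F_n^- >= s by [Fminus_ge] without mentioning the frontier, and is monotone in [s] and
    [n]. *)
Definition covers (s : R) (n : nat) (w : Omega) := forall y : 'I_e.+1 -> R,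
  (forall j, 0 <= y j) -> \sum_j y j < s ->
  exists2 i, (i < n)%N & hits X y i w.

Lemma covers_sub s s' n n' w : s <= s' -> (n' <= n)%N ->
  covers s' n' w -> covers s n w.
Proof.
move=> ss nn h y y0 ys; have [i ni hi] := h y y0 (lt_le_trans ys ss).
by exists i => //; exact: leq_trans nn.
Qed.

(** It suffices to hit every integer point of coordinate sum at most s + d with coordinates at most
    the integer part of s plus 1: each coordinate of [y] is rounded up to the next integer, which
    costs at most 1 per coordinate. There are at most (s + 2)^d such points. *)
Lemma covers_whp s n : 0 <= s -> exists U, [/\ measurable U,
  Pr P U <= (s + 2) ^+ d * expR (- (n%:R * expR (- (s + d%:R)))) &
  forall w, ~ U w -> covers s n w].
Proof.
move=> s0; pose K := (Num.trunc s).+2.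
pose y (a : {ffun 'I_e.+1 -> 'I_K}) (j : 'I_e.+1) : R := (a j)%:R.
pose D := [set a : {ffun 'I_e.+1 -> 'I_K} | \sum_j y a j <= s + d%:R].
pose U := \bigcup_(a in D) [set w | forall i, (i < n)%N -> ~ hits X (y a) i w].
have mU : measurable U.
  apply: fin_bigcup_measurable => [|a _]; first exact: finite_finset.
  exact: measurable_no_hit.
exists U; split=> //.
- pose r := [seq a <- index_enum {ffun 'I_e.+1 -> 'I_K} | \sum_j y a j <= s + d%:R].
  apply: le_trans (@Pr_union_bound _ _ _ P _ r
    (fun a => [set w | forall i, (i < n)%N -> ~ hits X (y a) i w]) _ mU _ _) _.
  + by move=> a _; exact: measurable_no_hit.
  + by move=> w [a Da h]; exists a => //; rewrite mem_filter Da mem_index_enum.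
  apply: (@le_trans _ _ (\sum_(a <- r) expR (- (n%:R * expR (- (s + d%:R)))))).
    rewrite big_seq [leRHS]big_seq; apply: ler_sum => a; rewrite mem_filter => /andP[ya _].
    apply: le_trans (Pr_no_hit expX indep n _) _; first by move=> j; rewrite ler0n.
    by rewrite ler_expR lerN2 ler_wpM2l// ler_expR lerN2.
  rewrite big_filter.
  apply: (@le_trans _ _ (\sum_(a : {ffun 'I_e.+1 -> 'I_K}) expR (- (n%:R * expR (- (s + d%:R)))))).
    by rewrite [leRHS](bigID (fun a => \sum_j y a j <= s + d%:R)) /= lerDl sumr_ge0// => a _; exact: expR_ge0.
  rewrite sumr_const card_ffun !card_ord -[_ *+ (_ ^ _)]mulr_natl natrX.
  rewrite ler_wpM2r ?expR_ge0// lerXn2r ?nnegrE ?ler0n//; first by lra.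
  have -> : K%:R = (Num.trunc s)%:R + 2 :> R by rewrite -natrD addn2.
  by rewrite lerD2r; have /andP[] := truncn_itv s0.
- move=> w nU z z0 zs; apply: contrapT => nh; apply: nU.
  have zj j : z j <= s.
    by apply: ltW; apply: le_lt_trans zs; rewrite (bigD1 j)//= lerDl sumr_ge0.
  have tz j : ((Num.trunc (z j)).+1 < K)%N.
    by rewrite !ltnS; apply: le_truncn; exact: zj.
  exists [ffun j => inord (Num.trunc (z j)).+1].
    rewrite /D /= /y -[X in _ + X]mulr1 mulr_natl -[in X in _ + X](card_ord e.+1) -sumr_const.
    apply: (@le_trans _ _ (\sum_j (z j + 1))); last by rewrite big_split /= lerD2r ltW.
    apply: ler_sum => j _; rewrite ffunE inordK// -natr1 lerD2r.
    by have /andP[] := truncn_itv (z0 j).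
  move=> i ni h; apply: nh; exists i => // j; apply: le_lt_trans (h j).
  by rewrite /y ffunE inordK//; exact/ltW/truncnS_gt.
Qed.

Lemma ev_covers (c : R) : 0 < c -> ev (fun n w => covers (level (- c) n) n w).
Proof.
move=> c0; pose s n : R := level (- (c / 2)) n.
have c20 : 0 < c / 2 by rewrite divr_gt0.
have hU n : exists U, [/\ measurable U,
    0 <= s n -> Pr P U <= (s n + 2) ^+ d * expR (- (n%:R * expR (- (s n + d%:R)))) &
    forall w, ~ U w -> covers (s n) n w].
  have [sn|sn] := leP 0 (s n).
    by have [U [mU pU qU]] := covers_whp n sn; exists U.
  (* Below level 0 no nonnegative point has to be covered. *)
  exists set0; split=> // w _ y y0 ys.
  have := le_lt_trans (sumr_ge0 _ (fun j _ => y0 j)) (lt_trans ys sn).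
  by rewrite ltxx.
have /choice[U hU'] := hU.
pose Q (l : R) := [/\ 1 <= l, 0 <= c / 2 * ln l, c / 2 * ln l <= l,
   1 + `|- (c / 2)| <= c / 2 * ln l &
   expR (- (expR (- d%:R) * l `^ (c / 2))) <= l `^ (- (2 + d%:R))].
have [n0 hn0] : exists n0, forall n : nat, (n0 <= n)%N -> Q (ln n%:R).
  apply: near_lnn; near=> l; split.
  - by near: l; exact: near_pinfty_ge.
  - by rewrite mulr_ge0 ?(ltW c20)//; near: l; exact: near_ln_ge.
  - have l1 : 1 <= l by near: l; exact: near_pinfty_ge.
    rewrite -[leRHS]powRr1; last by lra.
    by near: l; exact: near_ln_le_powR.
  - by rewrite -ler_pdivrMl//; near: l; exact: near_ln_ge.
  - by near: l; apply: near_expR_powR => //; exact: expR_gt0.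
apply: (@ev_dyadic _ _ _ _ U (3 ^+ d) 1 n0.+1) => //.
- by move=> n; case: (hU' n).
- move=> n nn0; have [_ + _] := hU' n.
  have [l1 ll0 h2 _ _] := hn0 _ (ltnW nn0).
  have n_gt0 : (0 < n)%N by exact: leq_trans nn0.
  have l0 : 0 < ln n%:R :> R by exact: lt_le_trans l1.
  have -> : n%:R * expR (- (s n + d%:R)) = expR (- d%:R) * ln n%:R `^ (c / 2).
    by rewrite opprD expRD mulrA mul_expR_level// opprK mulrC.
  have [sn sn3] : 0 <= s n /\ s n + 2 <= 3 * ln n%:R.
    by rewrite /s /level mulNr; split; lra.
  have [_ _ _ _ h3] := hn0 _ (ltnW nn0).
  move=> /(_ sn) h; apply: le_trans h _.
  apply: le_trans (ler_pM _ _ (_ : (s n + 2) ^+ d <= (3 * ln n%:R) ^+ d) h3) _.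
  + by rewrite exprn_ge0// addr_ge0.
  + exact: expR_ge0.
  + by rewrite lerXn2r ?nnegrE// ?mulr_ge0 ?(ltW l0)// addr_ge0.
  rewrite exprMn -mulrA ler_wpM2l ?exprn_ge0//.
  rewrite -powR_mulrn ?(ltW l0)// -powRD; last by apply/implyP => _; rewrite gt_eqF.
  by rewrite ler_powR// opprD addrCA subrr addr0.
- move=> w k n n0n n0k _ k1 kn nU _.
  have [_ _ /(_ w nU)] := hU' (2 ^ k)%N.
  apply: covers_sub; last by case/andP: kn.
  apply: level_dyadic_down kn _ => //.
  have [_ _ _ h _] := hn0 n (ltnW n0n).
  by rewrite (_ : _ - _ = c / 2)//; field.
Unshelve. all: by end_near.
Qed.

(** The union bound at level d + c/2 gives l^e l^-(d + c/2) = l^-(1 + c/2). The extra 1 in d = e + 1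
    is the price of summability along n = 2^k, where l is proportional to k. *)
Lemma ev_tot_le (c : R) : 0 < c ->
  ev (fun n w => forall i, (i < n)%N -> tot X i w <= level (d%:R + c) n).
Proof.
move=> c0; pose s n : R := level (d%:R + c / 2) n.
have c20 : 0 < c / 2 by rewrite divr_gt0.
have dc0 : 0 <= d%:R + c / 2 by rewrite addr_ge0// ltW.
pose U n := \bigcup_(i in `I_n) tot_ge X (s n) i.
have mU n : measurable (U n).
  by apply: fin_bigcup_measurable => [|i _];
     [exact: finite_II|exact: measurable_tot_ge].
pose Q (l : R) := [/\ 1 <= l, 0 <= (d%:R + c / 2) * ln l, (d%:R + c / 2) * ln l <= l &
       1 + `|d%:R + c / 2| <= c / 2 * ln l].
have [n0 hn0] : exists n0, forall n : nat, (n0 <= n)%N -> Q (ln n%:R).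
  apply: near_lnn; near=> l; split.
  - by near: l; exact: near_pinfty_ge.
  - by rewrite mulr_ge0//; near: l; exact: near_ln_ge.
  - have l1 : 1 <= l by near: l; exact: near_pinfty_ge.
    rewrite -[leRHS]powRr1; last by lra.
    by near: l; exact: near_ln_le_powR.
  - by rewrite -ler_pdivrMl//; near: l; exact: near_ln_ge.
apply: (@ev_dyadic _ _ _ _ U (3 ^+ e * expR e%:R) (c / 2) n0.+1) => //.
- move=> n nn0; have [l1 ll0 h1 _] := hn0 _ (ltnW nn0).
  have l0 : 0 < ln n%:R :> R by exact: lt_le_trans l1.
  have n_gt0 : (0 < n)%N by exact: leq_trans nn0.
  have [sn sn3] : 0 <= s n /\ s n + 1 <= 3 * ln n%:R.
    by rewrite /s /level; split; lra.
  apply: le_trans (@Pr_union_bound _ _ _ P _ (iota 0 n) (tot_ge X (s n)) _ (mU n) _ _) _.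
  + by move=> i _; exact: measurable_tot_ge.
  + by move=> w [i ni h]; exists i => //; rewrite mem_iota.
  apply: (@le_trans _ _ (\sum_(i <- iota 0 n) ((s n + 1) ^+ e * expR (e%:R - s n)))).
    by apply: ler_sum => i _; exact: (Pr_tot_ge_le expX indep).
  rewrite big_const_seq count_predT size_iota iter_addr_0 -[X in X <= _]mulr_natl.
  rewrite mulrCA expRD [X in _ * X <= _]mulrCA mul_expR_level//.
  apply: (@le_trans _ _ ((3 * ln n%:R) ^+ e * (expR e%:R * ln n%:R `^ (- (d%:R + c / 2))))).
    rewrite ler_wpM2r ?mulr_ge0 ?expR_ge0 ?powR_ge0//.
    by rewrite lerXn2r ?nnegrE ?mulr_ge0 ?(ltW l0)// addr_ge0.
  rewrite exprMn -!mulrA ler_wpM2l ?exprn_ge0// mulrCA ler_wpM2l ?expR_ge0//.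
  rewrite -powR_mulrn ?(ltW l0)// -powRD; last by apply/implyP => _; rewrite gt_eqF.
  by rewrite ler_powR// -[d%:R]natr1; lra.
- move=> w k n n0n _ _ k1 kn _ nU i ni.
  have : tot X i w < s (2 ^ k.+1)%N.
    rewrite ltNge; apply/negP => h; apply: nU; exists i => //=.
    by apply: ltn_trans ni _; case/andP: kn.
  move=> /ltW /le_trans; apply.
  apply: level_dyadic_up kn _ => //.
  have [_ _ _ h] := hn0 n (ltnW n0n).
  by rewrite (_ : _ - _ = c / 2)//; field.
Unshelve. all: by end_near.
Qed.

(** At level e - c/2 the expected number of large totals is at least C l^(c/2), so by independence
    none occurs with probability at most exp (- C l^(c/2)), which is below any power of l. *)
Lemma ev_tot_ge (c : R) : (0 < e)%N -> 0 < c <= 1 ->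
  ev (fun n w => exists2 i, (i < n)%N & level (e%:R - c) n <= tot X i w).
Proof.
move=> e_gt0 /andP[c0 c1]; pose s n : R := level (e%:R - c / 2) n.
have c20 : 0 < c / 2 by rewrite divr_gt0.
have eR : 1 <= e%:R :> R by rewrite ler1n.
have e0 : 0 < e%:R :> R by rewrite ltr0n.
have ec0 : 0 <= e%:R - c / 2 by lra.
pose U n := [set w | forall i, (0 <= i < 0 + n)%N -> ~ tot_ge X (s n) i w].
have mU n : measurable (U n).
  rewrite (_ : U n = \bigcap_(i in `I_n) ~` tot_ge X (s n) i)//.
  by apply: fin_bigcap_measurable => [|i _];
     [exact: finite_II|apply: measurableC; exact: measurable_tot_ge].
(* From M / 2 >= l / (4 e), where M is the integer part of l / e. *)
pose C : R := (4 * e%:R)^-1 ^+ e.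
have C0 : 0 < C by rewrite exprn_gt0// invr_gt0 mulr_gt0.
pose Q (l : R) := [/\ 2 * e%:R <= l, 0 <= ln l,
   expR (- (C * l `^ (c / 2))) <= l `^ (- 2) &
   1 + `|e%:R - c / 2| <= c / 2 * ln l].
have [n0 hn0] : exists n0, forall n : nat, (n0 <= n)%N -> Q (ln n%:R).
  apply: near_lnn; near=> l; split.
  - by near: l; exact: near_pinfty_ge.
  - by near: l; exact: near_ln_ge.
  - by near: l; apply: near_expR_powR.
  - by rewrite -ler_pdivrMl//; near: l; exact: near_ln_ge.
apply: (@ev_dyadic _ _ _ _ U 1 1 n0.+1) => //.
- move=> n nn0; have [l1 ll0 h1 _] := hn0 _ (ltnW nn0).
  have l0 : 0 < ln n%:R :> R by apply: lt_le_trans l1; rewrite mulr_gt0.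
  have n_gt0 : (0 < n)%N by exact: leq_trans nn0.
  apply: le_trans (Pr_avoid indep 0 n (A := tot_ge X (s n)) _) _.
    by move=> i; exact: history_tot_ge.
  rewrite mul1r; apply: le_trans h1; rewrite ler_expR lerN2.
  pose M := Num.trunc (ln n%:R / e%:R : R).
  have M1 : M%:R * e%:R <= ln n%:R :> R.
    rewrite -ler_pdivlMr//.
    have /truncn_itv/andP[] // : 0 <= ln n%:R / e%:R :> R.
    by rewrite divr_ge0// ltW.
  have M2 : (2 * e%:R)^-1 * ln n%:R <= M%:R :> R.
    have : ln n%:R / e%:R < M.+1%:R :> R by exact: truncnS_gt.
    have : 2 <= ln n%:R / e%:R :> R by rewrite ler_pdivlMr.
    rewrite -[M.+1%:R]natr1 (_ : _ * _ = 2^-1 * (ln n%:R / e%:R)).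
      by move: (M%:R : R) (ln n%:R / e%:R) => m q; lra.
    by rewrite invfM -mulrA [X in _ * X]mulrC.
  have Ms : M%:R * e%:R <= s n.
    by apply: le_trans M1 _; rewrite /s lerDl mulr_ge0.
  apply: (@le_trans _ _ (\sum_(0 <= i < 0 + n) ((M%:R / 2) ^+ e * expR (- s n)))); last first.
    by apply: ler_sum => i _; exact: (Pr_tot_ge_ge expX indep).
  rewrite sumr_const_nat add0n subn0 -[X in _ <= X]mulr_natl mulrCA.
  rewrite mul_expR_level//.
  apply: (@le_trans _ _ (((4 * e%:R)^-1 * ln n%:R) ^+ e * ln n%:R `^ (- (e%:R - c / 2)))).
    rewrite exprMn -mulrA ler_wpM2l ?(ltW C0)//.
    rewrite -powR_mulrn ?(ltW l0)// -powRD; last by apply/implyP => _; rewrite gt_eqF.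
    by rewrite opprB addrC subrK.
  rewrite ler_wpM2r ?powR_ge0// lerXn2r ?nnegrE ?divr_ge0//.
    by rewrite mulr_ge0 ?(ltW l0)// invr_ge0 mulr_ge0// ltW.
  rewrite ler_pdivlMr//; apply: le_trans M2.
  rewrite (_ : (4 * e%:R)^-1 * ln n%:R * 2 = (2 * e%:R)^-1 * ln n%:R :> R)//.
  by field; rewrite ?gt_eqF.
- move=> w k n n0n _ _ k1 kn nU _.
  move: nU => /existsNP[i /not_implyP[ni /contrapT hi]].
  exists i; first by apply: leq_trans ni _; case/andP: kn.
  apply: le_trans hi; apply: level_dyadic_down kn _ => //.
  have [_ _ _ h] := hn0 n (ltnW n0n).
  by rewrite (_ : e%:R - c / 2 - (e%:R - c) = c / 2)//; field.
Unshelve. all: by end_near.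
Qed.

End frontier_bounds.
Arguments covers {R d0 Omega P e} X s n w.

(** * Free cells *)

Section free_cells.
Context {R : realType} {d0 : measure_display} {Omega : measurableType d0}.
Context {P : probability Omega R} {e : nat} {X : nat -> 'I_e.+1 -> {RV P >-> R}}.
Hypothesis expX : forall k j A, measurable A ->
  P (X k j @^-1` A) = exponential_prob 1 A.
Hypothesis indep :
  mutually_independent P (fun kj : nat * 'I_e.+1 => (X kj.1 kj.2 : Omega -> R)).
Local Notation ev := (almost_uniformly_eventually P).
Local Notation d := e.+1.

Definition free (y : 'I_e.+1 -> R) (n : nat) : set Omega :=
  [set w | forall i, (i < n)%N -> ~ hits X y i w].

Lemma history_free y n : measurable (free y n : set (history X `I_n)).
Proof.
rewrite (_ : free y n = \bigcap_(i in `I_n) ~` hits X y i)//.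
apply: fin_bigcap_measurable; first exact: finite_II.
by move=> i /= ni; apply: measurableC; exact: history_hits.
Qed.

(** A vector above both corners exceeds one of them by a further [h] in the coordinate where they
    differ, so it lies above a point of coordinate sum s + h. *)
Lemma Pr_hits_overlap (s h : R) (a b : 'I_e -> nat) i k : 0 <= h ->
  h * \sum_i (a i)%:R <= s -> h * \sum_i (b i)%:R <= s -> a k != b k ->
  Pr P (hits X (cell s h a) i `&` hits X (cell s h b) i) <= expR (- (s + h)).
Proof.
wlog ab : a b / (a k < b k)%N.
  move=> H h0 ha hb nab; have := nab; rewrite neq_ltn => /orP[ab|ba].
    exact: H.
  by rewrite setIC; apply: H => //; rewrite eq_sym.
move=> h0 ha hb _.
pose y (j : 'I_e.+1) := cell s h a j + (if j == lift ord0 k then h else 0).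
have y0 j : 0 <= y j.
  by rewrite addr_ge0 ?cell_ge0//; case: ifP.
have -> : s + h = \sum_j y j.
  by rewrite big_split /= sum_cell -big_mkcond big_pred1_eq.
rewrite -(Pr_hits expX indep i y0); apply: le_Pr.
- by apply: measurableI; exact: measurable_hits.
- exact: measurable_hits.
move=> w [wa wb] j; rewrite /y; case: ifPn => [/eqP->|_]; last by rewrite addr0.
apply: le_lt_trans (wb _); rewrite /cell liftK.
by rewrite -[X in _ + X]mulr1 -mulrDr ler_wpM2l// natr1 ler_nat.
Qed.

(** Either distinct vectors hit the r cells, an injective assignment with independent events, or one
    vector hits two cells. The two terms bound these alternatives. *)
Lemma Pr_all_hit (s h : R) (r n : nat) (a : 'I_r -> 'I_e -> nat) : 0 <= h ->
  (forall t, h * \sum_i (a t i)%:R <= s) ->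
  (forall t t', t != t' -> exists k, a t k != a t' k) ->
  Pr P [set w | forall t, exists2 i, (i < n)%N & hits X (cell s h (a t)) i w] <=
  (n%:R * expR (- s)) ^+ r + n%:R * r%:R ^+ 2 * expR (- (s + h)).
Proof.
move=> h0 ha da; set A := [set w | _].
have y0 t j : 0 <= cell s h (a t) j by exact: cell_ge0.
have mA : measurable A.
  rewrite (_ : A = \bigcap_(t in [set: 'I_r]) \bigcup_(i in `I_n)
                    hits X (cell s h (a t)) i).
    apply: fin_bigcap_measurable => [|t _]; first exact: finite_finset.
    apply: fin_bigcup_measurable => [|i _]; first exact: finite_II.
    exact: measurable_hits.
  by apply/seteqP; split=> [w h1 t _|w h1 t]; [exact: h1|exact: (h1 t)].
pose I1 := [seq f : {ffun 'I_r -> 'I_n} <- index_enum {ffun 'I_r -> 'I_n} | injectiveb f].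
pose F1 (f : {ffun 'I_r -> 'I_n}) :=
  [set w | forall t, t \in index_enum 'I_r -> hits X (cell s h (a t)) (f t) w].
pose I2 := [seq u <- index_enum ('I_n * ('I_r * 'I_r))%type | u.2.1 != u.2.2].
pose F2 (u : 'I_n * ('I_r * 'I_r)) :=
  hits X (cell s h (a u.2.1)) u.1 `&` hits X (cell s h (a u.2.2)) u.1.
pose F (u : {ffun 'I_r -> 'I_n} + 'I_n * ('I_r * 'I_r)) :=
  match u with inl f => F1 f | inr u => F2 u end.
apply: le_trans (@Pr_union_bound _ _ _ P _ (map inl I1 ++ map inr I2) F _ mA _ _) _.
- move=> [f|u] _ /=; last by apply: measurableI; exact: measurable_hits.
  rewrite (_ : F1 f = \bigcap_(t in [set` index_enum 'I_r])
     hits X (cell s h (a t)) (f t))//.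
  apply: fin_bigcap_measurable => [|t _]; first exact: finite_seq.
  exact: measurable_hits.
- move=> w Aw.
  have /choice[f hf] : forall t : 'I_r, exists i : 'I_n, hits X (cell s h (a t)) i w.
    by move=> t; have [i ni hi] := Aw t; exists (Ordinal ni).
  have [fi|/injectivePn[t [t' tt' ftt']]] := boolP (injectiveb (finfun f)).
    exists (inl (finfun f)); last by move=> t _; rewrite ffunE; exact: hf.
    by rewrite mem_cat map_f// mem_filter fi mem_index_enum.
  exists (inr (f t, (t, t'))).
    by rewrite mem_cat [X in _ || X]map_f ?orbT// mem_filter /= tt' mem_index_enum.
  rewrite !ffunE in ftt'.
  by split; [exact: hf|rewrite /= ftt'; exact: hf].
rewrite big_cat /= !big_map; apply: lerD.
- apply: (@le_trans _ _ (\sum_(f <- I1) expR (- s) ^+ r)).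
    rewrite big_seq [leRHS]big_seq; apply: ler_sum => f; rewrite mem_filter => /andP[fi _].
    rewrite /F /F1 (Pr_times_inj indep (f := fun t => f t : nat)).
    + rewrite (eq_bigr (fun=> expR (- s))).
        by rewrite prodr_const card_ord.
      by move=> t _; rewrite (Pr_hits expX indep)// sum_cell.
    + rewrite map_inj_uniq ?index_enum_uniq// => t t' /val_inj.
      by move/injectiveP: fi; exact.
    + by move=> t; exact: history_hits.
  rewrite big_filter.
  apply: (@le_trans _ _ (\sum_(f : {ffun 'I_r -> 'I_n}) expR (- s) ^+ r)).
    rewrite [leRHS](bigID (fun f : {ffun 'I_r -> 'I_n} => injectiveb f)) /= lerDl.
    by rewrite sumr_ge0// => f _; rewrite exprn_ge0// expR_ge0.
  by rewrite sumr_const card_ffun !card_ord exprMn -[X in X <= _]mulr_natl natrX.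
- apply: (@le_trans _ _ (\sum_(u <- I2) expR (- (s + h)))).
    rewrite big_seq [leRHS]big_seq; apply: ler_sum => u; rewrite mem_filter => /andP[uu _].
    have [k ak] := da _ _ uu.
    exact: (Pr_hits_overlap _ h0 (ha _) (ha _) ak).
  rewrite big_filter.
  apply: (@le_trans _ _ (\sum_(u : 'I_n * ('I_r * 'I_r)) expR (- (s + h)))).
    rewrite [leRHS](bigID (fun u : 'I_n * ('I_r * 'I_r) => u.2.1 != u.2.2)) /= lerDl.
    by rewrite sumr_ge0// => f _; rewrite expR_ge0.
  rewrite sumr_const !card_prod !card_ord -[X in X <= _]mulr_natl.
  by rewrite !natrM expr2.
Qed.

(* Cells are grouped in blocks of r: g is the block, t the cell inside it. *)
Definition block (r M : nat) (g : {ffun 'I_e -> 'I_M}) (t : 'I_r) (i : 'I_e) : nat :=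
  (r * g i + t)%N.

(** Requiring one free cell per block, and not a particular one, raises the failure probability of a
    block to the power r up to the overlap term, and still leaves at least M^e free cells. *)
Definition good (s h : R) (r M n : nat) : set Omega :=
  [set w | forall g : {ffun 'I_e -> 'I_M}, exists t : 'I_r,
     free (cell s h (block g t)) n w].

(** The position t is the residue modulo r of any coordinate, so at least one coordinate is
    needed. *)
Lemma block_inj r M g t g' t' : (0 < e)%N ->
  @block r M g t =1 @block r M g' t' -> (g, t) = (g', t').
Proof.
move=> e0 H.
have r0 : (0 < r)%N by apply: leq_trans (ltn_ord t).
have tt : t = t'.
  apply: val_inj; have := H (Ordinal e0); rewrite /block => /(congr1 (modn^~ r)).
  by rewrite !(mulnC r) !modnMDl !modn_small.
congr pair => //; apply/ffunP => i; apply: val_inj; have := H i.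
rewrite /block tt => /eqP; rewrite eqn_add2r eqn_pmul2l// => /eqP//.
Qed.

Lemma sum_block_le (s h : R) r M g t : 0 <= h -> h * (e * r * M)%:R <= s ->
  h * \sum_i (@block r M g t i)%:R <= s.
Proof.
move=> h0; apply: le_trans; apply: ler_wpM2l => //.
rewrite -natr_sum ler_nat -[in leqRHS](card_ord e) -mulnA -sum_nat_const.
apply: leq_sum => i _; rewrite /block; have := ltn_ord (g i); have := ltn_ord t.
nia.
Qed.

Lemma history_good s h r M n :
  measurable (good s h r M n : set (history X `I_n)).
Proof.
rewrite (_ : good s h r M n = \bigcap_(g in [set: {ffun 'I_e -> 'I_M}])
   \bigcup_(t in [set: 'I_r]) free (cell s h (block g t)) n).
  apply: fin_bigcap_measurable => [|g _]; first exact: finite_finset.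
  apply: fin_bigcup_measurable => [|t _]; first exact: finite_finset.
  exact: history_free.
apply/seteqP; split=> [w h1 g _|w h1 g].
  by have [t ht] := h1 g; exists t.
by have [t _ ht] := h1 g I; exists t.
Qed.

Lemma measurable_good s h r M n : measurable (good s h r M n).
Proof. exact: history_measurable (@history_good s h r M n). Qed.

Lemma Pr_not_good s h r M n : (0 < e)%N -> 0 <= h ->
  h * (e * r * M)%:R <= s ->
  Pr P (~` good s h r M n) <= M%:R ^+ e *
    ((n%:R * expR (- s)) ^+ r + n%:R * r%:R ^+ 2 * expR (- (s + h))).
Proof.
move=> e0 h0 hs.
pose F (g : {ffun 'I_e -> 'I_M}) := [set w | forall t : 'I_r,
  exists2 i, (i < n)%N & hits X (cell s h (block g t)) i w].
have mG : measurable (~` good s h r M n).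
  by apply: measurableC; exact: measurable_good.
apply: le_trans (@Pr_union_bound _ _ _ P _ (index_enum {ffun 'I_e -> 'I_M}) F _ mG _ _) _.
- move=> g _; rewrite (_ : F g = \bigcap_(t in [set: 'I_r]) \bigcup_(i in `I_n)
                    hits X (cell s h (block g t)) i).
    apply: fin_bigcap_measurable => [|t _]; first exact: finite_finset.
    apply: fin_bigcup_measurable => [|i _]; first exact: finite_II.
    exact: measurable_hits.
  by apply/seteqP; split=> [w h1 t _|w h1 t]; [exact: h1|exact: (h1 t)].
- move=> w /existsNP[g /forallNP hg]; exists g; first exact: mem_index_enum.
  move=> t; have := hg t => /existsNP[i /not_implyP[ni /contrapT hi]].
  by exists i.
apply: (@le_trans _ _ (\sum_(g : {ffun 'I_e -> 'I_M})
   ((n%:R * expR (- s)) ^+ r + n%:R * r%:R ^+ 2 * expR (- (s + h))))).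
  apply: ler_sum => g _; apply: Pr_all_hit => // [t|t t' tt'].
    exact: sum_block_le.
  apply/existsP; apply: contraT => /existsPn H.
  have /(block_inj e0)[] : block g t =1 block g t'.
    by move=> i; have := H i; rewrite negbK => /eqP.
  by move=> E; rewrite E eqxx in tt'.
by rewrite sumr_const card_ffun !card_ord -[X in X <= _]mulr_natl natrX.
Qed.

Local Notation x := (fun k j => X k j : Omega -> R).

(* A cell free at time k makes every vector of its slab a record, and the slabs
   are disjoint: the conditional record probability is bounded below. *)
Lemma record_rate s h r M k (A : set Omega) : (0 < e)%N -> 1 <= h ->
  h * (e * r * M)%:R <= s -> measurable (A : set (history X `I_k)) ->
  Pr P (A `&` good s h r M k) * (M%:R ^+ e * (2^-1 ^+ e * expR (- s))) <=
  Pr P (A `&` [set w | is_record x w k]).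
Proof.
move=> e0 h1 hs hA.
have h0 : 0 <= h by lra.
pose B := A `&` good s h r M k.
have hB : measurable (B : set (history X `I_k)).
  by apply: measurableI => //; exact: history_good.
have mB := history_measurable hB.
pose I := index_enum ({ffun 'I_e -> 'I_M} * 'I_r)%type.
pose Bf (u : {ffun 'I_e -> 'I_M} * 'I_r) := B `&` free (cell s h (block u.1 u.2)) k.
have hBf u : measurable (Bf u : set (history X `I_k)).
  by apply: measurableI => //; exact: history_free.
pose Z u := Bf u `&` slab (X := X) s h (block u.1 u.2) k.
have mrec : measurable [set w | is_record x w k].
  apply: (@history_measurable _ _ _ _ _ _ setT).
  exact: history_record.
have mA := history_measurable hA.
apply: le_trans (@Pr_disjoint_sum _ _ _ P _ I Z _ _ _ _ _ _); last 5 first.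
- exact: index_enum_uniq.
- exact: measurableI.
- move=> u _; apply: measurableI; last exact: measurable_slab.
  exact: history_measurable (hBf u).
- move=> [g t] [g' t'] w [_ s1] [_ s2]; apply: block_inj => //.
  by apply: slab_inj s1 s2; lra.
- move=> u _ w [[[Aw _] fw] sw]; split=> // i ik hi; apply: (fw i ik) => j.
  by apply: le_lt_trans (hi j); exact: slab_dominates sw j.
set q := 2^-1 ^+ e * expR (- s).
have q0 : 0 <= q by rewrite mulr_ge0 ?expR_ge0 ?exprn_ge0.
apply: (@le_trans _ _ (\sum_(u <- I) (Pr P (Bf u) * q))).
  rewrite -mulr_suml [leLHS]mulrA ler_wpM2r//.
  rewrite -(pair_bigA _ (fun g t => Pr P (Bf (g, t)))) /=.
  apply: (@le_trans _ _ (\sum_(g : {ffun 'I_e -> 'I_M}) Pr P B)).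
    rewrite sumr_const card_ffun !card_ord -[X in _ <= X]mulr_natr natrX.
    by rewrite mulrC mulrC.
  (* On [B] each block has a free cell, so the events [Bf (g, t)] of one block cover [B]: every one
     of the M^e blocks contributes at least the probability of [B]. *)
  apply: ler_sum => g _.
  apply: (@Pr_union_bound _ _ _ P _ (index_enum 'I_r) (fun t => Bf (g, t)) _ mB).
    by move=> t _; exact: history_measurable (hBf _).
  move=> w Bw; have [_ /(_ g)[t ht]] := Bw.
  by exists t; [exact: mem_index_enum|split].
apply: ler_sum => u _; rewrite /Z.
rewrite (@history_independent _ _ _ _ _ X indep `I_k [set k])//.
- by rewrite ler_wpM2l ?Pr_ge0//; apply: Pr_slab => //; exact: sum_block_le.
- by apply/seteqP; split=> // i [/= + ik]; rewrite ik ltnn.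
- exact: history_slab.
Qed.

Section parameters.
Variable c : R.
Hypotheses (c0 : 0 < c) (e0 : (0 < e)%N).

(* With these choices a block misses with probability l^-(c r) + O(l^-H), which
   beats the number l^e of blocks, where l = ln n. *)
Definition gH : R := e%:R + 3.
Definition gr : nat := (Num.trunc ((e%:R + 3) / c)).+1.
Definition gh (l : R) : R := gH * ln l.
Definition gs (l : R) : R := l + c * ln l.
Definition gM (l : R) : nat := Num.trunc (l / ((e * gr)%:R * gh l)).

Definition good_at n := good (gs (ln n%:R)) (gh (ln n%:R)) gr (gM (ln n%:R)) n.

(** [gM] is the integer part of the largest value allowed by h e r M <= l. The factor ln l lost in
    each of the [e] directions is at most l^(c/e), hence l^c in total. *)
Lemma good_parameters : \forall l \near +oo,
  [/\ 1 <= l, 1 <= gh l, gh l * (e * gr * gM l)%:R <= gs l, (0 < gM l)%N &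
      l `^ (e%:R - c) <= (gM l)%:R ^+ e /\ (gM l)%:R ^+ e <= l `^ e%:R].
Proof.
have H3 : 3 <= gH by rewrite /gH lerDr.
have er : 1 <= (e * gr)%:R :> R by rewrite ler1n muln_gt0 e0.
have eR : 1 <= e%:R :> R by rewrite ler1n.
near=> l.
have l1 : 1 <= l by near: l; exact: near_pinfty_ge.
have ll1 : 1 <= ln l by near: l; exact: near_ln_ge.
have l0 : 0 < l by lra.
have gh1 : 1 <= gh l by rewrite /gh; nra.
pose D := (e * gr)%:R * gh l.
have D1 : 1 <= D by rewrite /D; nra.
have D0 : 0 < D by lra.
have Dl : 2 * D <= l `^ (c / e%:R).
  rewrite /D /gh !mulrA; near: l; apply: near_ln_le_powR.
  by rewrite divr_gt0//; lra.
have Dl' : 2 * D <= l.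
  rewrite -[leRHS]powRr1; last by lra.
  rewrite /D /gh !mulrA; near: l; exact: near_ln_le_powR.
have Ml : (gM l)%:R * D <= l.
  rewrite -ler_pdivlMr//.
  have /truncn_itv/andP[] // : 0 <= l / D by rewrite divr_ge0//; lra.
have Mg : l / (2 * D) <= (gM l)%:R.
  have : l / D < (gM l).+1%:R by exact: truncnS_gt.
  have : 2 <= l / D by rewrite ler_pdivlMr.
  rewrite -natr1 (_ : l / (2 * D) = 2^-1 * (l / D)); last by rewrite invfM mulrCA.
  by move: (l / D) => q; lra.
have M1 : (0 < gM l)%N.
  rewrite -(ltr0n R); apply: lt_le_trans Mg; rewrite divr_gt0//; lra.
split=> //.
- apply: (@le_trans _ _ l); last first.
    by rewrite /gs lerDl mulr_ge0 ?(ltW c0)// (le_trans ler01 ll1).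
  by apply: le_trans Ml; rewrite natrM /D; lra.
split.
  apply: (@le_trans _ _ ((l / (2 * D)) ^+ e)); last first.
    by rewrite lerXn2r ?nnegrE// divr_ge0//; lra.
  apply: (@le_trans _ _ ((l / l `^ (c / e%:R)) ^+ e)).
    rewrite -powRN -{2}(powRr1 (ltW l0)) -powRD; last first.
      by apply/implyP => _; rewrite gt_eqF.
    rewrite -powR_mulrn ?powR_ge0// -powRrM mulrDl mul1r mulNr divfK//.
    by rewrite gt_eqF//; lra.
  rewrite lerXn2r ?nnegrE ?divr_ge0 ?powR_ge0//; try lra.
  have D20 : 0 < 2 * D by rewrite pmulr_rgt0.
  by rewrite ler_wpM2l ?(ltW l0)// lef_pV2 ?posrE ?powR_gt0.
rewrite powR_mulrn; last by lra.
rewrite lerXn2r ?nnegrE ?(ltW l0)//.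
by apply: le_trans Ml; rewrite ler_peMr.
Unshelve. all: by end_near.
Qed.

Lemma Pr_not_good_at : exists n0, forall n, (n0 <= n)%N ->
  Pr P (~` good_at n) <= (1 + gr%:R ^+ 2) * ln n%:R `^ (- 3).
Proof.
have [n0 hn0] := near_lnn good_parameters.
exists n0.+1 => n nn0; have [l1 h1 hs M0 [_ Ml]] := hn0 n (ltnW nn0).
have n_gt0 : (0 < n)%N by exact: leq_trans nn0.
have l0 : 0 < ln n%:R :> R by exact: lt_le_trans l1.
apply: le_trans (Pr_not_good n e0 (le_trans ler01 h1) hs) _.
have E : n%:R * expR (- gs (ln n%:R)) = ln n%:R `^ (- c).
  exact: mul_expR_level.
have E2 : expR (- gh (ln n%:R)) = ln n%:R `^ (- gH).
  by rewrite /gh /powR gt_eqF// mulNr.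
have -> : n%:R * gr%:R ^+ 2 * expR (- (gs (ln n%:R) + gh (ln n%:R))) =
    gr%:R ^+ 2 * (ln n%:R `^ (- c) * ln n%:R `^ (- gH)).
  by rewrite opprD expRD E2 -E; ring.
rewrite E.
apply: (@le_trans _ _ (ln n%:R `^ e%:R *
   (ln n%:R `^ (- gH) + gr%:R ^+ 2 * ln n%:R `^ (- gH)))).
  apply: ler_pM => //.
    by rewrite addr_ge0 ?mulr_ge0 ?exprn_ge0 ?powR_ge0.
  apply: lerD.
    rewrite -powR_mulrn ?powR_ge0// -powRrM ler_powR// mulNr lerN2.
    have : (e%:R + 3) / c < gr%:R by exact: truncnS_gt.
    by rewrite ltr_pdivrMr// mulrC => /ltW.
  rewrite ler_wpM2l ?exprn_ge0// ler_piMl ?powR_ge0//.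
  by rewrite -[leRHS](powRr0 (ln n%:R)) ler_powR// oppr_le0 ltW.
rewrite -[X in _ * (X + _)]mul1r -mulrDl mulrCA ler_wpM2l ?addr_ge0 ?exprn_ge0//.
rewrite -powRD; last by apply/implyP => _; rewrite gt_eqF.
by rewrite ler_powR// /gH; lra.
Qed.

End parameters.

(** Any single block suffices, here block 0. Its free cell is taken at the right end of the dyadic
    block: what is free there is free at all earlier n. *)
Lemma ev_free (c : R) : 0 < c -> (0 < e)%N ->
  ev (fun n w => exists y, [/\ forall j, 0 <= y j,
        \sum_j y j <= level c n & free y n w]).
Proof.
move=> c0 e0; have c20 : 0 < c / 2 by rewrite divr_gt0.
have [n1 hn1] := Pr_not_good_at c20 e0.
have [n2 hn2] : exists n0, forall n : nat, (n0 <= n)%N ->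
    1 + `|c / 2| <= c / 2 * ln (ln n%:R).
  apply: (near_lnn (Q := fun l => 1 + `|c / 2| <= c / 2 * ln l)).
  by near=> l; rewrite -ler_pdivrMl//; near: l; exact: near_ln_ge.
have [n3 hn3] := near_lnn (good_parameters c20 e0).
apply: (@ev_dyadic _ _ _ _ (fun n => ~` good_at (c / 2) n)
  (1 + (gr (c / 2))%:R ^+ 2) 2 (maxn n1 (maxn n2 n3))) => //.
- by move=> n; apply: measurableC; exact: measurable_good.
- move=> n; rewrite geq_max => /andP[nn1 _].
  rewrite (_ : 1 + 2 = 3); last by lra.
  exact: hn1.
move=> w k n; rewrite !geq_max => /and3P[_ nn2 _] _ /and3P[_ _ kn3] k1 kn _ /contrapT gw.
have [l1' g1 gs' gM0 _] := hn3 _ kn3.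
have g0 := le_trans ler01 g1.
have [t ft] := gw [ffun=> Ordinal gM0].
exists (cell (gs (c / 2) (ln (2 ^ k.+1)%:R)) (gh (ln (2 ^ k.+1)%:R))
   (block [ffun=> Ordinal gM0] t)); split.
- by move=> j; apply: cell_ge0 => //; exact: sum_block_le gs'.
- rewrite sum_cell; apply: level_dyadic_up kn _ => //.
  by rewrite (_ : c - c / 2 = c / 2); [exact: hn2|field].
- by move=> i ni; apply: ft; apply: ltn_trans ni _; case/andP: kn.
Unshelve. all: by end_near.
Qed.

End free_cells.
Arguments gH {R} e.
Arguments gr {R} e c.
Arguments gh {R} e l.
Arguments gM {R} e c l.
Arguments good_at {R d0 Omega P e} X c n.

(** * The number of records *)

Lemma sum_harmonic_le {R : realType} (a b : nat) : (0 < a <= b)%N ->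
  \sum_(a <= i < b.+1) i%:R^-1 <= 1 + ln b%:R - ln a%:R :> R.
Proof.
move=> /andP[a0 /subnK <-]; elim: (b - a)%N => [|n IH].
  rewrite add0n big_nat1 addrK invf_le1 ?ler1n ?ltr0n//.
rewrite addSn big_nat_recr /=; last by rewrite ltnW// ltnS leq_addl.
have p : 0 < (n + a)%:R :> R by rewrite ltr0n addn_gt0 a0 orbT.
have p1 : 0 < (n + a).+1%:R :> R by rewrite ltr0n.
have : ln (1 + - (n + a).+1%:R^-1) <= - (n + a).+1%:R^-1 :> R.
  by apply: le_ln1Dx; rewrite ltrN2 invf_lt1// ltr1n ltnS addn_gt0 a0 orbT.
have -> : 1 + - (n + a).+1%:R^-1 = (n + a)%:R / (n + a).+1%:R :> R.
  rewrite -[X in X - _](divff (lt0r_neq0 p1)) -[X in _ / _ - X]mul1r.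
  by rewrite -mulrBl -natr1 addrK.
rewrite ln_div ?posrE//; move: IH.
move: (\sum_(a <= i < (n + a).+1) (i%:R^-1 : R)) ((n + a).+1%:R^-1 : R).
move: (ln (n + a).+1%:R : R) (ln (n + a)%:R : R) (ln a%:R : R) => u v z S t; lra.
Qed.

Section record_count_bounds.
Context {R : realType} {d0 : measure_display} {Omega : measurableType d0}.
Context {P : probability Omega R} {e : nat} {X : nat -> 'I_e.+1 -> {RV P >-> R}}.
Hypothesis expX : forall k j A, measurable A ->
  P (X k j @^-1` A) = exponential_prob 1 A.
Hypothesis indep :
  mutually_independent P (fun kj : nat * 'I_e.+1 => (X kj.1 kj.2 : Omega -> R)).
Local Notation ev := (almost_uniformly_eventually P).
Local Notation d := e.+1.
Local Notation x := (fun k j => X k j : Omega -> R).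

Definition grid_point (M : nat) (h : R) (a : {ffun 'I_e.+1 -> 'I_M}) (j : 'I_e.+1) : R :=
  h * (a j)%:R.

(* The first vector above a grid point is a record; if it stays in the cube of
   that grid point, different grid points yield different records. *)
Lemma nrecords_ge_grid (M n : nat) (h : R) (N : {ffun 'I_e.+1 -> 'I_M} -> nat) w :
  0 < h ->
  (forall a, (N a <= n)%N /\ exists2 i, (i < N a)%N & hits X (grid_point h a) i w) ->
  (forall a i, (i < N a)%N -> hits X (grid_point h a) i w ->
     forall j, X i j w < grid_point h a j + h) ->
  (M ^ d <= nrecords x w n)%N.
Proof.
move=> h0 hN hC.
have hex a : exists i, (i < N a)%N && asbool (hits X (grid_point h a) i w).
  by have [_ [i iN hi]] := hN a; exists i; rewrite iN asboolT.
have /choice[f hf] : forall a, exists i : 'I_n,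
    [/\ (i < N a)%N, hits X (grid_point h a) i w & is_record x w i].
  move=> a; case: (ex_minnP (hex a)) => i /andP[iN /asboolP hi] imin.
  have [Nn _] := hN a; exists (Ordinal (leq_trans iN Nn)); split=> //.
  move=> i' ii' /= hii'; have := imin i'; rewrite (ltn_trans ii' iN) /= asboolT.
    by move=> /(_ isT); rewrite leqNgt ii'.
  by move=> j; exact: lt_trans (hi j) (hii' j).
have finj : injective f.
  move=> a b fab; apply/ffunP => j; apply: val_inj => /=.
  have [aN ah _] := hf a; have [bN bh _] := hf b.
  have la : h * (a j)%:R < h * (b j).+1%:R.
    apply: lt_trans (ah j) _; rewrite fab -natr1 mulrDr mulr1.
    exact: hC bN bh j.
  have lb : h * (b j)%:R < h * (a j).+1%:R.
    apply: lt_trans (bh j) _; rewrite -fab -natr1 mulrDr mulr1.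
    exact: hC aN ah j.
  move: la lb; rewrite !ltr_pM2l// !ltr_nat; lia.
rewrite /nrecords -[in leqLHS](card_ord M) -[in leqLHS](card_ord d) -card_ffun.
rewrite -(card_imset _ finj) -sum1_card big_mkcond /=; apply: leq_sum => i _.
case: ifP => // /imsetP[a _ ->]; have [_ _ r] := hf a.
by rewrite asboolT.
Qed.

(** Every grid point has its own horizon [N a], adapted to its coordinate sum. With a common
    horizon, points near the origin would be exceeded by vectors outside their cubes. *)
Lemma nrecords_ge_whp (M n : nat) (h l : R) : 0 < h -> 1 <= l ->
  (forall a : {ffun 'I_e.+1 -> 'I_M},
     2 * l * expR (\sum_j grid_point h a j) <= n%:R) ->
  exists U, [/\ measurable U,
    Pr P U <= M%:R ^+ d * (expR (- l) + 2 * l * d%:R * expR (- h)) &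
    forall w, ~ U w -> (M ^ d <= nrecords x w n)%N].
Proof.
move=> h0 l1 hn.
pose y a := grid_point (M := M) h a.
have y0 a j : 0 <= y a j by rewrite /y /grid_point mulr_ge0// ltW.
pose S a := \sum_j y a j.
have S0 a : 0 <= S a by exact: sumr_ge0.
(* About l vectors above the grid point are expected by then: enough for one to occur except with
   probability e^-l, and few enough that leaving the cube, of relative probability at most d e^-h,
   stays unlikely. *)
pose N a := (Num.trunc (l * expR (S a))).+1.
have eS a : 1 <= expR (S a) by rewrite -expR0 ler_expR.
have lS a : 1 <= l * expR (S a).
  by rewrite -[leLHS]mulr1; apply: ler_pM.
have N1 a : l * expR (S a) <= (N a)%:R by exact/ltW/truncnS_gt.
have N2 a : (N a)%:R <= 2 * l * expR (S a).
  have /truncn_itv/andP[h1 _] : 0 <= l * expR (S a) by exact: le_trans (lS a).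
  rewrite -mulrA mulr_natl mulr2n /N -natr1; apply: lerD => //.
pose z a (k j : 'I_e.+1) := y a j + (if j == k then h else 0).
pose F a := [set w | forall i, (i < N a)%N -> ~ hits X (y a) i w] `|`
   \bigcup_(i in `I_(N a)) \bigcup_(k in [set: 'I_e.+1]) dominates X (z a k) i.
have mF a : measurable (F a).
  apply: measurableU; first exact: measurable_no_hit.
  apply: fin_bigcup_measurable => [|i _]; first exact: finite_II.
  apply: fin_bigcup_measurable => [|k _]; first exact: finite_finset.
  exact: measurable_dominates.
pose U := \bigcup_(a in [set: {ffun 'I_e.+1 -> 'I_M}]) F a.
have mU : measurable U.
  by apply: fin_bigcup_measurable => [|a _]; first exact: finite_finset.
exists U; split=> //.
- apply: le_trans (@Pr_union_bound _ _ _ P _ (index_enum {ffun 'I_e.+1 -> 'I_M}) F _ mU _ _) _ => //.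
    by move=> w [a _ h1]; exists a => //; exact: mem_index_enum.
  apply: (@le_trans _ _ (\sum_(a : {ffun 'I_e.+1 -> 'I_M})
      (expR (- l) + 2 * l * d%:R * expR (- h)))); last first.
    by rewrite sumr_const card_ffun !card_ord -[X in X <= _]mulr_natl natrX.
  apply: ler_sum => a _; apply: le_trans (Pr_setU_le _ _ _) _.
  + exact: measurable_no_hit.
  + apply: fin_bigcup_measurable => [|i _]; first exact: finite_II.
    apply: fin_bigcup_measurable => [|k _]; first exact: finite_finset.
    exact: measurable_dominates.
  apply: lerD.
    apply: le_trans (Pr_no_hit expX indep _ (y0 a)) _.
    rewrite ler_expR lerN2.
    by rewrite expRN ler_pdivlMr ?expR_gt0//; exact: N1.
  apply: le_trans (@Pr_union_bound _ _ _ P _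
     (index_enum ('I_(N a) * 'I_e.+1)%type) (fun u => dominates X (z a u.2) u.1) _ _ _ _) _.
  + apply: fin_bigcup_measurable => [|i _]; first exact: finite_II.
    apply: fin_bigcup_measurable => [|k _]; first exact: finite_finset.
    exact: measurable_dominates.
  + by move=> u _; exact: measurable_dominates.
  + move=> w [i iN [k _ hk]]; exists (Ordinal iN, k) => //; exact: mem_index_enum.
  apply: (@le_trans _ _ (\sum_(u : 'I_(N a) * 'I_e.+1) (expR (- S a) * expR (- h)))).
    apply: ler_sum => -[i k] _; rewrite (Pr_dominates expX indep)/=; last first.
      by move=> j; rewrite addr_ge0//; case: ifP => // _; exact: ltW.
    by rewrite big_split /= -big_mkcond big_pred1_eq opprD expRD.
  rewrite sumr_const card_prod !card_ord -[X in X <= _]mulr_natl natrM.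
  rewrite [leLHS](_ : _ = ((N a)%:R * expR (- S a)) * (d%:R * expR (- h))); last by ring.
  rewrite [leRHS](_ : _ = (2 * l) * (d%:R * expR (- h))); last by ring.
  rewrite ler_wpM2r ?mulr_ge0 ?expR_ge0//.
  by rewrite expRN ler_pdivrMr ?expR_gt0.
- move=> w nU; apply: (nrecords_ge_grid (h := h) (N := N)) => //.
  + move=> a; split.
      by rewrite -(ler_nat R); apply: le_trans (N2 a) _; exact: hn.
    apply: contrapT => nh; apply: nU; exists a => //; left=> i iN hi.
    by apply: nh; exists i.
  + move=> a i iN hi j; rewrite ltNge; apply/negP => hj.
    apply: nU; exists a => //; right; exists i => //; exists j => // k.
    by rewrite /z; case: eqP => [->//|_]; rewrite addr0 ltW//; exact: hi.
Qed.

(** The mesh (d + 3) ln l leaves l^(1 - o(1)) grid values per axis. Up to a constant the failure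
    probability is l^d (number of points) times l times l^-(d + 3), that is l^-2, summable along n =
    2^k. *)
Lemma ev_nrecords_ge (c : R) : 0 < c <= 1 ->
  ev (fun n w => (d%:R - c) * ln (ln n%:R) <= ln (nrecords x w n)%:R).
Proof.
move=> /andP[c0 c1]; have c20 : 0 < c / 2 by rewrite divr_gt0.
have dR : 1 <= d%:R :> R by rewrite ler1n.
have dR0 : 0 < d%:R :> R by rewrite ltr0n.
have dc0 : 0 <= d%:R - c / 2 by lra.
pose h (l : R) := (d%:R + 3) * ln l.
pose M (l : R) := Num.trunc (l / (2 * d%:R * h l)).
pose Q (l : R) := [/\ 1 <= l, 0 < h l,
   forall a : {ffun 'I_e.+1 -> 'I_(M l)},
     2 * l * expR (\sum_j grid_point (h l) a j) <= expR l,
   l `^ (d%:R - c / 2) <= (M l)%:R ^+ d /\ (M l)%:R ^+ d <= l `^ d%:R &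
   expR (- (1 * l `^ 1)) <= l `^ (- (d%:R + 2)) /\ d%:R <= c / 2 * ln l].
have [n0 hn0] : exists n0, forall n : nat, (n0 <= n)%N -> Q (ln n%:R).
  apply: near_lnn; near=> l.
  have l1 : 1 <= l by near: l; exact: near_pinfty_ge.
  have l0 : 0 < l by lra.
  have ll1 : 1 <= ln l by near: l; exact: near_ln_ge.
  have h1 : 1 <= h l by rewrite /h; nra.
  pose D := 2 * d%:R * h l.
  have D0 : 1 <= D by rewrite /D; nra.
  have D0' : 0 < D by lra.
  have Dl : 2 * D <= l `^ (c / 2 / d%:R).
    rewrite /D /h !mulrA; near: l; apply: near_ln_le_powR.
    by rewrite !divr_gt0.
  have Dl' : 2 * D <= l.
    rewrite -[leRHS]powRr1; last by lra.
    rewrite /D /h !mulrA; near: l; exact: near_ln_le_powR.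
  have Ml : (M l)%:R * D <= l.
    rewrite -ler_pdivlMr//.
    have /truncn_itv/andP[] // : 0 <= l / D by rewrite divr_ge0//; lra.
  have Mg : l / (2 * D) <= (M l)%:R.
    have : l / D < (M l).+1%:R by exact: truncnS_gt.
    have : 2 <= l / D by rewrite ler_pdivlMr.
    rewrite -[(M l).+1%:R]natr1 (_ : l / (2 * D) = 2^-1 * (l / D)); last first.
      by rewrite invfM mulrCA.
    by move: (l / D) => q; lra.
  have D20 : 0 < 2 * D by rewrite pmulr_rgt0.
  split=> //; first by lra.
  - move=> a.
    have lh : 2 * l <= expR (l / 2).
      have : 2 * ln l <= l / 2.
        have : 4 * ln l <= l `^ 1 by near: l; exact: near_ln_le_powR.
        by rewrite powRr1; lra.
      rewrite -ler_expR => /(le_trans _); apply.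
      rewrite (_ : 2 * ln l = ln l + ln l); last by ring.
      rewrite expRD lnK ?posrE//.
      have : 2 <= l by near: l; exact: near_pinfty_ge.
      by move=> l2; rewrite ler_wpM2r// ltW.
    rewrite [in leRHS](splitr l) expRD; apply: ler_pM; rewrite ?expR_ge0 ?mulr_ge0 ?(ltW l0)//.
    rewrite ler_expR /grid_point -mulr_sumr -natr_sum.
    have : (\sum_(i < d) a i <= d * M l)%N.
      rewrite -[in leqRHS](card_ord d) -sum_nat_const; apply: leq_sum => j _.
      exact: ltnW.
    rewrite -(ler_nat R) natrM => aM.
    have hl0 : 0 <= h l by lra.
    apply: le_trans (ler_wpM2l hl0 aM) _; move: Ml; rewrite /D; lra.
  - split.
      apply: (@le_trans _ _ ((l / (2 * D)) ^+ d)); last first.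
        by rewrite lerXn2r ?nnegrE// divr_ge0 ?(ltW l0)// ltW.
      apply: (@le_trans _ _ ((l / l `^ (c / 2 / d%:R)) ^+ d)).
        rewrite -powRN -{2}(powRr1 (ltW l0)) -powRD; last first.
          by apply/implyP => _; rewrite gt_eqF.
        by rewrite -powR_mulrn ?powR_ge0// -powRrM mulrDl mul1r mulNr divfK// gt_eqF.
      rewrite lerXn2r ?nnegrE ?divr_ge0 ?powR_ge0 ?(ltW l0) ?(ltW D20)//.
      by rewrite ler_wpM2l ?(ltW l0)// lef_pV2 ?posrE ?powR_gt0.
    rewrite powR_mulrn ?(ltW l0)// lerXn2r ?nnegrE ?(ltW l0)//.
    by apply: le_trans Ml; rewrite ler_peMr.
  - split; last by rewrite -ler_pdivrMl//; near: l; exact: near_ln_ge.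
    by near: l; apply: near_expR_powR.
have hU n : exists U, [/\ measurable U, (n0.+1 <= n)%N ->
    Pr P U <= (1 + 2 * d%:R) * ln n%:R `^ (- (1 + 1)) &
    (n0.+1 <= n)%N -> forall w, ~ U w -> (M (ln n%:R) ^ d <= nrecords x w n)%N].
  have [nn0|nn0] := leqP n0.+1 n; last by exists set0; split.
  have [l1 h0 hn [_ Ml] [hE _]] := hn0 n (ltnW nn0).
  have n_gt0 : (0 < n)%N by exact: leq_trans nn0.
  have l0 : 0 < ln n%:R :> R by exact: lt_le_trans l1.
  rewrite -natr_expR_ln// in hn.
  have [U [mU pU qU]] := nrecords_ge_whp h0 l1 hn.
  exists U; split=> // _; apply: le_trans pU _.
  have -> : expR (- h (ln n%:R)) = ln n%:R `^ (- (d%:R + 3)).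
    by rewrite /h /powR gt_eqF// mulNr.
  rewrite mul1r powRr1 ?(ltW l0)// in hE.
  have E1 : ln n%:R * ln n%:R `^ (- (d%:R + 3)) = ln n%:R `^ (- (d%:R + 2)) :> R.
    rewrite -[X in X * _](powRr1 (ltW l0)) -powRD; last by apply/implyP => _; rewrite gt_eqF.
    by congr (_ `^ _); ring.
  apply: (@le_trans _ _ (ln n%:R `^ d%:R *
     ((1 + 2 * d%:R) * ln n%:R `^ (- (d%:R + 2))))).
    apply: ler_pM => //.
      by rewrite addr_ge0 ?expR_ge0 ?mulr_ge0 ?powR_ge0// ltW.
    rewrite [leRHS]mulrDl mul1r; apply: lerD => //.
    by rewrite -E1 [leLHS](_ : _ = 2 * d%:R * (ln n%:R * ln n%:R `^ (- (d%:R + 3))))//; ring.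
  rewrite mulrCA -powRD; last by apply/implyP => _; rewrite gt_eqF.
  rewrite ler_wpM2l ?addr_ge0 ?mulr_ge0// ler_powR//; lra.
have /choice[U hU'] := hU.
apply: (@ev_dyadic _ _ _ _ U (1 + 2 * d%:R) 1 n0.+1) => //.
- by move=> n; case: (hU' n).
- by move=> n nn0; case: (hU' n) => _ /(_ nn0).
- move=> w k n n0n n0k _ k1 kn nU _.
  have [_ _ /(_ n0k w nU) hM] := hU' (2 ^ k)%N.
  have [l1 _ _ [Ml _] _] := hn0 _ (ltnW n0k).
  have [_ _ _ _ [_ hc]] := hn0 _ (ltnW n0n).
  have [_ a1 a2 _ _] := @ln_dyadic R _ _ k1 kn.
  have l0 : 0 < ln (2 ^ k)%:R :> R by exact: lt_le_trans l1.
  have b1 : ln (ln n%:R) <= ln (ln (2 ^ k)%:R) + 1 :> R.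
    by apply: lnD1 => //; exact: lt_le_trans a1.
  have Rk : ln (2 ^ k)%:R `^ (d%:R - c / 2) <= (nrecords x w n)%:R.
    apply: le_trans Ml _; rewrite -natrX ler_nat; apply: leq_trans hM _.
    by apply: nrecords_mono; case/andP: kn.
  have R0 : 0 < (nrecords x w n)%:R :> R by exact: lt_le_trans (powR_gt0 _ l0) Rk.
  have : (d%:R - c / 2) * ln (ln (2 ^ k)%:R) <= ln (nrecords x w n)%:R.
    by rewrite -ln_powR ler_ln ?posrE ?powR_gt0.
  have := ler_wpM2l dc0 b1; move: hc {hn0 hU hU' hM Ml Rk R0 b1 a1 a2 l1 l0}.
  move: (ln (ln n%:R)) (ln (ln (2 ^ k)%:R)) (ln (nrecords x w n)%:R) => u v z.
  lra.
Unshelve. all: by end_near.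
Qed.

(** Once the region below the level is covered, records are high ([record_high]). Unlike the record
    event, [high c i] is decided by vector i alone, so its probability is explicit and it is
    independent of the past. *)
Definition high (c : R) (i : nat) : set Omega := tot_ge X (level (- c) i) i.

Lemma measurable_high c i : measurable (high c i).
Proof. exact: measurable_tot_ge. Qed.

Lemma record_high w c i : covers X (level (- c) i) i w ->
  (forall j, 0 < X i j w) -> is_record x w i -> high c i w.
Proof.
move=> cov pos rec; rewrite /high /tot_ge /= leNgt; apply/negP => lt.
have [k ki hk] := cov (fun j => X i j w) (fun j => ltW (pos j)) lt.
exact: (rec k ki).
Qed.

Definition nhigh c a b w : nat := \sum_(a <= i < b) (asbool (high c i w) : nat).

Lemma nrecords_nhigh w c a b : (a <= b)%N ->
  (forall i, (a <= i < b)%N -> is_record x w i -> high c i w) ->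
  (nrecords x w b <= nrecords x w a + nhigh c a b w)%N.
Proof.
move=> ab H.
have -> : nrecords x w b = (nrecords x w a +
    \sum_(a <= i < b) (asbool (is_record x w i) : nat))%N.
  rewrite /nrecords -!(big_mkord predT (fun i => asbool (is_record x w i) : nat)).
  by rewrite -big_cat_nat.
rewrite leq_add2l /nhigh big_nat [leqRHS]big_nat; apply: leq_sum => i iab.
by case: asboolP => // r; rewrite asboolT//; exact: H.
Qed.

Lemma nhigh_mono c a a' b b' w : (a <= a')%N -> (b' <= b)%N ->
  (nhigh c a' b' w <= nhigh c a b w)%N.
Proof.
move=> aa bb; have [ab'|ba'] := leqP a' b'; last by rewrite /nhigh big_geq// ltnW.
rewrite /nhigh (big_cat_nat aa (leq_trans ab' bb)) /= (big_cat_nat ab' bb) /=.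
by rewrite addnCA leq_addr.
Qed.

Lemma Pr_tot_level (a : R) : exists (n0 : nat) (C : R), 0 <= C /\
  forall i, (n0 <= i)%N ->
    Pr P (tot_ge X (level a i) i) <= C * ln i%:R `^ (e%:R - a) / i%:R.
Proof.
pose Q (l : R) := [/\ 1 <= l, - l <= a * ln l & a * ln l <= l].
have [n0 hn0] : exists n0, forall n : nat, (n0 <= n)%N -> Q (ln n%:R).
  apply: near_lnn; near=> l.
  have l1 : 1 <= l by near: l; exact: near_pinfty_ge.
  have h : `|a| * ln l <= l `^ 1 by near: l; exact: near_ln_le_powR.
  rewrite powRr1 in h; last by lra.
  have : `|a * ln l| <= l by rewrite normrM (ger0_norm (ln_ge0 l1)).
  by rewrite ler_norml => /andP[].
exists n0.+1, (3 ^+ e * expR e%:R); split; first by rewrite mulr_ge0 ?expR_ge0// exprn_ge0.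
move=> i ni; have [l1 l2 l3] := hn0 i (ltnW ni).
have i0 : (0 < i)%N by exact: leq_trans ni.
have l0 : 0 < ln i%:R :> R by exact: lt_le_trans l1.
pose s : R := level a i.
have [s0 s1] : 0 <= s /\ s + 1 <= 3 * ln i%:R.
  by rewrite /s /level; split; lra.
apply: le_trans (Pr_tot_ge_le expX indep i s0) _.
have E : expR (e%:R - s) * i%:R = expR e%:R * ln i%:R `^ (- a).
  by rewrite expRD -mulrA [X in _ * X]mulrC mul_expR_level.
rewrite ler_pdivlMr ?ltr0n// -[leLHS]mulrA E.
apply: (@le_trans _ _ ((3 * ln i%:R) ^+ e * (expR e%:R * ln i%:R `^ (- a)))).
  rewrite ler_wpM2r ?mulr_ge0 ?expR_ge0 ?powR_ge0//.
  by rewrite lerXn2r ?nnegrE ?mulr_ge0 ?(ltW l0)// addr_ge0.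
rewrite exprMn powRD; last by apply/implyP => _; rewrite gt_eqF.
rewrite powR_mulrn ?(ltW l0)// [leRHS](_ : _ = 3 ^+ e * ln i%:R ^+ e * (expR e%:R * ln i%:R `^ (- a)))//.
ring.
Unshelve. all: by end_near.
Qed.

Lemma sum_high c : 0 < c -> exists (n0 : nat) (C : R), [/\ (2 < n0)%N, 0 <= C &
  forall a b, (n0 <= a <= b)%N -> \sum_(a <= i < b.+1) Pr P (high c i) <=
    C * ln b%:R `^ (e%:R + c) * (1 + ln b%:R - ln a%:R)].
Proof.
move=> c0; have [n0 [C [C0 hC']]] := Pr_tot_level (- c).
have hC i : (n0 <= i)%N -> Pr P (high c i) <= C * ln i%:R `^ (e%:R + c) / i%:R.
  by move=> /hC'; rewrite opprK.
exists (maxn n0 3), C; split=> //; first by rewrite leq_max orbT.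
move=> a b /andP[]; rewrite geq_max => /andP[n0a a3] ab.
have a0 : (0 < a)%N by exact: leq_trans a3.
apply: (@le_trans _ _ (\sum_(a <= i < b.+1) C * ln b%:R `^ (e%:R + c) * i%:R^-1)); last first.
  rewrite -mulr_sumr ler_wpM2l ?mulr_ge0 ?powR_ge0//.
  by apply: sum_harmonic_le; rewrite a0.
rewrite big_nat [leRHS]big_nat; apply: ler_sum => i /andP[ai ib].
apply: le_trans (hC i (leq_trans n0a ai)) _.
have i0 : (0 < i)%N by exact: leq_trans ai.
rewrite ler_wpM2r ?invr_ge0// ler_wpM2l//.
have b0 : (0 < b)%N by exact: leq_trans i0 ib.
apply: ge0_ler_powR.
- by rewrite addr_ge0// ltW.
- by rewrite nnegrE ln_ge0// ler1n.
- by rewrite nnegrE ln_ge0// ler1n.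
- by rewrite ler_ln ?posrE ?ltr0n// ler_nat.
Qed.

Lemma measurable_nhigh c a b t : measurable [set w | (t <= nhigh c a b w)%N].
Proof.
by apply: (@measurable_count _ Omega (high c)) => i _; exact: measurable_high.
Qed.

(** The mean is of order l^(d + c), and Markov's inequality leaves a failure probability of order
    l^-c only, which need not be summable along powers of 2. Along 2^(k^q), where l is proportional
    to k^q, it becomes k^-(q c), and ln g(k + 1) <= 2^q ln g(k) still controls the gaps. *)
Lemma ev_nhigh c : 0 < c -> exists (n0 : nat) (K : R), 0 < K /\
  ev (fun n w => (nhigh c n0 n w)%:R <= (K * ln n%:R) `^ (d%:R + 2 * c)).
Proof.
move=> c0; have [n0 [C [n03 C0 hC]]] := sum_high c0.
(* Chosen so that q c >= 2. *)
pose q := (Num.trunc (2 / c)).+1.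
have qc : 2 <= q%:R * c.
  by rewrite -ler_pdivrMr//; exact/ltW/truncnS_gt.
pose g k := (2 ^ (k ^ q))%N.
have dc0 : 0 <= d%:R + 2 * c by rewrite addr_ge0// mulr_ge0// ltW.
have kg k : (k <= g k)%N.
  apply: leq_trans (_ : k <= k ^ q)%N _; last by rewrite ltnW// ltn_expl.
  by case: k => // k; rewrite /q expnS leq_pmulr// expn_gt0.
have lg k : ln (g k)%:R = k%:R ^+ q * ln 2 :> R by rewrite /g ln_2X natrX.
have l2h := @ln2_ge_half R.
have l20 : 0 < ln 2 :> R by apply: lt_le_trans l2h.
pose t k := (Num.trunc (ln (g k)%:R `^ (d%:R + 2 * c) : R)).+1.
pose U k := [set w | (t k <= nhigh c n0 (g k).+1 w)%N].
exists n0, (2 ^+ q); split; first by rewrite exprn_gt0.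
apply: (@ev_interpolate _ _ _ _ g U (2 * C * 2 `^ c) 1 (maxn n0 2)) => //.
- by move=> k; exact: measurable_nhigh.
- move=> k; rewrite geq_max => /andP[n0k k2].
  have kR : 0 < k%:R :> R by rewrite ltr0n; exact: leq_trans k2.
  have k1R : 1 <= k%:R :> R by rewrite ler1n; exact: leq_trans k2.
  set l : R := ln (g k)%:R.
  have lk : k%:R ^+ q / 2 <= l by rewrite /l lg ler_wpM2l ?exprn_ge0.
  have l1 : 1 <= l.
    apply: le_trans lk; rewrite ler_pdivlMr// mul1r.
    apply: (@le_trans _ _ k%:R); first by rewrite ler_nat.
    by rewrite -[leLHS]expr1 ler_weXn2l.
  have l0 : 0 < l by exact: lt_le_trans l1.
  have tR : l `^ (d%:R + 2 * c) <= (t k)%:R by exact/ltW/truncnS_gt.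
  have tR0 : 0 < (t k)%:R :> R by exact: lt_le_trans (powR_gt0 _ l0) tR.
  have := @markov_count _ _ _ P _ (index_iota n0 (g k).+1) (high c) (t k) (U k)
    (measurable_nhigh _ _ _ _) (measurable_high c) (fun w h => h).
  move=> /le_trans -/(_ _ (hC n0 (g k) _)).
  rewrite leqnn (leq_trans n0k (kg k)) => /(_ isT).
  rewrite -ler_pdivlMl// => /le_trans; apply.
  have ln0 : 0 <= ln n0%:R :> R by rewrite ln_ge0// ler1n; exact: leq_trans n03.
  apply: (@le_trans _ _ ((l `^ (d%:R + 2 * c))^-1 * (C * l `^ (e%:R + c) * (2 * l)))).
    apply: ler_pM.
    + by rewrite invr_ge0 ltW.
    + rewrite !mulr_ge0 ?powR_ge0// subr_ge0.
      apply: (@le_trans _ _ l); last by rewrite lerDr.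
      by rewrite ler_ln ?posrE ?ltr0n ?(leq_trans _ n03) ?expn_gt0// ler_nat (leq_trans n0k).
    + by rewrite lef_pV2 ?posrE ?powR_gt0.
    + by rewrite ler_wpM2l ?mulr_ge0 ?powR_ge0// -/l; lra.
  have -> : (l `^ (d%:R + 2 * c))^-1 * (C * l `^ (e%:R + c) * (2 * l)) =
      2 * C * l `^ (- c).
    rewrite [LHS](_ : _ = 2 * C * (l `^ (- (d%:R + 2 * c)) * l `^ (e%:R + c) * l `^ 1)).
      rewrite -!powRD; try by apply/implyP => _; rewrite gt_eqF.
      by congr (_ * _ `^ _); rewrite -[d%:R]natr1; ring.
    by rewrite powRN powRr1 ?(ltW l0)//; ring.
  rewrite -[leRHS]mulrA ler_wpM2l ?mulr_ge0//.
  have k20 : 0 < k%:R ^+ q / 2 :> R by rewrite divr_gt0// exprn_gt0.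
  apply: (@le_trans _ _ ((k%:R ^+ q / 2) `^ (- c))).
    rewrite !powRN lef_pV2 ?posrE ?powR_gt0//.
    by apply: ge0_ler_powR => //; rewrite ?nnegrE ltW.
  rewrite powRM ?exprn_ge0 ?invr_ge0// -powR_mulrn ?ler0n// -powRrM mulrC.
  rewrite -powR_inv1// -powRrM mulrNN mul1r ler_wpM2l ?powR_ge0//.
  rewrite ler_powR// mulrN lerN2; lra.
- move=> w k n; rewrite geq_max => /andP[n0k k2] /andP[gn ng] _ nU.
  have l0 : 0 < ln (g k.+1)%:R :> R by rewrite lg mulr_gt0 ?exprn_gt0 ?ltr0n.
  have cn : (nhigh c n0 n w <= Num.trunc (ln (g k.+1)%:R `^ (d%:R + 2 * c) : R))%N.
    rewrite leqNgt; apply/negP => h; apply: nU.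
    by apply: leq_trans h _; apply: nhigh_mono => //; rewrite ltnW// ltnW.
  rewrite -(ler_nat R) in cn; apply: le_trans cn _.
  have /truncn_itv/andP[h _] : 0 <= ln (g k.+1)%:R `^ (d%:R + 2 * c) by exact: powR_ge0.
  apply: le_trans h _; apply: ge0_ler_powR => //.
  + by rewrite nnegrE ltW.
  + by rewrite nnegrE mulr_ge0 ?exprn_ge0// ln_ge0// ler1n (leq_trans _ gn)// expn_gt0.
  apply: (@le_trans _ _ (2 ^+ q * ln (g k)%:R)); last first.
    rewrite ler_wpM2l ?exprn_ge0// ler_ln ?posrE ?ltr0n ?expn_gt0//.
      by rewrite ler_nat.
    by rewrite (leq_trans _ gn)// expn_gt0.
  rewrite !lg mulrA -exprMn ler_wpM2r ?(ltW l20)// lerXn2r ?nnegrE ?mulr_ge0//.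
  by rewrite -natrM ler_nat; lia.
Qed.

(** From a path-independent index [N1] on, records are high; the earlier ones number at most [N1],
    absorbed by a small power of l. *)
Lemma ev_nrecords_le (c : R) : 0 < c ->
  ev (fun n w => ln (nrecords x w n)%:R <= (d%:R + c) * ln (ln n%:R)).
Proof.
move=> c0; have c30 : 0 < c / 3 by rewrite divr_gt0.
have [n0 [K [K0 evK]]] := ev_nhigh c30.
have evC := ev_covers expX indep c30.
have evP := ev_ae_cst (ae_pos expX).
apply: ev_shift (ev_and evK (ev_and evC evP)) => N.
pose N1 := maxn N n0.
pose KK := K `^ (d%:R + 2 * (c / 3)) + N1%:R.
pose Q (l : R) := [/\ 1 <= l, 0 <= ln l & KK <= l `^ (c / 3)].
have [n1 hn1] : exists n1, forall n : nat, (n1 <= n)%N -> Q (ln n%:R).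
  apply: near_lnn; near=> l; split.
  - by near: l; exact: near_pinfty_ge.
  - by near: l; exact: near_ln_ge.
  - by near: l; exact: near_powR_ge.
exists (maxn N1 n1) => w hw n; rewrite geq_max => /andP[N1n n1n].
have [l1 ll0 hK] := hn1 n n1n.
have l0 : 0 < ln n%:R :> R by exact: lt_le_trans l1.
have NN1 : (N <= N1)%N by exact: leq_maxl.
have [hn _] := hw n (leq_trans NN1 N1n).
have h1 : (nrecords x w n <= N1 + nhigh (c / 3) n0 n w)%N.
  apply: leq_trans (@nrecords_nhigh w (c / 3) N1 n N1n _) _.
    move=> i /andP[N1i _]; have [_ [cov pos]] := hw i (leq_trans NN1 N1i).
    by apply: record_high cov _ => j; exact: pos.
  apply: leq_add; first exact: nrecords_le.
  by apply: nhigh_mono => //; exact: leq_maxr.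
have lp : 1 <= ln n%:R `^ (d%:R + 2 * (c / 3)) :> R.
  rewrite -[leLHS](powRr0 (ln n%:R)) ler_powR// addr_ge0// mulr_ge0// ltW//.
have h2 : (nrecords x w n)%:R <= ln n%:R `^ (d%:R + c) :> R.
  apply: (@le_trans _ _ (N1%:R + (nhigh (c / 3) n0 n w)%:R)).
    by rewrite -natrD ler_nat.
  apply: (@le_trans _ _ (KK * ln n%:R `^ (d%:R + 2 * (c / 3)))).
    rewrite /KK mulrDl addrC; apply: lerD.
      by apply: le_trans hn _; rewrite powRM ?(ltW K0) ?(ltW l0).
    by rewrite ler_peMr.
  apply: le_trans (ler_wpM2r (powR_ge0 _ _) hK) _.
  rewrite -powRD; last by apply/implyP => _; rewrite gt_eqF.
  by rewrite ler_powR//; lra.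
have [->|r0] := eqVneq (nrecords x w n) 0%N.
  by rewrite ln0// mulr_ge0// addr_ge0// ltW.
by rewrite -ln_powR ler_ln ?posrE ?powR_gt0// ltr0n lt0n.
Unshelve. all: by end_near.
Qed.

End record_count_bounds.
Arguments high {R d0 Omega P e} X c i.
Arguments nhigh {R d0 Omega P e} X c a b w.

(** * Large vectors just before the m-th record *)

Section bad_indices.
Context {R : realType} {d0 : measure_display} {Omega : measurableType d0}.
Context {P : probability Omega R} {e : nat} {X : nat -> 'I_e.+1 -> {RV P >-> R}}.
Hypothesis expX : forall k j A, measurable A ->
  P (X k j @^-1` A) = exponential_prob 1 A.
Hypothesis indep :
  mutually_independent P (fun kj : nat * 'I_e.+1 => (X kj.1 kj.2 : Omega -> R)).
Local Notation ev := (almost_uniformly_eventually P).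
Local Notation d := e.+1.
Local Notation x := (fun k j => X k j : Omega -> R).

(** The random time does not occur: each condition compares [m] with quantities decided by the past,
    the vector or the future of a deterministic k. The final 1 allows for vector k being a record
    itself. *)
Definition bad_indices (m : nat) (ks : seq nat) (s : nat -> R) (b : nat -> nat)
    (eta : R) : set Omega :=
  [set w | exists2 k, k \in ks & [/\ tot_ge X (s k) k w, (nrecords x w k <= m)%N &
     (m <= nrecords x w k + nhigh X eta k.+1 (b k) w + 1)%N]].

Section core.
Variables (m : nat) (ks : seq nat) (s : nat -> R) (b : nat -> nat) (eta : R).
(** With r = m - R_k fixed, the event factors over the past ([N]), the vector k and its future
    ([D]). The predecessor in [D] discounts a possible record at k. *)
Let N (k r : nat) : set Omega := [set w | nrecords x w k = (m - r)%N].
Let D (k r : nat) : set Omega := [set w | (r.-1 <= nhigh X eta k.+1 (b k) w)%N].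
Let F (kr : nat * nat) : set Omega :=
  N kr.1 kr.2 `&` (tot_ge X (s kr.1) kr.1 `&` D kr.1 kr.2).

Let hN k r : measurable (N k r : set (history X `I_k)).
Proof. exact: history_nrecords_eq. Qed.

Let hD k r : measurable (D k r : set (history X [set i | (k < i)%N])).
Proof.
rewrite /D /nhigh.
apply: (@measurable_count _ (history X [set i | (k < i)%N]) (high X eta)) => i.
by rewrite mem_index_iota => /andP[ki _]; exact: history_tot_ge.
Qed.

Let mN k r : measurable (N k r).
Proof. by apply: (@history_measurable _ _ _ _ _ X `I_k); exact: hN. Qed.

Let mD k r : measurable (D k r).
Proof.
by apply: (@history_measurable _ _ _ _ _ X [set i | (k < i)%N]); exact: hD.
Qed.

Let mF kr : measurable (F kr).
Proof.
apply: measurableI; first exact: mN.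
by apply: measurableI; [exact: measurable_tot_ge|exact: mD].
Qed.

Lemma measurable_bad_indices : measurable (bad_indices m ks s b eta).
Proof.
rewrite (_ : bad_indices m ks s b eta =
  \bigcup_(k in [set` ks]) \bigcup_(r in `I_m.+1) F (k, r)).
  apply: fin_bigcup_measurable => [|k _]; first exact: finite_seq.
  by apply: fin_bigcup_measurable => [|r _]; [exact: finite_II|exact: mF].
apply/seteqP; split=> w.
  move=> [k kks [tk km mk]]; exists k => //; exists (m - nrecords x w k)%N => /=.
    by rewrite ltnS leq_subr.
  by split; [rewrite /N /= subKn|split => //; rewrite /D /=; lia].
move=> [k kks [r /= rm [Nk [tk Dk]]]]; exists k => //; split=> //.
  by move: Nk; rewrite /N /= => ->; exact: leq_subr.
by move: Nk Dk; rewrite /N /D /= => ->; lia.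
Qed.

Variables (pA S q G H : R).
Hypotheses (e0 : (0 < e)%N) (uks : uniq ks).
Hypotheses (pA0 : 0 <= pA) (S0 : 0 <= S) (q0 : 0 < q) (G0 : 0 <= G).
Hypothesis hA : forall k, k \in ks -> Pr P (tot_ge X (s k) k) <= pA / k%:R.
Hypothesis hS : forall k, k \in ks ->
  \sum_(k.+1 <= i < b k) Pr P (high X eta i) <= S.
Hypothesis hpar : forall k, k \in ks -> 1 <= gh e (ln k%:R : R) /\
  gh e (ln k%:R) * (e * gr e eta * gM e eta (ln k%:R))%:R <= gs eta (ln k%:R).
Hypothesis hq : forall k, k \in ks -> q / k%:R <=
  (gM e eta (ln k%:R))%:R ^+ e * (2^-1 ^+ e * expR (- gs eta (ln k%:R))).
Hypothesis hG : forall k, k \in ks -> Pr P (~` good_at X eta k) <= G.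
Hypothesis hH : \sum_(k <- ks) k%:R^-1 <= H.

Let PrF k r : Pr P (F (k, r)) = Pr P (N k r) * (Pr P (tot_ge X (s k) k) * Pr P (D k r)).
Proof.
have d1 : `I_k `&` [set i | (k <= i)%N] = set0.
  by apply/seteqP; split=> // i [/= ik]; rewrite leqNgt ik.
have d2 : [set k] `&` [set i | (k < i)%N] = set0.
  by apply/seteqP; split=> // i [/= ->]; rewrite ltnn.
have hT S' : S' k -> measurable (tot_ge X (s k) k : set (history X S')).
  exact: history_tot_ge.
have hTD : measurable (tot_ge X (s k) k `&` D k r : set (history X [set i | (k <= i)%N])).
  apply: measurableI; first by apply: hT => /=.
  by apply: history_sub (@hD k r) => i /= /ltnW.
rewrite /F /= (history_independent indep d1 (@hN k r) hTD).
by rewrite (history_independent indep d2 (hT [set k] erefl) (@hD k r)).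
Qed.

(** Markov's inequality gives (r - 1) P(D) <= S; adding 2 P(D) <= 2 turns the factor into r + 1,
    which also covers r = 0 and r = 1 and makes the sum over r logarithmic. *)
Let PrD k r : k \in ks -> Pr P (D k r) <= (S + 2) / r.+1%:R.
Proof.
move=> kks; rewrite ler_pdivlMr ?ltr0n//.
have D1 := Pr_le1 P (mD k r); have D0 := Pr_ge0 P (D k r).
have h : r.-1%:R * Pr P (D k r) <= S.
  apply: le_trans (hS kks).
  apply: (@markov_count _ _ _ P _ (index_iota k.+1 (b k)) (high X eta)) => //.
  by move=> i; exact: measurable_high.
have r2 : r.+1%:R <= r.-1%:R + 2 :> R by rewrite -natrD ler_nat addn2; case: (r).
apply: le_trans (ler_wpM2l D0 r2) _.
by rewrite mulrDr mulrC; apply: lerD => //; rewrite ler_piMl.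
Qed.

(** Exchanges the weight 1 / k for the record probability at time k, at the price 1 / q; this makes
    the sum over k bounded by [sum_rec]. *)
Let rate k r : k \in ks -> k%:R^-1 * Pr P (N k r `&` good_at X eta k) <=
  q^-1 * Pr P (N k r `&` [set w | is_record x w k]).
Proof.
move=> kks; have [h1 h2] := hpar kks.
have := record_rate expX indep e0 h1 h2 (@hN k r).
rewrite ler_pdivlMl//; apply: le_trans.
by rewrite [leLHS]mulrA [leLHS]mulrC ler_wpM2l ?Pr_ge0//; exact: hq.
Qed.

Let sum_rec r : \sum_(k <- ks) Pr P (N k r `&` [set w | is_record x w k]) <= 1.
Proof.
apply: le_trans (Pr_le1 P measurableT); apply: Pr_disjoint_sum => //.
- move=> k _; apply: measurableI; first exact: mN.
  by apply: (@history_measurable _ _ _ _ _ _ setT); exact: history_record.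
have wl k k' w : (k < k')%N -> N k r w -> is_record x w k -> N k' r w -> False.
  move=> kk' Nk rk Nk'; have := nrecords_mono x w kk'.
  by rewrite nrecordsS asboolT// Nk Nk'; lia.
move=> k k' w [Nk rk] [Nk' rk']; case: (ltngtP k k') => // kk'.
  by case: (wl k k' w kk' Nk rk Nk').
by case: (wl k' k w kk' Nk' rk' Nk).
Qed.

(** The first term comes from the good part of the past, through [rate] and the harmonic sum over r.
    The second comes from the rest, where the crude sum of 1 / k is affordable because [G] is
    small. *)
Lemma Pr_bad_indices : Pr P (bad_indices m ks s b eta) <=
  pA * (S + 2) * q^-1 * (1 + ln m.+1%:R) + pA * G * H.
Proof.
pose r1 := iota 0 m.+1.
apply: le_trans (@Pr_union_bound _ _ _ P _ [seq (k, r) | k <- ks, r <- r1] F _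
   measurable_bad_indices _ _) _; first by move=> kr _; exact: mF.
  move=> w [k kks [tk km mk]]; exists (k, m - nrecords x w k)%N.
    by apply/allpairsP; exists (k, m - nrecords x w k)%N; split=> //=; rewrite mem_iota; lia.
  by split; [rewrite /N /= subKn|split => //; rewrite /D /=; lia].
rewrite big_allpairs.
apply: (@le_trans _ _ (\sum_(k <- ks) \sum_(r <- r1)
   (pA * (S + 2) * (r.+1%:R^-1 * (k%:R^-1 * Pr P (N k r `&` good_at X eta k))) +
    pA * (k%:R^-1 * Pr P (N k r `&` ~` good_at X eta k))))).
  rewrite big_seq [leRHS]big_seq; apply: ler_sum => k kks.
  apply: ler_sum => r _; rewrite PrF.

  have mg : measurable (good_at X eta k) by exact: measurable_good.

  have k0 : 0 <= k%:R^-1 :> R by rewrite invr_ge0.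
  have split_N : Pr P (N k r) <= Pr P (N k r `&` good_at X eta k) +
      Pr P (N k r `&` ~` good_at X eta k).
    apply: le_trans (Pr_setU_le _ _ _); rewrite -?setIUr ?setUv ?setIT//.
      by apply: measurableI => //; exact: mN.
    by apply: measurableI; [exact: mN|exact: measurableC].
  apply: le_trans (ler_wpM2r _ split_N) _; first by rewrite mulr_ge0 ?Pr_ge0.
  rewrite mulrDl; apply: lerD.
    rewrite [leRHS](_ : _ = Pr P (N k r `&` good_at X eta k) *
       ((pA / k%:R) * ((S + 2) / r.+1%:R))); last by ring.
    rewrite ler_wpM2l ?Pr_ge0//; apply: ler_pM; rewrite ?Pr_ge0//; [exact: hA|exact: PrD].
  rewrite [leRHS](_ : _ = Pr P (N k r `&` ~` good_at X eta k) * ((pA / k%:R) * 1)); last by ring.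
  rewrite ler_wpM2l ?Pr_ge0//; apply: ler_pM; rewrite ?Pr_ge0//; [exact: hA|apply: Pr_le1; exact: mD].
under eq_bigr do rewrite big_split /=.
rewrite big_split /=; apply: lerD.
  rewrite exchange_big /=.
  apply: (@le_trans _ _ (\sum_(r <- r1) (pA * (S + 2) * q^-1 * r.+1%:R^-1))).
    apply: ler_sum => r _; rewrite -!mulr_sumr -!mulrA ler_wpM2l// ler_wpM2l ?addr_ge0//.
    rewrite mulrC ler_wpM2r ?invr_ge0//.
    apply: (@le_trans _ _ (\sum_(k <- ks) (q^-1 * Pr P (N k r `&` [set w | is_record x w k])))).
      by rewrite big_seq [leRHS]big_seq; apply: ler_sum => k; exact: rate.
    by rewrite -mulr_sumr ler_piMr// invr_ge0 ltW.
  rewrite -mulr_sumr ler_wpM2l ?mulr_ge0 ?addr_ge0 ?invr_ge0 ?(ltW q0)//.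
  have := @sum_harmonic_le R 1 m.+1 isT; rewrite ln1 subr0; apply: le_trans.
  by rewrite big_add1 /= /r1 /index_iota subn0.
apply: (@le_trans _ _ (\sum_(k <- ks) (pA * (k%:R^-1 * G)))).
  rewrite big_seq [leRHS]big_seq; apply: ler_sum => k kks.
  rewrite -!mulr_sumr ler_wpM2l// ler_wpM2l ?invr_ge0//.
  have mg : measurable (~` good_at X eta k).
    by apply: measurableC; exact: measurable_good.
  apply: le_trans (hG kks).
  (* For fixed k the values of R_k are exclusive, so summing over r does not multiply the
     probability of the exceptional event. *)
  apply: (@le_trans _ _ (\sum_(i <- iota 0 m.+1) Pr P ([set w | nrecords x w k = i] `&` ~` good_at X eta k))).
    rewrite le_eqVlt; apply/orP; left; apply/eqP.
    rewrite /r1 -[iota 0 m.+1]/(index_iota 0 m.+1) [RHS]big_nat_rev /= add0n.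
    by apply: eq_big_nat => r /andP[_ rm]; rewrite /N subSS.
  apply: Pr_disjoint_sum => //.
  - exact: iota_uniq.
  - move=> i _; apply: measurableI => //.
    by apply: (@history_measurable _ _ _ _ _ X `I_k); exact: history_nrecords_eq.
  - by move=> i i' w [/= <- _] [/= <- _].
rewrite -mulr_sumr -mulr_suml -mulrA ler_wpM2l// mulrC ler_wpM2l//.
Qed.

End core.
End bad_indices.

Lemma near_natr {R : realType} (Q : R -> Prop) : (\forall x \near +oo, Q x) ->
  exists n0, forall n : nat, (n0 <= n)%N -> Q n%:R.
Proof.
move=> [M [Mr hM]]; exists (Num.trunc M).+1 => n hn; apply: hM.
by apply: lt_le_trans (truncnS_gt _) _; rewrite ler_nat.
Qed.

(** * Totals observed up to the m-th record *)

Section record_times.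
Context {R : realType} {d0 : measure_display} {Omega : measurableType d0}.
Context {P : probability Omega R} {e : nat} {X : nat -> 'I_e.+1 -> {RV P >-> R}}.
Hypothesis expX : forall k j A, measurable A ->
  P (X k j @^-1` A) = exponential_prob 1 A.
Hypothesis indep :
  mutually_independent P (fun kj : nat * 'I_e.+1 => (X kj.1 kj.2 : Omega -> R)).
Local Notation ev := (almost_uniformly_eventually P).
Local Notation d := e.+1.
Local Notation x := (fun k j => X k j : Omega -> R).
Hypothesis e0 : (0 < e)%N.

(** For the totals the crude exponent d + 1 is enough; it exceeds e by 2, which is the 2 in
    [index_gap] and the square in [time_bound]. *)
Definition typical (eta : R) (n : nat) (w : Omega) : Prop :=
  [/\ covers X (level (- eta) n) n w,
      forall i, (i < n)%N -> tot X i w <= level (d%:R + 1) n,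
      (d%:R - eta) * ln (ln n%:R) <= ln (nrecords x w n)%:R,
      ln (nrecords x w n)%:R <= (d%:R + eta) * ln (ln n%:R) &
      forall i j, 0 < X i j w].

Lemma ev_typical eta : 0 < eta <= 1 -> ev (typical eta).
Proof.
move=> /[dup] eta01 /andP[eta0 eta1].
have h1 := ev_covers expX indep eta0.
have h2 := ev_tot_le expX indep (ltr01 : 0 < 1 :> R).
have h3 := ev_nrecords_ge expX indep eta01.
have h4 := ev_nrecords_le expX indep eta0.
have h5 := ev_ae_cst (ae_pos expX).
apply: (ev_imp (n0 := 0)) (ev_and h1 (ev_and h2 (ev_and h3 (ev_and h4 h5)))).
by move=> w n _ [? [? [? [? ?]]]].
Qed.

Definition index_bound (l2 : R) : nat := Num.trunc (expR l2).
(** The deterministic candidates for the maximizing index: [l1] and [l2] will bracket ln T_m, and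
    that index k satisfies ln k >= ln T_m / 4. *)
Definition index_range (l1 l2 : R) : seq nat :=
  [seq k <- iota 1 (index_bound l2) | l1 / 4 <= ln k%:R].
(** An upper bound for T_m given the maximizing index k, since T_m <= (k + 1) (ln T_m)^2 and ln T_m
    <= l2. The outer successor matches the summation range of [sum_high]. *)
Definition time_bound (l2 : R) (k : nat) : nat := (k.+1 * (Num.trunc (l2 ^+ 2)).+1).+1.

(** The lower bound on the record count makes it diverge, so the m-th record exists; and T_m >= m
    places T_m beyond the threshold [N]. *)
Lemma Trec_typical (eta : R) (N m : nat) w : 0 < eta <= 1 -> (N <= m)%N ->
  (forall n, (N <= n)%N -> typical eta n w) ->
  [/\ nrecords x w (Trec x m w) = m, (m <= Trec x m w)%N &
      typical eta (Trec x m w) w].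
Proof.
move=> /andP[eta0 eta1] Nm hw.
have de : 1 <= d%:R - eta.
  have d2 : 2 <= d%:R :> R by rewrite ler_nat.
  by rewrite lerBrDr; apply: le_trans d2; rewrite lerD2l.
have [n mn] : exists n, (m <= nrecords x w n)%N.
  have [|n1 hn1] := @near_lnn R (fun l => ln m.+1%:R <= ln l /\ 0 <= ln l).
    by near=> l; split; near: l; exact: near_ln_ge.
  exists (maxn n1 N).
  have [_ _ + _ _] := hw (maxn n1 N) (leq_maxr _ _).
  have [h1 h0] := hn1 _ (leq_maxl n1 N).
  have h2 : ln m.+1%:R <= (d%:R - eta) * ln (ln (maxn n1 N)%:R) :> R.
    by apply: le_trans h1 _; rewrite ler_peMl.
  move=> /(le_trans h2) h3; rewrite leqNgt; apply/negP => lt.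
  have [r0|r0] := posnP (nrecords x w (maxn n1 N)).
    move: h3; rewrite r0 [ln 0%:R]ln0// leNgt ln_gt0// ltr1n ltnS.
    by rewrite (leq_ltn_trans _ lt).
  move: h3; rewrite ler_ln ?posrE ?ltr0n// ler_nat => h3.
  by have := leq_trans lt (ltnW h3); rewrite ltnn.
have [h1 h2 h3] := Trec_spec mn; split=> //.
by apply: hw; exact: leq_trans h3.
Unshelve. all: by end_near.
Qed.

(** Applied with t = ln T, y = ln (k + 1) and u, z their logarithms: a total above level e + c at T
    but below level d + 1 at k + 1 forces k to be close to T. *)
Lemma index_gap (f c t u y z : R) : 0 <= c * z ->
  (f + 1 + 1) * u <= (f + 1 + 1) * z -> t + (f + c) * z < y + (f + 1 + 1) * u ->
  t <= y + 2 * z.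
Proof. lra. Qed.

(* If the maximum over the first T_m vectors is too large, then it is attained
   at an index k shortly before T_m, at which few records are still missing. *)
Lemma bad_indices_cover (c eta l1 l2 : R) (N m : nat) w :
  0 < c <= 1 -> 0 < eta <= 1 -> (N <= m)%N -> (0 < m)%N -> 1 <= ln m%:R :> R ->
  l1 = m%:R `^ (d%:R + eta)^-1 -> l2 = m%:R `^ (d%:R - eta)^-1 ->
  level (d%:R + 1) m <= l1 -> (forall y : R, l1 <= y -> [/\ 4 <= y & 4 * ln y <= y]) ->
  (forall n, (N <= n)%N -> typical eta n w) ->
  ~ bad_indices (X := X) m (index_range l1 l2) (level (e%:R + c)) (time_bound l2) eta w ->
  forall i, (i < Trec x m w)%N -> tot X i w <= level (e%:R + c) (Trec x m w).
Proof.
move=> /andP[c0 c1] eta01 Nm m_gt0 lnm1 l1E l2E lm hl1 hw nbad k kT.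
have [rT mT [covT totT reT1 reT2 pos]] := Trec_typical eta01 Nm hw.
set T := Trec x m w in rT mT covT totT reT1 reT2 kT *.
have /andP[eta0 eta1] := eta01.
have de0 : 0 < d%:R - eta.
  by rewrite subr_gt0; apply: le_lt_trans eta1 _; rewrite ltr1n ltnS.
have de0' : 0 < d%:R + eta by rewrite addr_gt0// ltr0n.
have m0 : 0 < m%:R :> R by rewrite ltr0n.
have T0 : (0 < T)%N by exact: leq_trans mT.
have TR0 : 0 < T%:R :> R by rewrite ltr0n.
pose L : R := ln T%:R.

have L1 : 1 <= L.
  by apply: le_trans lnm1 _; rewrite ler_ln ?posrE// ler_nat.
have L0 : 0 < L by exact: lt_le_trans L1.
have lnL0 : 0 <= ln L by exact: ln_ge0.
rewrite rT -/L in reT1 reT2.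
have Ll2 : L <= l2.
  rewrite l2E -ler_ln ?posrE ?powR_gt0// ln_powR mulrC ler_pdivlMr//.
  by rewrite mulrC.
have l1L : l1 <= L.
  rewrite l1E -ler_ln ?posrE ?powR_gt0// ln_powR mulrC ler_pdivrMr//.
  by rewrite mulrC.
have [L4 L4'] := hl1 L l1L.
rewrite leNgt; apply/negP => bigk; apply: nbad.
have ec0 : 0 <= (e%:R + c) * ln L by rewrite mulr_ge0// addr_ge0// ltW.
(* Among the first m vectors no total can be that large, since level d + 1 at m is at most l1 <= ln
   T. Hence k lies beyond [N] and the typical bounds hold from k on. *)
have mk : (m <= k)%N.
  rewrite leqNgt; apply/negP => km.
  have [_ /(_ k km) tm _ _ _] := hw m Nm.
  have := lt_le_trans bigk (le_trans tm (le_trans lm l1L)).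
  by rewrite ltNge /level -/L lerDl ec0.
have k0 : (0 < k)%N by exact: leq_trans mk.
have kR0 : 0 < k%:R :> R by rewrite ltr0n.
have k1R0 : 0 < k.+1%:R :> R by rewrite ltr0n.
have lnk1 : 1 <= ln k%:R :> R by apply: le_trans lnm1 _; rewrite ler_ln ?posrE// ler_nat.
have lnkk : ln k%:R <= ln k.+1%:R :> R by rewrite ler_ln ?posrE// ler_nat.
have lnk1' : 0 < ln k.+1%:R :> R by apply: lt_le_trans lnkk; exact: lt_le_trans lnk1.
have lnkT : ln k.+1%:R <= L by rewrite ler_ln ?posrE// ler_nat.
have main : L <= ln k.+1%:R + 2 * ln L.
  have [_ /(_ k (ltnSn k)) tk _ _ _] := hw k.+1 (leq_trans Nm (leqW mk)).
  apply: (@index_gap e%:R c _ (ln (ln k.+1%:R))).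
  - by rewrite mulr_ge0// ltW.
  - by rewrite natr1 ler_wpM2l ?addr_ge0// ler_ln ?posrE.
  - by rewrite natr1; exact: lt_le_trans bigk tk.
have lnk1k : ln k.+1%:R <= ln k%:R + 1 :> R.
  by apply: lnD1; rewrite ?ltr0n// ?ler1n// natr1.
exists k.
  rewrite mem_filter mem_iota add1n ltnS k0 /=; apply/andP; split.
    apply: (@le_trans _ _ (L / 4)); first by rewrite ler_pM2r.
    (* From L <= ln k + 1 + 2 ln L, 2 ln L <= L / 2 and 1 <= L / 4. *)
    move: main lnk1k L4 L4'; move: (ln k.+1%:R) (ln k%:R) (ln L) => a b z; lra.
  rewrite truncn_ge_nat ?expR_ge0//.
  apply: (@le_trans _ _ (expR L)); last by rewrite ler_expR.
  by rewrite lnK ?posrE// ler_nat ltnW.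
split.
- apply: le_trans (ltW bigk); rewrite /level -/L; apply: lerD; first exact: le_trans lnkT.
  rewrite ler_wpM2l ?addr_ge0 ?(ltW c0)// ler_ln ?posrE//.
    exact: le_trans lnkT.
  exact: lt_le_trans lnk1.
- by rewrite -rT; apply: nrecords_mono; exact: ltnW.
- rewrite -{1}rT.
  apply: leq_trans (@nrecords_nhigh _ _ _ _ _ X w eta k.+1 T kT _) _.
    move=> i /andP[ki _].
    have [cov _ _ _ _] := hw i (leq_trans Nm (leq_trans mk (ltnW ki))).
    by apply: record_high cov _.
  rewrite addnAC leq_add//.
    by rewrite nrecordsS leq_add2l; case: asbool.
  apply: nhigh_mono => //; rewrite /time_bound leqW// -(ler_nat R) natrM.
  apply: (@le_trans _ _ (k.+1%:R * L ^+ 2)).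
    rewrite -ler_ln ?posrE ?mulr_gt0 ?exprn_gt0// lnM ?posrE ?exprn_gt0//.
    by rewrite lnXn// -[_ *+ 2]mulr_natl.
  rewrite ler_wpM2l//; apply: (@le_trans _ _ (l2 ^+ 2)).
    by rewrite lerXn2r ?nnegrE ?(ltW L0)// (le_trans (ltW L0)).
  exact/ltW/truncnS_gt.
Qed.

Lemma near_pinfty_threshold (Q : R -> Prop) : (\forall y \near +oo, Q y) ->
  exists M, forall y, M <= y -> Q y.
Proof.
by move=> [M [_ hM]]; exists (M + 1) => y My; apply: hM; apply: lt_le_trans My; rewrite ltrDl.
Qed.

(** These are the exponents of 1 / m in the two terms of the final estimate. After
    cross-multiplication the gain from c has to outweigh all terms in [eta], for which c / 8 is
    small enough. *)
Lemma exponent_gap (c eta f : R) : 0 < c <= 1 -> eta = c / 8 -> 1 <= f ->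
  0 < (f + 1 + eta)^-1 * (c + f - 2 * eta) - (f + 1 - eta)^-1 * (f + 2 * eta) /\
  0 < (f + 1 + eta)^-1 * (c + 3) - (f + 1 - eta)^-1.
Proof.
move=> /andP[c0 c1] -> f1.
have p1 : 0 < f + 1 + c / 8 by lra.
have p2 : 0 < f + 1 - c / 8 by lra.
have cf : 0 < c * f by rewrite mulr_gt0//; lra.
have cc : c * c <= c by rewrite ger_pMl.
have cross (p q a b : R) : 0 < p -> 0 < q -> p * b < q * a -> q^-1 * b < p^-1 * a.
  by move=> p0 q0 h; rewrite ltr_pdivrMl// mulrCA ltr_pdivlMl.
split; first by rewrite subr_gt0; apply: cross => //; lra.
by rewrite subr_gt0 -[ltLHS]mulr1; apply: cross => //; lra.
Qed.

Lemma powR_div4 (v a y : R) : 0 < v -> (v `^ a / 4) `^ (- y) = 4 `^ y * v `^ (- (a * y)).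
Proof.
move=> v0; rewrite powRM ?powR_ge0 ?invr_ge0// -powRrM mulrN mulrC; congr (_ * _).
by rewrite -powR_inv1// -powRrM mulrNN mul1r.
Qed.

(** Rewrites the bound of [Pr_bad_indices] in powers of v = m: ln k is at least [la], a multiple of
    v^al, and at most l2 = v^be. *)
Lemma bad_bound_le (CA CS CG c eta al be v lm la l2 : R) :
  0 <= CA -> 0 <= CS -> 0 <= CG -> 0 < eta -> 0 <= c -> 0 < al -> 0 < be -> 1 <= v ->
  0 <= lm -> la = v `^ al / 4 -> l2 = v `^ be ->
  CA * la `^ (- c) * (CS * (3 * l2) `^ (e%:R + eta) * l2 `^ eta + 2) *
    (2^-1 ^+ e * la `^ (e%:R - 2 * eta))^-1 * (3 * lm) +
  CA * la `^ (- c) * (CG * la `^ (- 3)) * (1 + l2) <=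
  CA * (CS * 3 `^ (e%:R + eta) + 2) * 2 ^+ e * 4 `^ (c + e%:R - 2 * eta) * 3 *
    (v `^ (- (al * (c + e%:R - 2 * eta) - be * (e%:R + 2 * eta))) * lm) +
  CA * CG * 4 `^ (c + 3) * 2 * v `^ (- (al * (c + 3) - be)).
Proof.
move=> CA0 CS0 CG0 eta0 c0 al0 be0 v1 lm0 laE l2E.
have v0 : 0 < v by lra.
have l21 : 1 <= l2 by rewrite l2E -[leLHS](powRr0 v) ler_powR// ltW.
have l20 : 0 < l2 by lra.
have la0 : 0 < la by rewrite laE divr_gt0// powR_gt0.
have vne (a b : R) : (a + b == 0) ==> (v != 0) by apply/implyP => _; rewrite gt_eqF.
have lane (a b : R) : (a + b == 0) ==> (la != 0) by apply/implyP => _; rewrite gt_eqF.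
have l2ne (a b : R) : (a + b == 0) ==> (l2 != 0) by apply/implyP => _; rewrite gt_eqF.
apply: lerD.
  have hS : CS * (3 * l2) `^ (e%:R + eta) * l2 `^ eta + 2 <=
      (CS * 3 `^ (e%:R + eta) + 2) * l2 `^ (e%:R + 2 * eta).
    have E0 : l2 `^ (e%:R + 2 * eta) = l2 `^ (e%:R + eta) * l2 `^ eta.
      by rewrite -powRD; [congr (_ `^ _); ring|exact: l2ne].
    rewrite powRM ?(ltW l20)// mulrDl; apply: lerD.
      by rewrite E0 le_eqVlt; apply/orP; left; apply/eqP; ring.
    by rewrite ler_peMr// -[leLHS](powRr0 l2) ler_powR// addr_ge0// mulr_ge0// ltW.
  have E1 : la `^ (- c) * (2^-1 ^+ e * la `^ (e%:R - 2 * eta))^-1 =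
      2 ^+ e * (4 `^ (c + e%:R - 2 * eta) * v `^ (- (al * (c + e%:R - 2 * eta)))).
    rewrite invfM exprVn invrK mulrCA -powRN -(powRD (lane _ _)) -powR_div4// laE.
    by congr (_ * _ `^ _); ring.
  have E2 : l2 `^ (e%:R + 2 * eta) = v `^ (be * (e%:R + 2 * eta)) by rewrite l2E -powRrM.
  have E3 : v `^ (- (al * (c + e%:R - 2 * eta) - be * (e%:R + 2 * eta))) =
      v `^ (- (al * (c + e%:R - 2 * eta))) * v `^ (be * (e%:R + 2 * eta)).
    by rewrite -(powRD (vne _ _)); congr (_ `^ _); ring.
  rewrite [leLHS](_ : _ = CA * (la `^ (- c) * (2^-1 ^+ e * la `^ (e%:R - 2 * eta))^-1) *
     (3 * lm) * (CS * (3 * l2) `^ (e%:R + eta) * l2 `^ eta + 2)); last by ring.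
  rewrite E1.
  apply: le_trans (ler_wpM2l _ hS) _.
    by rewrite !mulr_ge0 ?exprn_ge0 ?powR_ge0.
  by rewrite E2 E3 le_eqVlt; apply/orP; left; apply/eqP; ring.
have E4 : la `^ (- c) * la `^ (- 3) = 4 `^ (c + 3) * v `^ (- (al * (c + 3))).
  by rewrite -(powRD (lane _ _)) -powR_div4// laE; congr (_ `^ _); ring.
rewrite [leLHS](_ : _ = CA * CG * (la `^ (- c) * la `^ (- 3)) * (1 + l2)); last by ring.
rewrite E4.
have E5 : v `^ (- (al * (c + 3) - be)) = v `^ (- (al * (c + 3))) * l2.
  by rewrite l2E -(powRD (vne _ _)); congr (_ `^ _); ring.
have hl : 1 + l2 <= 2 * l2 by lra.
apply: le_trans (ler_wpM2l _ hl) _; first by rewrite !mulr_ge0 ?powR_ge0.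
by rewrite E5 le_eqVlt; apply/orP; left; apply/eqP; ring.
Qed.

Lemma whp_tot_le (c : R) : 0 < c <= 1 ->
  whp P (fun m w => forall i, (i < Trec x m w)%N ->
           tot X i w <= level (e%:R + c) (Trec x m w)).
Proof.
move=> /[dup] c01 /andP[c0 c1] eps eps0.
pose eta := c / 8.
have eta0 : 0 < eta by rewrite divr_gt0.
have eta1 : eta <= 1 by rewrite ler_pdivrMr//; lra.
have eta01 : 0 < eta <= 1 by rewrite eta0.
have eR : 1 <= e%:R :> R by rewrite ler1n.
have [nA [CA [CA0 hCA]]] := Pr_tot_level expX indep (e%:R + c).
have [nS [CS [nS3 CS0 hCS]]] := sum_high expX indep eta0.
have [nG hnG] := Pr_not_good_at expX indep eta0 e0.
have [n3 hn3] := near_lnn (good_parameters eta0 e0).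
(* A common threshold for the tail estimates; every index in [ks] exceeds it once m is large. *)
pose ns := maxn nA (maxn nS (maxn nG n3)).
pose CG : R := 1 + (gr e eta)%:R ^+ 2.
have CG0 : 0 <= CG by rewrite addr_ge0// exprn_ge0.
pose al : R := (d%:R + eta)^-1; pose be : R := (d%:R - eta)^-1.
have d2 : 2 <= d%:R :> R by rewrite ler_nat.
have al0 : 0 < al by rewrite invr_gt0; lra.
have be0 : 0 < be by rewrite invr_gt0; lra.
have [] := exponent_gap c01 (erefl eta) eR; rewrite natr1 -/al -/be => g10 g20.
have [M1 hM1] : exists M : R, forall y : R, M <= y -> 4 <= y /\ 4 * ln y <= y.
  apply: (near_pinfty_threshold (Q := fun y => 4 <= y /\ 4 * ln y <= y)); near=> y.
  have y1 : 1 <= y by near: y; exact: near_pinfty_ge.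
  split; first by near: y; exact: near_pinfty_ge.
  by rewrite -[leRHS]powRr1; [near: y; exact: near_ln_le_powR|exact: le_trans y1].
have [M2 hM2] : exists M : R, forall y : R, M <= y ->
    [/\ 1 <= y, 2 + 2 * ln y <= y `^ eta & y + 2 + 2 * ln y <= 3 * y].
  apply: (near_pinfty_threshold (Q := fun y =>
    [/\ 1 <= y, 2 + 2 * ln y <= y `^ eta & y + 2 + 2 * ln y <= 3 * y])); near=> y.
  have y1 : 1 <= y by near: y; exact: near_pinfty_ge.
  have y4 : 4 * ln y <= y `^ eta by near: y; exact: near_ln_le_powR.
  have y4' : 2 * ln y <= y `^ 1 by near: y; exact: near_ln_le_powR.
  have y2 : 1 <= ln y by near: y; exact: near_ln_ge.
  have y3 : 2 <= y by near: y; exact: near_pinfty_ge.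
  rewrite powRr1 in y4'; last by lra.
  by split=> //; lra.
pose K1 : R := CA * (CS * 3 `^ (e%:R + eta) + 2) * 2 ^+ e * 4 `^ (c + e%:R - 2 * eta) * 3.
pose K2 : R := CA * CG * 4 `^ (c + 3) * 2.
pose g1 := al * (c + e%:R - 2 * eta) - be * (e%:R + 2 * eta).
pose g2 := al * (c + 3) - be.
pose Q (v : R) := [/\ 1 <= v /\ 1 <= ln v, ln v + (d%:R + 1) * ln (ln v) <= v `^ al,
  M1 <= v `^ al /\ M2 <= v `^ be, 1 <= v `^ al / 4 /\ ln ns%:R <= v `^ al / 4 &
  K1 * (v `^ (- g1) * ln v) <= eps / 4 /\ K2 * v `^ (- g2) <= eps / 4].
have e40 : 0 < eps / 4 by rewrite divr_gt0.
have [nQ hnQ] : exists n0, forall n : nat, (n0 <= n)%N -> Q n%:R.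
  apply: near_natr; near=> v.
  have v1 : 1 <= v by near: v; exact: near_pinfty_ge.
  have v0 : 0 < v by exact: lt_le_trans v1.
  have lv1 : 1 <= ln v by near: v; exact: near_ln_ge.
  split.
  - by split.
  - apply: (@le_trans _ _ ((d%:R + 2) * ln v)).
      have : ln (ln v) <= ln v.
        have lv0 : 0 < ln v by exact: lt_le_trans lv1.
        rewrite -[in leLHS](subrK 1 (ln v)) [_ + 1]addrC.
        apply: le_trans (le_ln1Dx _) _; first by rewrite ltrBrDr addNr.
        by rewrite gerBl.
      move=> h; rewrite (_ : (d%:R + 2) * ln v = ln v + (d%:R + 1) * ln v); last by ring.
      by rewrite lerD2l ler_wpM2l// addr_ge0.
    by near: v; exact: near_ln_le_powR.
  - by split; near: v; exact: near_powR_ge.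
  - by rewrite !ler_pdivlMr//; split; near: v; exact: near_powR_ge.
  - split.
      rewrite mulrCA powRN ler_pdivrMl ?powR_gt0// -ler_pdivrMr// mulrAC.
      by near: v; exact: near_ln_le_powR.
    rewrite powRN ler_pdivrMr ?powR_gt0// -ler_pdivrMl//.
    by near: v; exact: near_powR_ge.
have e20 : 0 < eps / 2 by rewrite divr_gt0.
have [N [V [mV pV hV]]] := ev_typical eta01 e20.
exists (maxn N (maxn nQ 1)) => m; rewrite !geq_max => /and3P[Nm nQm m1].
have [[v1 lv1] q2 [q3 q3'] [q4 q4'] [q5 q6]] := hnQ m nQm.
set v : R := m%:R in v1 lv1 q2 q3 q3' q4 q4' q5 q6.
pose l1 := v `^ al; pose l2 := v `^ be.
have v0 : 0 < v by exact: lt_le_trans v1.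
have l10 : 0 < l1 by rewrite powR_gt0.
have [l21 l2a l2b] := hM2 _ q3'; rewrite -/l2 in l21 l2a l2b.
have l20 : 0 < l2 by exact: lt_le_trans l21.
pose la := l1 / 4.
have la0 : 0 < la by rewrite divr_gt0.
pose ks := index_range l1 l2.
have ksP k : k \in ks -> [/\ (0 < k)%N, la <= ln k%:R, k%:R <= expR l2 & (ns <= k)%N].
  rewrite mem_filter mem_iota add1n ltnS => /and3P[lk k0 kb].
  have k0R : 0 < k%:R :> R by rewrite ltr0n.
  split=> //; first by move: kb; rewrite truncn_ge_nat// expR_ge0.
  have n0 : 0 < ns%:R :> R.
    by rewrite ltr0n /ns !leq_max (leq_trans _ nS3) ?orbT.
  by rewrite -(ler_nat R) -ler_ln ?posrE//; exact: le_trans lk.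
have nsP k : (ns <= k)%N -> [/\ (nA <= k)%N, (nS <= k)%N, (nG <= k)%N & (n3 <= k)%N].
  by rewrite /ns !geq_max => /and4P[].
(* From [sum_high] between k + 1 and (k + 1) B: the logarithm of the upper end is at most 3 l2, and
   1 + ln B is at most l2^eta. *)
pose S := CS * (3 * l2) `^ (e%:R + eta) * l2 `^ eta.
have S0 : 0 <= S by rewrite !mulr_ge0 ?powR_ge0.
have le_la (k : nat) (y : R) : la <= ln k%:R -> 0 <= y ->
    ln k%:R `^ (- y) <= la `^ (- y).
  move=> lk y0; have k0 := lt_le_trans la0 lk.
  rewrite !powRN lef_pV2 ?posrE ?powR_gt0//.
  by apply: ge0_ler_powR => //; rewrite nnegrE ltW.
have mB := @measurable_bad_indices _ _ _ P _ X m ks (level (e%:R + c)) (time_bound l2) eta.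
have pB : Pr P (bad_indices (X := X) m ks (level (e%:R + c)) (time_bound l2) eta) <= eps / 2.
  (* With l = ln k >= la: the tail at level e + c is at most CA l^-c / k; and [q] comes from M^e >=
     l^(e - eta) together with k e^-gs = l^-eta. *)
  pose pA := CA * la `^ (- c); pose q := 2^-1 ^+ e * la `^ (e%:R - 2 * eta).
  pose G := CG * la `^ (- 3).
  have e2eta : 0 <= e%:R - 2 * eta by rewrite /eta; lra.
  have h : Pr P (bad_indices (X := X) m ks (level (e%:R + c)) (time_bound l2) eta) <=
      pA * (S + 2) * q^-1 * (1 + ln m.+1%:R) + pA * G * (1 + l2).
    apply: Pr_bad_indices => //.
    - by rewrite filter_uniq// iota_uniq.
    - by rewrite mulr_ge0// powR_ge0.
    - by rewrite mulr_gt0 ?exprn_gt0 ?powR_gt0.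
    - by rewrite mulr_ge0// powR_ge0.
    - move=> k kks; have [k0 lk _ /nsP[nAk _ _ _]] := ksP k kks.
      apply: le_trans (hCA k nAk) _; rewrite ler_wpM2r ?invr_ge0// ler_wpM2l//.
      by rewrite opprD addrA subrr add0r; apply: le_la => //; exact: ltW.
    - move=> k kks; have [k0 lk kl2 /nsP[_ nSk _ _]] := ksP k kks.
      pose B := (Num.trunc (l2 ^+ 2)).+1.
      apply: le_trans (hCS k.+1 (k.+1 * B)%N _) _.
        by rewrite leqW//= leq_pmulr.
      have B0 : 0 < B%:R :> R by rewrite ltr0n.
      have k1R0 : 0 < k.+1%:R :> R by rewrite ltr0n.
      rewrite natrM lnM ?posrE// [X in _ * X <= _](_ : _ = 1 + ln B%:R); last by ring.
      have lnB : ln B%:R <= 1 + 2 * ln l2 :> R.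
        have l2s : 1 <= l2 ^+ 2 by rewrite exprn_ege1.
        have Bl : B%:R <= l2 ^+ 2 + 1 :> R.
          have /truncn_itv/andP[h _] : 0 <= l2 ^+ 2 by exact: le_trans l2s.
          by rewrite /B -natr1 lerD2r.
        have := lnD1 l2s Bl B0; rewrite lnXn// -[_ *+ 2]mulr_natl addrC; exact.
      have lnk : ln k.+1%:R <= l2 + 1 :> R.
        rewrite -[X in X + 1](expRK l2); apply: lnD1 => //.
          by rewrite -expR0 ler_expR ltW.
        by rewrite -natr1 lerD2r.
      have lnB0 : 0 <= ln B%:R :> R by rewrite ln_ge0// ler1n.
      have lnk0 : 0 <= ln k.+1%:R :> R by rewrite ln_ge0// ler1n.
      rewrite /S -!mulrA ler_wpM2l//; apply: ler_pM.
      + exact: powR_ge0.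
      + by rewrite addr_ge0.
      + apply: ge0_ler_powR.
        * by rewrite addr_ge0// ltW.
        * by rewrite nnegrE addr_ge0.
        * by rewrite nnegrE mulr_ge0// ltW.
        * apply: le_trans l2b; apply: le_trans (lerD lnk lnB) _.
          by rewrite [leLHS](_ : _ = l2 + 2 + 2 * ln l2)//; ring.
      + by apply: le_trans l2a; apply: le_trans (lerD (lexx 1) lnB) _; rewrite addrA.
    - move=> k kks; have [k0 lk _ /nsP[_ _ _ n3k]] := ksP k kks.
      by have [_ h1 h2 _ _] := hn3 k n3k.
    - move=> k kks; have [k0 lk _ /nsP[_ _ _ n3k]] := ksP k kks.
      have [_ _ _ _ [h1 _]] := hn3 k n3k.
      have lk0 := lt_le_trans la0 lk.
      rewrite ler_pdivrMr ?ltr0n// -mulrA -mulrA [X in _ * (_ * X)]mulrC.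
      rewrite (mul_expR_level eta k0 lk0) /q [leRHS]mulrCA ler_wpM2l ?exprn_ge0//.
      apply: (@le_trans _ _ (ln k%:R `^ (e%:R - eta) * ln k%:R `^ (- eta))); last first.
        by rewrite ler_wpM2r ?powR_ge0.
      rewrite -powRD; last by apply/implyP => _; rewrite gt_eqF.
      rewrite (_ : e%:R - eta - eta = e%:R - 2 * eta); last by ring.
      by apply: ge0_ler_powR => //; rewrite nnegrE ltW.
    - move=> k kks; have [k0 lk _ /nsP[_ _ nGk _]] := ksP k kks.
      by apply: le_trans (hnG k nGk) _; rewrite ler_wpM2l//; exact: le_la.
    - have b1 : (0 < index_bound l2)%N.
        by rewrite /index_bound truncn_gt0 -expR0 ler_expR ltW.
      apply: (@le_trans _ _ (\sum_(1 <= k < (index_bound l2).+1) k%:R^-1)).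
        rewrite /ks /index_range big_filter /index_iota subn1 /=.
        rewrite [leRHS](bigID (fun k : nat => l1 / 4 <= ln k%:R)) /= lerDl.
        by rewrite sumr_ge0// => k _; rewrite invr_ge0.
      apply: le_trans (sum_harmonic_le _) _; first by rewrite b1.
      rewrite ln1 subr0 lerD2l -ler_expR lnK ?posrE ?ltr0n//.
      by have /truncn_itv/andP[] := expR_ge0 l2.
  apply: le_trans h _; rewrite [leRHS]splitr.
  have ln3 : 1 + ln m.+1%:R <= 3 * ln v.
    have : ln m.+1%:R <= ln v + 1.
      by apply: lnD1; rewrite ?ltr0n// -natr1.
    move: lv1; move: (ln v) (ln m.+1%:R) => a b; lra.
  have lv0 : 0 <= ln v by exact: le_trans lv1.
  have := bad_bound_le CA0 CS0 CG0 eta0 (ltW c0) al0 be0 v1 lv0 (erefl la) (erefl l2).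
  rewrite -/pA -/S -/q -/G -/K1 -/K2 -/g1 -/g2 => hb.
  apply: (@le_trans _ _ (pA * (S + 2) / q * (3 * ln v) + pA * G * (1 + l2))).
    have pA0 : 0 <= pA by rewrite mulr_ge0// powR_ge0.
    have q0 : 0 <= q by rewrite mulr_ge0 ?powR_ge0// exprn_ge0.
    by rewrite lerD2r ler_wpM2l// divr_ge0// mulr_ge0// addr_ge0.
  apply: le_trans hb _.
  have e4 : eps / 2 / 2 = eps / 4 by field.
  by rewrite e4; exact: lerD.
exists (V `|` bad_indices (X := X) m ks (level (e%:R + c)) (time_bound l2) eta); split.
- by apply: measurableU => //; exact: mB.
- by apply: le_trans (Pr_setU_le _ mV mB) _; rewrite [leRHS]splitr; exact: lerD.
- move=> w /not_orP[nV nB].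
  apply: (bad_indices_cover c01 eta01 Nm m1 lv1 (erefl l1) (erefl l2)) nB => //.
  + by move=> y l1y; have [? ?] := hM1 y (le_trans q3 l1y).
  + exact: hV.
Unshelve. all: by end_near. Qed.

End record_times.

(** * Limits superior and infinitely many large vectors *)

Section limsup.
Context {R : realType}.

Lemma limn_esup_EFin (u : nat -> R) (l : R) :
  (forall eps, 0 < eps -> exists N, forall m, (N <= m)%N -> u m <= l + eps) ->
  (forall eps, 0 < eps -> forall N, exists2 m, (N <= m)%N & l - eps <= u m) ->
  limn_esup (fun m => (u m)%:E) = l%:E.
Proof.
move=> hle hge; apply/eqP; rewrite eq_le; apply/andP; split.
  apply/lee_addgt0Pr => eps eps0; have [N hN] := hle _ eps0.
  apply: (@le_trans _ _ (ereal_sup [set (u m)%:E | m in [set m | (N <= m)%N]])).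
    by apply: ereal_inf_lbound; exists [set m | (N <= m)%N] => //; exact: nbhs_infty_ge.
  by apply: ub_ereal_sup => _ [m Nm <-]; rewrite -EFinD lee_fin; exact: hN.
apply: le_ereal_inf_tmp => _ [A [N _ NA] <-].
apply/lee_addgt0Pr => eps eps0; have [m Nm hm] := hge _ eps0 N.
rewrite -leeBlDr// -EFinB; apply: (@le_trans _ _ (u m)%:E); first by rewrite lee_fin.
by apply: ereal_sup_ubound; exists m => //; exact: NA.
Qed.

Lemma limn_einf_EFin (u : nat -> R) (l : R) :
  (forall eps, 0 < eps -> exists N, forall m, (N <= m)%N -> l - eps <= u m) ->
  (forall eps, 0 < eps -> forall N, exists2 m, (N <= m)%N & u m <= l + eps) ->
  limn_einf (fun m => (u m)%:E) = l%:E.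
Proof.
move=> hge hle; rewrite /limn_einf -[RHS]oppeK; congr (- _)%E.
rewrite -EFinN -(@limn_esup_EFin (fun m => - u m))//.
- move=> eps /hge[N hN]; exists N => m /hN; lra.
- move=> eps /hle h N; have [m Nm] := h N; exists m => //; lra.
Qed.

End limsup.

Section infinitely_often.
Context {R : realType} {d0 : measure_display} {Omega : measurableType d0}.
Context {P : probability Omega R}.

(** The event that [Q m] fails for all m >= N is contained in each single failure, hence in sets of
    arbitrarily small probability. *)
Lemma whp_io (Q : nat -> Omega -> Prop) : whp P Q ->
  {ae P, forall w, forall N, exists2 m, (N <= m)%N & Q m w}.
Proof.
move=> hQ; apply: ae_foralln => N.
have /choice[V hV] k : exists V, [/\ measurable V, Pr P V <= k.+1%:R^-1 &
    forall w, ~ V w -> exists2 m, (N <= m)%N & Q m w].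
  have [|M hM] := hQ k.+1%:R^-1; first by rewrite invr_gt0.
  have [V [mV pV qV]] := hM (maxn N M) (leq_maxr _ _).
  by exists V; split=> // w /qV; exists (maxn N M) => //; exact: leq_maxl.
have ev : almost_uniformly_eventually P (fun _ w => exists2 m, (N <= m)%N & Q m w).
  move=> eps eps0; have [k ke] := ltr_add_invr eps0; rewrite add0r in ke.
  have [mV pV qV] := hV k; exists 0%N, (V k); split=> //; last by move=> w /qV.
  exact: le_trans pV (ltW ke).
have := ev_ae ev; apply: filterS => w [n hn].
exact: hn (leqnn n).
Qed.

End infinitely_often.

(** * Totals at coefficients close to d occur infinitely often *)

Section large_totals.
Context {R : realType} {d0 : measure_display} {Omega : measurableType d0}.
Context {P : probability Omega R} {e : nat} {X : nat -> 'I_e.+1 -> {RV P >-> R}}.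
Hypothesis expX : forall k j A, measurable A ->
  P (X k j @^-1` A) = exponential_prob 1 A.
Hypothesis indep :
  mutually_independent P (fun kj : nat * 'I_e.+1 => (X kj.1 kj.2 : Omega -> R)).
Hypothesis e0 : (0 < e)%N.
Local Notation d := e.+1.

(** Telescoping with ln (1 + y) <= y, applied once to ln i and once to ln (ln i). *)
Lemma sum_inv_nln_ge (a n : nat) : (2 < a)%N -> 
  ln (ln (a + n)%:R) - ln (ln a%:R) <= \sum_(a <= i < a + n) (i%:R * ln i%:R)^-1 :> R.
Proof.
move=> a2; elim: n => [|n IH]; first by rewrite addn0 big_geq// subrr.
rewrite addnS big_nat_recr ?leq_addr//=.
set i := (a + n)%N in IH *.
have i2 : (2 < i)%N by rewrite /i (leq_trans a2)// leq_addr.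
have i0 : 0 < i%:R :> R by rewrite ltr0n (leq_trans _ i2).
have i10 : 0 < i.+1%:R :> R by rewrite ltr0n.
have li0 : 0 < ln i%:R :> R by rewrite ln_gt0// ltr1n (leq_trans _ i2).
have li10 : 0 < ln i.+1%:R :> R by rewrite ln_gt0// ltr1n ltnS (leq_trans _ i2).
have h1 : ln i.+1%:R <= ln i%:R + i%:R^-1 :> R.
  have : ln (1 + i%:R^-1) <= i%:R^-1 :> R.
    by apply: le_ln1Dx; apply: lt_le_trans (_ : 0 <= _); rewrite ?invr_ge0 ?(ltW i0)// ltrN10.
  have -> : 1 + i%:R^-1 = i.+1%:R / i%:R :> R.
    by rewrite -natr1 mulrDl mul1r divff// gt_eqF.
  rewrite ln_div ?posrE//; lra.
have h2 : ln (ln i.+1%:R) <= ln (ln i%:R) + (i%:R * ln i%:R)^-1 :> R.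
  apply: (@le_trans _ _ (ln (ln i%:R + i%:R^-1))).
    by rewrite ler_ln ?posrE// addr_gt0// invr_gt0.
  have -> : ln i%:R + i%:R^-1 = ln i%:R * (1 + (i%:R * ln i%:R)^-1) :> R.
    by field; rewrite !gt_eqF.
  have p0 : 0 <= (i%:R * ln i%:R)^-1 :> R by rewrite invr_ge0 mulr_ge0 ?ltW.
  rewrite lnM ?posrE//; last by rewrite ltr_wpDr.
  rewrite lerD2l; apply: le_ln1Dx; apply: lt_le_trans p0; exact: ltrN10.
move: IH h2; lra.
Qed.

(** The second Borel-Cantelli lemma, through the divergence of the sum of 1 / (i ln i). The level is
    taken at n + 1, the first time at which vector n contributes to the maximum. *)
Lemma ae_tot_io (c : R) : 0 < c <= 1 ->
  {ae P, forall w, forall N, exists2 n, (N <= n)%N &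
     level (d%:R - c) n.+1 <= tot X n w}.
Proof.
move=> /andP[c0 c1]; apply: ae_foralln => N.
have eR : 1 <= e%:R :> R by rewrite ler1n.
pose C : R := (4 * e%:R)^-1 ^+ e.
have C0 : 0 < C by rewrite exprn_gt0// invr_gt0 mulr_gt0// ltr0n.
have dc0 : 0 <= d%:R - c by rewrite -natr1; lra.
pose Q (l : R) := [/\ 2 * e%:R <= l, 0 <= ln l & C^-1 <= l `^ c].
have [n0 hn0] : exists n0, forall n : nat, (n0 <= n)%N -> Q (ln n%:R).
  apply: near_lnn; near=> l; split.
  - by near: l; exact: near_pinfty_ge.
  - by near: l; exact: near_ln_ge.
  - by near: l; exact: near_powR_ge.
pose A i := tot_ge X (level (d%:R - c) i.+1) i.
have hPA i : (n0 <= i)%N -> (0 < i)%N -> (i.+1%:R * ln i.+1%:R)^-1 <= Pr P (A i).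
  move=> ni i0; have [l1 ll0 lC] := hn0 i.+1 (leqW ni).
  set l : R := ln i.+1%:R in l1 ll0 lC *.
  have e00 : 0 < e%:R :> R by rewrite ltr0n.
  have l0 : 0 < l by apply: lt_le_trans l1; rewrite mulr_gt0.
  pose M := Num.trunc (l / e%:R).
  have M1 : M%:R * e%:R <= l.
    rewrite -ler_pdivlMr//.
    have /truncn_itv/andP[] // : 0 <= l / e%:R by rewrite divr_ge0// ltW.
  have M2 : (2 * e%:R)^-1 * l <= M%:R.
    have : l / e%:R < M.+1%:R by exact: truncnS_gt.
    have : 2 <= l / e%:R by rewrite ler_pdivlMr.
    rewrite -[M.+1%:R]natr1 (_ : _ * _ = 2^-1 * (l / e%:R)).
      by move: (M%:R : R) (l / e%:R) => m q; lra.
    by rewrite invfM -mulrA [X in _ * X]mulrC.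
  have Ms : M%:R * e%:R <= level (d%:R - c) i.+1.
    by apply: le_trans M1 _; rewrite /level -/l lerDl mulr_ge0.
  apply: le_trans (Pr_tot_ge_ge expX indep i Ms).
  have iR0 : 0 < i.+1%:R :> R by rewrite ltr0n.
  have -> : expR (- level (d%:R - c) i.+1) = l `^ (- (d%:R - c)) / i.+1%:R.
    by rewrite -(mul_expR_level (d%:R - c) (ltn0Sn i) l0) mulrAC divff ?mul1r.
  rewrite invfM [leLHS]mulrC mulrA ler_wpM2r ?invr_ge0 ?(ltW iR0)//.
  apply: (@le_trans _ _ (((4 * e%:R)^-1 * l) ^+ e * l `^ (- (d%:R - c)))); last first.
    rewrite ler_wpM2r ?powR_ge0// lerXn2r ?nnegrE ?divr_ge0//.
      by rewrite mulr_ge0 ?(ltW l0)// invr_ge0 mulr_ge0// ltW.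
    rewrite ler_pdivlMr//; apply: le_trans M2.
    rewrite (_ : (4 * e%:R)^-1 * l * 2 = (2 * e%:R)^-1 * l :> R)//.
    by field; rewrite ?gt_eqF.
  rewrite exprMn -/C -powR_mulrn ?(ltW l0)// -mulrA.
  have lne (a b : R) : (a + b == 0) ==> (l != 0) by apply/implyP => _; rewrite gt_eqF.
  rewrite -(powRD (lne _ _)).
  (* The power l^c absorbs the constant [C] and leaves 1 / l. *)
  have -> : e%:R + - (d%:R - c) = c + (- 1) by rewrite -[d%:R]natr1; ring.
  rewrite (powRD (lne _ _)) powR_inv1 ?(ltW l0)// mulrA ler_peMl ?invr_ge0 ?(ltW l0)//.
  by rewrite mulrC -ler_pdivrMr// div1r.
pose a := maxn N (maxn n0 2).
have a2 : (2 < a.+1)%N by rewrite ltnS /a !leq_max leqnn !orbT.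
have ev : almost_uniformly_eventually P (fun _ w => exists2 n, (N <= n)%N &
     level (d%:R - c) n.+1 <= tot X n w).
  move=> eps eps0.
  have [n hn] : exists n : nat, expR (- (ln (ln (a.+1 + n)%:R) - ln (ln a.+1%:R))) <= eps :> R.
    have [|n1 hn1] := @near_lnn R (fun l => ln (ln a.+1%:R) - ln eps <= ln l).
      by near=> l; near: l; exact: near_ln_ge.
    exists n1; rewrite -[leRHS]lnK ?posrE// ler_expR.
    have := hn1 (a.+1 + n1)%N (leq_addl _ _); lra.
  pose V := [set w | forall i, (a <= i < a + n)%N -> ~ A i w].
  have mV : measurable V.
    rewrite (_ : V = \bigcap_(i in [set i | (a <= i < a + n)%N]) ~` A i)//.
    apply: fin_bigcap_measurable.
      apply: (@sub_finite_set _ _ `I_(a + n)); last exact: finite_II.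
      by move=> i /= /andP[].
    by move=> i _; apply: measurableC; exact: measurable_tot_ge.
  exists 0%N, V; split=> //.
    apply: le_trans (Pr_avoid indep a n (A := A) _) _.
      by move=> i; exact: history_tot_ge.
    apply: le_trans hn; rewrite ler_expR lerN2.
    apply: le_trans (sum_inv_nln_ge n a2) _.
    rewrite addSn big_add1 /= big_nat [leRHS]big_nat; apply: ler_sum => i /andP[ai _].
    have : (n0 <= i)%N by apply: leq_trans ai; rewrite /a !leq_max leqnn !orbT.
    move=> /hPA; apply; apply: leq_trans ai.
    by rewrite /a !leq_max !orbT.
  move=> w nV _ _; apply: contrapT => hN; apply: nV => i /andP[ai _] Ai.
  by apply: hN; exists i => //; apply: leq_trans ai; rewrite /a leq_max leqnn.
have := ev_ae ev; apply: filterS => w [n hn].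
exact: hn (leqnn n).
Unshelve. all: by end_near.
Qed.

End large_totals.

(** * The width of the frontier at record times *)

Section ratio.
Context {R : realType}.

(** With p = a / D <= 1 and D >= 2, expanding (p + 6c)(D - c) gains 6cD >= 12c over a and loses at
    most c p + 6c^2 <= 4c, which leaves more than 2c. *)
Lemma ratio_le (D a c u r W : R) : 2 <= D -> 0 <= a <= D -> 0 < c <= 2^-1 -> 0 < u ->
  W <= (a + 2 * c) * u -> (D - c) * u <= r -> W / r <= a / D + 6 * c.
Proof.
move=> D2 /andP[a0 aD] /andP[c0 c2] u0 hW hr.
have D0 : 0 < D by lra.
pose p := a / D.
have pD : a = p * D by rewrite /p divfK// gt_eqF.
have p0 : 0 <= p by rewrite divr_ge0// ltW.
have p1 : p <= 1 by rewrite ler_pdivrMr// mul1r.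
have r0 : 0 < r by apply: lt_le_trans hr; rewrite mulr_gt0//; lra.
rewrite ler_pdivrMr// -/p; apply: le_trans hW _.
have k0 : 0 <= p + 6 * c by lra.
apply: le_trans (ler_wpM2l k0 hr); rewrite mulrA; apply: ler_wpM2r; first exact: ltW.
have cp : c * p <= c by rewrite ler_piMr// ltW.
have cD : 2 * c <= c * D by rewrite mulrC ler_wpM2l// ltW.
have cc : c * c <= c by rewrite ler_piMr//; lra.
rewrite pD; lra.
Qed.

Lemma ratio_ge (D a c u r W : R) : 2 <= D -> 0 <= a <= D -> 0 < c <= 2^-1 -> 0 < u ->
  (a - 2 * c) * u <= W -> (D - c) * u <= r -> r <= (D + c) * u ->
  a / D - 6 * c <= W / r.
Proof.
move=> D2 /andP[a0 aD] /andP[c0 c2] u0 hW hr1 hr2.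
have D0 : 0 < D by lra.
pose p := a / D.
have pD : a = p * D by rewrite /p divfK// gt_eqF.
have p0 : 0 <= p by rewrite divr_ge0// ltW.
have p1 : p <= 1 by rewrite ler_pdivrMr// mul1r.
have r0 : 0 < r by apply: lt_le_trans hr1; rewrite mulr_gt0//; lra.
rewrite ler_pdivlMr// -/p; apply: le_trans hW.
have cp : c * p <= c by rewrite ler_piMr// ltW.
have cp0 : 0 <= c * p by rewrite mulr_ge0// ltW.
have cD : 2 * c <= c * D by rewrite mulrC ler_wpM2l// ltW.
have cc : c * c <= c by rewrite ler_piMr//; lra.
have cc0 : 0 <= c * c by rewrite mulr_ge0// ltW.
have [k0|k0] := leP 0 (p - 6 * c).
  apply: le_trans (ler_wpM2l k0 hr2) _; rewrite mulrA; apply: ler_wpM2r; first exact: ltW.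
  rewrite pD; lra.
(* When p - 6c is negative, the product with r is bounded through the lower bound on r instead of
   the upper one. *)
apply: le_trans (ler_wnM2l (ltW k0) hr1) _; rewrite mulrA; apply: ler_wpM2r; first exact: ltW.
rewrite pD; lra.
Qed.

End ratio.

Section width.
Context {R : realType} {d0 : measure_display} {Omega : measurableType d0}.
Context {P : probability Omega R} {e : nat} {X : nat -> 'I_e.+1 -> {RV P >-> R}}.
Hypothesis expX : forall k j A, measurable A ->
  P (X k j @^-1` A) = exponential_prob 1 A.
Hypothesis indep :
  mutually_independent P (fun kj : nat * 'I_e.+1 => (X kj.1 kj.2 : Omega -> R)).
Hypothesis e0 : (0 < e)%N.
Local Notation ev := (almost_uniformly_eventually P).
Local Notation d := e.+1.
Local Notation x := (fun k j => X k j : Omega -> R).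
Local Notation LL n := (ln (ln n%:R) : R).
Local Notation ratio m w := (Wtilde x m w / ln m%:R).

Definition regular (c : R) (n : nat) (w : Omega) : Prop :=
  [/\ (forall i j, 0 < X i j w) /\ 0 < LL n,
      level (- c) n <= Fminus x n w <= level c n,
      level (e%:R - c) n <= Fplus x n w <= level (d%:R + c) n &
      (d%:R - c) * LL n <= ln (nrecords x w n)%:R <= (d%:R + c) * LL n].

Lemma ev_regular c : 0 < c <= 1 -> ev (regular c).
Proof.
move=> /[dup] c01 /andP[c0 c1].
have h1 := ev_covers expX indep c0.
have h2 := ev_free expX indep c0 e0.
have h3 := ev_tot_ge expX indep e0 c01.
have h4 := ev_tot_le expX indep c0.
have h5 := ev_nrecords_ge expX indep c01.
have h6 := ev_nrecords_le expX indep c0.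
have h7 := ev_ae_cst (ae_pos expX).
pose Q (l : R) := 0 <= l /\ 1 <= ln l.
have [n0 hn0] : exists n0, forall n : nat, (n0 <= n)%N -> Q (ln n%:R).
  apply: near_lnn; near=> l; split.
    by near: l; exact: near_pinfty_ge.
  by near: l; exact: near_ln_ge.
apply: (ev_imp (n0 := n0.+1)) (ev_and h1 (ev_and h2 (ev_and h3 (ev_and h4
  (ev_and h5 (ev_and h6 h7)))))).
move=> w n nn0 [k1 [k2 [k3 [k4 [k5 [k6 k7]]]]]].
have [l0 ll1] := hn0 n (ltnW nn0).
have n_gt0 : (0 < n)%N by exact: leq_trans nn0.
have u0 : 0 < LL n by exact: lt_le_trans ll1.
split; first by split.
- apply/andP; split.
    by apply: Fminus_ge => // y y0 ys; have [i ni hi] := k1 y y0 ys; exists i.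
  have [y [y0 ys yf]] := k2; apply: le_trans ys.
  by apply: Fminus_le.
- apply/andP; split.
    have [i ni hi] := k3; apply: le_trans hi _.
    exact: Fplus_ge.
  apply: Fplus_le; last exact: k4.
  by rewrite addr_ge0// mulr_ge0 ?(ltW u0)// addr_ge0// ltW.
- by rewrite k5.
Unshelve. all: by end_near.
Qed.

Lemma half01 : 0 < (2^-1 : R) <= 1.
Proof. by apply/andP; split; lra. Qed.

(** The typical event enters to guarantee that all records exist; 1/2 is one admissible value of its
    parameter. *)
Lemma ev_Trec (Q : nat -> Omega -> Prop) : ev Q ->
  ev (fun m w => [/\ nrecords x w (Trec x m w) = m, (m <= Trec x m w)%N &
                     Q (Trec x m w) w]).
Proof.
move=> hQ; have ht := ev_typical expX indep half01.
apply: ev_shift (ev_and hQ ht) => N; exists N => w hw m Nm.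
have [h1 h2 h3] := Trec_typical e0 half01 Nm (fun n Nn => (hw n Nn).2).
by split=> //; exact: (hw _ (leq_trans Nm h2)).1.
Qed.

Lemma dR2 : 2 <= d%:R :> R.
Proof. by rewrite ler_nat. Qed.

Lemma edR : 0 <= (e%:R : R) <= d%:R.
Proof. by rewrite ler0n ler_nat leqnSn. Qed.

Lemma ratio_ge_regular c m w : 0 < c <= 2^-1 -> nrecords x w (Trec x m w) = m ->
  regular c (Trec x m w) w -> e%:R / d%:R - 6 * c <= ratio m w.
Proof.
move=> c01 rT [[pos u0] /andP[f1 f2] /andP[g1 g2]]; rewrite rT => /andP[r1 r2].
apply: (ratio_ge dR2 edR c01 u0 _ r1 r2).
rewrite /Wtilde /Wn; move: f2 g1; rewrite /level.
move: (ln (Trec x m w)%:R) (Fplus _ _ _) (Fminus _ _ _) => l fp fm; lra.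
Qed.

Lemma ratio_le_regular c m w : 0 < c <= 2^-1 -> nrecords x w (Trec x m w) = m ->
  regular c (Trec x m w) w -> ratio m w <= 1 + 6 * c.
Proof.
move=> c01 rT [[pos u0] /andP[f1 f2] /andP[g1 g2]]; rewrite rT => /andP[r1 r2].
have dd : 0 <= (d%:R : R) <= d%:R by rewrite ler0n lexx.
have dn0 : d%:R != 0 :> R by rewrite pnatr_eq0.
have -> : 1 + 6 * c = d%:R / d%:R + 6 * c by rewrite divff.
apply: (ratio_le dR2 dd c01 u0 _ r1).
rewrite /Wtilde /Wn; move: f1 g2; rewrite /level.
move: (ln (Trec x m w)%:R) (Fplus _ _ _) (Fminus _ _ _) => l fp fm; lra.
Qed.

(** The lower half holds almost surely eventually; only the upper bound on F^+ is restricted to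
    probability. *)
Lemma whp_ratio c : 0 < c <= 2^-1 ->
  whp P (fun m w => `| ratio m w - e%:R / d%:R | <= 6 * c).
Proof.
move=> /[dup] c01 /andP[c0 c2].
have c01' : 0 < c <= 1 by rewrite c0 (le_trans c2)//; case/andP: half01.
have h1 := ev_whp (ev_Trec (ev_regular c01')).
have h2 := whp_tot_le expX indep e0 c01'.
apply: (whp_imp (n0 := 0)) (whp_and h1 h2) => w m _ [[rT mT reg] tT].
rewrite ler_distl; apply/andP; split; first exact: ratio_ge_regular.
case: reg => [[pos u0] /andP[f1 f2] /andP[g1 g2]]; rewrite rT => /andP[r1 r2].
apply: (ratio_le dR2 edR c01 u0 _ r1).
have fp : Fplus x (Trec x m w) w <= level (e%:R + c) (Trec x m w).
  apply: Fplus_le => //; rewrite addr_ge0 ?mulr_ge0 ?(ltW u0) ?addr_ge0 ?(ltW c0)//.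
  by have [->|n0] := posnP (Trec x m w); [rewrite ln0|rewrite ln_ge0// ler1n].
rewrite /Wtilde /Wn; move: f1 fp; rewrite /level.
move: (ln (Trec x m w)%:R) (Fplus _ _ _) (Fminus _ _ _) => l a b; lra.
Qed.

Lemma ae_limits : {ae P, forall w,
  limn_einf (fun m => (ratio m w)%:E) = (e%:R / d%:R)%:E /\
  limn_esup (fun m => (ratio m w)%:E) = 1%:E}.
Proof.
(* Countably many tolerances, all at most 1/2, so that a single null set serves every eps. *)
pose c (q : nat) : R := q.+2%:R^-1.
have c01 q : 0 < c q <= 2^-1 by rewrite invr_gt0 ltr0n lef_pV2 ?posrE ?ltr0n// ler_nat.
have c01' q : 0 < c q <= 1.
  by have /andP[c0 c2] := c01 q; rewrite c0 (le_trans c2)//; case/andP: half01.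
have small (eps : R) : 0 < eps -> exists q, 6 * c q <= eps.
  move=> eps0; have [|k] := ltr_add_invr (_ : 0 < eps / 6); first by rewrite divr_gt0.
  rewrite add0r => hk; exists k; rewrite mulrC -ler_pdivlMr//.
  by apply: le_trans (ltW hk); rewrite lef_pV2 ?posrE ?ltr0n// ler_nat.
have a1 : {ae P, forall w, forall q, exists N, forall n, (N <= n)%N -> regular (c q) n w}.
  by apply: ae_foralln => q; apply: ev_ae; exact: ev_regular.
have a2 : {ae P, forall w, forall q, exists N, forall m, (N <= m)%N ->
   [/\ nrecords x w (Trec x m w) = m, (m <= Trec x m w)%N & regular (c q) (Trec x m w) w]}.
  by apply: ae_foralln => q; apply: ev_ae; apply: ev_Trec; exact: ev_regular.
have a3 : {ae P, forall w, forall q, forall N, exists2 m, (N <= m)%N &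
   `| ratio m w - e%:R / d%:R | <= 6 * c q}.
  by apply: ae_foralln => q; apply: whp_io; exact: whp_ratio.
have a4 : {ae P, forall w, forall q, forall N, exists2 n, (N <= n)%N &
     level (d%:R - c q) n.+1 <= tot X n w}.
  by apply: ae_foralln => q; exact: (ae_tot_io expX indep e0).
near=> w.
have h1 : forall q, exists N, forall n, (N <= n)%N -> regular (c q) n w by near: w.
have h2 : forall q, exists N, forall m, (N <= m)%N ->
   [/\ nrecords x w (Trec x m w) = m, (m <= Trec x m w)%N & regular (c q) (Trec x m w) w].
  by near: w.
have h3 : forall q, forall N, exists2 m, (N <= m)%N &
   `| ratio m w - e%:R / d%:R | <= 6 * c q by near: w.
have h4 : forall q, forall N, exists2 n, (N <= n)%N &
     level (d%:R - c q) n.+1 <= tot X n w by near: w.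
split; [apply: limn_einf_EFin|apply: limn_esup_EFin] => eps /small[q hq].
- have [N hN] := h2 q; exists N => m /hN[rT _ reg].
  by apply: le_trans (ratio_ge_regular (c01 q) rT reg); rewrite lerB.
- move=> N; have [m Nm] := h3 q N; rewrite ler_distl => /andP[_ hm].
  by exists m => //; apply: le_trans hm _; rewrite lerD2l.
- have [N hN] := h2 q; exists N => m /hN[rT _ reg].
  by apply: le_trans (ratio_le_regular (c01 q) rT reg) _; rewrite lerD2l.
(* A large total at vector n gives a large width at time n + 1, whether or not n is a record; the
   corresponding m is the record count at n + 1, and n >= T_m0 makes it at least m0. *)
- move=> N; have [N1 hN1] := h1 q; have [N2 hN2] := h2 q.
  pose m0 := maxn N N2.
  have [rT0 _ _] := hN2 m0 (leq_maxr _ _).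
  have [n] := h4 q (maxn N1 (Trec x m0 w)).
  rewrite geq_max => /andP[N1n Tn] hn.
  exists (nrecords x w n.+1).
    apply: leq_trans (leq_maxl N N2) _; rewrite -/m0 -rT0.
    by apply: nrecords_mono; exact: leqW.
  rewrite Wtilde_nrecords.
  have [[pos u0] /andP[f1 f2] _ /andP[r1 r2]] := hN1 n.+1 (leqW N1n).
  have dd : 0 <= (d%:R : R) <= d%:R by rewrite ler0n lexx.
  have dn0 : d%:R != 0 :> R by rewrite pnatr_eq0.
  apply: (@le_trans _ _ (d%:R / d%:R - 6 * c q)); first by rewrite divff// lerB.
  apply: (ratio_ge dR2 dd (c01 q) u0 _ r1 r2).
  have fp : tot X n w <= Fplus x n.+1 w by exact: Fplus_ge.
  have := le_trans hn fp; rewrite /Wn; move: f2; rewrite /level.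
  move: (ln n.+1%:R) (Fplus _ _ _) (Fminus _ _ _) => l a b; lra.
Unshelve. all: by end_near.
Qed.

End width.

Theorem theorem5p6 (R : realType) (d0 : measure_display) (Omega : measurableType d0)
    (P : probability Omega R) (d : nat) (X : nat -> 'I_d -> {RV P >-> R}) :
  (0 < d)%N ->
  (forall k j A, measurable A -> P (X k j @^-1` A) = exponential_prob 1 A) ->
  mutually_independent P (fun kj : nat * 'I_d => (X kj.1 kj.2 : Omega -> R)) ->
  (forall eps : R, 0 < eps ->
     exists B : nat -> set Omega,
       (forall m, measurable (B m) /\
          [set w | eps <= `| Wtilde (fun k j => X k j) m w / ln m%:R - (1 - d%:R^-1) | ]
            `<=` B m) /\
       (fun m => P (B m)) @ \oo --> 0%E)
  /\
  ((1 < d)%N ->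
     {ae P, forall w,
        limn_einf (fun m => (Wtilde (fun k j => X k j) m w / ln m%:R)%:E)
          = (1 - d%:R^-1)%:E /\
        limn_esup (fun m => (Wtilde (fun k j => X k j) m w / ln m%:R)%:E) = 1%:E}).
Proof.
case: d X => [//|[|e]] X _ expX indep.
  split=> // eps eps0; exists (fun=> set0); split; last first.
    by rewrite (_ : (fun m => P set0) = cst 0%E); [exact: cvg_cst|apply/funext => m; rewrite measure0].
  move=> m; split=> // w /=.
  by rewrite /Wtilde Wn_dim1// mul0r invr1 subrr subrr normr0 leNgt eps0.
have eE : 1 - e.+2%:R^-1 = e.+1%:R / e.+2%:R :> R.
  have n0 : e.+2%:R != 0 :> R by rewrite pnatr_eq0.
  by rewrite -[X in X - _](divff n0) -[X in _ / _ - X]mul1r -mulrBl -natr1 addrK.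
rewrite eE; split=> [eps eps0|_]; last exact: ae_limits.
(* Then 6c <= eps / 2 < eps, as the excluded deviations satisfy the weak inequality. *)
pose c := Num.min 2^-1 (eps / 12).
have c01 : 0 < c <= 2^-1.
  by rewrite lt_min ge_min lexx /= andbT invr_gt0 ltr0n divr_gt0.
have := whp_cover (whp_ratio expX indep (ltn0Sn e) c01).
move=> [B [hB cB]]; exists B; split=> // m; have [mB sB] := hB m.
split=> // w /= hw; apply: sB => /= hc; have := le_trans hw hc.
apply/negP; rewrite -ltNge; apply: (@le_lt_trans _ _ (6 * (eps / 12))).
  by rewrite ler_wpM2l// ge_min lexx orbT.
lra.
Qed.
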